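(* Let $m\ge0$, $\mathbf x=(x_1,\dots,x_{m+1})$, $\mathbf y=(y_1,\dots,y_{m+1})$, $\mathbf x'=(x_1,\dots,x_m)$, $\mathbf y'=(y_1,\dots,y_m)$. Then \[ Z^{(+)}_{\mathrm{HT}}(2m+1;\mathbf x,\mathbf y)=\frac{(a+\bar a)Z(m+1;\mathbf x,\mathbf y)Z^{(2)}_{\mathrm{HT}}(2m;\mathbf x',\mathbf y')-(x_{m+1}\bar y_{m+1}+\bar x_{m+1}y_{m+1})Z(m;\mathbf x',\mathbf y')Z^{(2)}_{\mathrm{HT}}(2m+2;\mathbf x,\mathbf y)}{\sigma(a)\,\sigma(a x_{m+1}\bar y_{m+1})\,\sigma(a\bar x_{m+1}y_{m+1})}, \] \[ Z^{(-)}_{\mathrm{HT}}(2m+1;\mathbf x,\mathbf y)=\frac{-(x_{m+1}\bar y_{m+1}+\bar x_{m+1}y_{m+1})Z(m+1;\mathbf x,\mathbf y)Z^{(2)}_{\mathrm{HT}}(2m;\mathbf x',\mathbf y')+(a+\bar a)Z(m;\mathbf x',\mathbf y')Z^{(2)}_{\mathrm{HT}}(2m+2;\mathbf x,\mathbf y)}{\sigma(a)\,\sigma(a x_{m+1}\bar y_{m+1})\,\sigma(a\bar x_{m+1}y_{m+1})}. \]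
   Context: Notation: $\bar z=z^{-1}$, $\sigma(z)=z-z^{-1}$; $a$ is a fixed (generic) nonzero complex parameter. Vertex weights: at a vertex where a horizontal and a vertical line cross, the four incident edges are oriented with exactly two pointing into the vertex (ice rule). Type 1: both horizontal edges point in, both vertical out; type 2: horizontal out, vertical in; type 3: horizontal edges point right, vertical up; type 4: horizontal left, vertical down; type 5: horizontal left, vertical up; type 6: horizontal right, vertical down. A vertex with spectral parameter $z$ has weight $\sigma(a^2)$ (types 1,2), $\sigma(az)$ (types 3,4), $\sigma(a\bar z)$ (types 5,6). A state is an orientation of all internal edges obeying the ice rule at every vertex; its weight is the product of the vertex weights; a partition function is the sum of weights of states. Domain-wall model: $Z(n;\mathbf x,\mathbf y)$ ($\mathbf x,\mathbf y$ of length $n$) is the partition function on the $n\times n$ grid of vertices $(i,j)$ (row $i$ from the top, column $j$ from the left), vertex $(i,j)$ having parameter $x_i\bar y_j$; horizontal boundary edges point into the grid, vertical boundary edges point out of it. $Z(0)=1$. Even half-turn model: for $\mathbf x,\mathbf y$ of length $m$, $Z_{\mathrm{HT}}(2m;\mathbf x,\mathbf y)$ is the partition function on vertices $(r,j)$, $1\le r\le 2m$, $1\le j\le m$, vertex $(r,j)$ having parameter $x_{\min(r,2m+1-r)}\bar y_j$; left boundary edges point right, top boundary edges up, bottom boundary edges down; for each $r\le m$ the edges to the right of $(r,m)$ and of $(2m+1-r,m)$ form one single edge (U-turn) with one orientation. $Z_{\mathrm{HT}}(0)=1$, and $Z^{(2)}_{\mathrm{HT}}(2m;\mathbf x,\mathbf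 y):=Z_{\mathrm{HT}}(2m;\mathbf x,\mathbf y)/Z(m;\mathbf x,\mathbf y)$. Odd half-turn model: for $\mathbf x,\mathbf y$ of length $m+1$, the vertices are $(r,j)$ with $1\le r\le 2m+1$, $1\le j\le m$, and $(r,m+1)$ with $m+2\le r\le 2m+1$; vertex $(r,j)$ has parameter $x_{\min(r,2m+2-r)}\bar y_j$. Edges join consecutive vertices in rows and columns. Left boundary edges point right, top boundary edges of columns $1..m$ point up, bottom boundary edges of columns $1..m+1$ point down. The edge right of $(m+1,m)$ and the edge above $(m+2,m+1)$ form one single edge, pointing right out of $(m+1,m)$ iff pointing down into $(m+2,m+1)$. For each $r\le m$, the edges right of $(r,m)$ and right of $(2m+2-r,m+1)$ form one single edge with one orientation. States correspond bijectively to $(2m+1)\times(2m+1)$ half-turn symmetric alternating-sign matrices (vertex types 1, 2, others giving entries $1,-1,0$ in columns $1..m$ and in positions $(r,m+1)$, $r\ge m+2$); the central entry $(m+1,m+1)$ of the matrix is $1$ if the joined middle edge points out of $(m+1,m)$ and into $(m+2,m+1)$, and $-1$ otherwise. $Z^{(+)}_{\mathrm{HT}}(2m+1;\mathbf x,\mathbf y)$, resp. $Z^{(-)}_{\mathrm{HT}}(2m+1;\mathbf x,\mathbf y)$, is the sum of the weights of the states whose corresponding matrix has central entry $1$, resp. $-1$ (for $m=0$: $Z^{(+)}_{\mathrm{HT}}(1)=1$, $Z^{(-)}_{\mathrm{HT}}(1)=0$). *)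

(* Defs.v *)
From mathcomp Require Import all_boot all_algebra.
From mathcomp Require Export complex reals.
Set Implicit Arguments.
Unset Strict Implicit.
Unset Printing Implicit Defensive.
Import GRing.Theory.
Local Open Scope ring_scope.

(* Six-vertex models; all definitions over an arbitrary field F.
   Edge orientations are booleans:
   - a horizontal edge carries [true] iff it points RIGHT;
   - a vertical edge carries [true] iff it points UP.
   At a vertex, L/R are the edges to its left/right, U/D the edges above/below it. *)

Definition sigma {F : fieldType} (z : F) : F := z - z^-1.

Definition vtype1 (L R U D : bool) := [&& L, ~~ R, U & ~~ D].
Definition vtype2 (L R U D : bool) := [&& ~~ L, R, ~~ U & D].
Definition vtype3 (L R U D : bool) := [&& L, R, U & D].
Definition vtype4 (L R U D : bool) := [&& ~~ L, ~~ R, ~~ U & ~~ D].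
Definition vtype5 (L R U D : bool) := [&& ~~ L, ~~ R, U & D].
Definition vtype6 (L R U D : bool) := [&& L, R, ~~ U & ~~ D].

(* ice rule: exactly two of the four incident edges point into the vertex *)
Definition ice (L R U D : bool) : bool :=
  [|| vtype1 L R U D, vtype2 L R U D, vtype3 L R U D, vtype4 L R U D,
      vtype5 L R U D | vtype6 L R U D].

Definition vweight {F : fieldType} (a z : F) (L R U D : bool) : F :=
  if vtype1 L R U D || vtype2 L R U D then sigma (a ^+ 2)
  else if vtype3 L R U D || vtype4 L R U D then sigma (a * z)
  else if vtype5 L R U D || vtype6 L R U D then sigma (a * z^-1)
  else 0.

(* Parameters x, y are given as functions nat -> F, index k standing for the
   paper's x_{k+1}; rows/columns are numbered from 0. *)

(* ---------- Domain-wall model Z(n; x, y) ----------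
   h (i, j) : horizontal edge to the left of vertex (i, j) (j = n: right boundary)
   v (i, j) : vertical edge above vertex (i, j) (i = n: bottom boundary) *)
Definition dw_state (n : nat) (h : {ffun 'I_n * 'I_n.+1 -> bool})
    (v : {ffun 'I_n.+1 * 'I_n -> bool}) : bool :=
  [&& [forall i : 'I_n, h (i, ord0) && ~~ h (i, ord_max)],
      [forall j : 'I_n, v (ord0, j) && ~~ v (ord_max, j)] &
      [forall i : 'I_n, forall j : 'I_n,
         ice (h (i, inord j)) (h (i, inord j.+1)) (v (inord i, j)) (v (inord i.+1, j))]].

Definition Zdw {F : fieldType} (a : F) (n : nat) (x y : nat -> F) : F :=
  \sum_(s : {ffun 'I_n * 'I_n.+1 -> bool} * {ffun 'I_n.+1 * 'I_n -> bool}
          | dw_state s.1 s.2)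
    \prod_(i < n) \prod_(j < n)
      vweight a (x i / y j) (s.1 (i, inord j)) (s.1 (i, inord j.+1))
                            (s.2 (inord i, j)) (s.2 (inord i.+1, j)).

(* ---------- Even half-turn model Z_HT(2m; x, y) ----------
   rows r : 'I_(2m), columns j : 'I_m; row r has parameter x_(min(r, 2m-1-r)).
   h (r, m) is the edge to the right of (r, m-1); for r < m it is joined (U-turn)
   with h (2m-1-r, m), the orientation being consistent along the U-turn. *)
Definition ht_even_state (m : nat) (h : {ffun 'I_(2 * m) * 'I_m.+1 -> bool})
    (v : {ffun 'I_(2 * m).+1 * 'I_m -> bool}) : bool :=
  [&& [forall r : 'I_(2 * m), h (r, ord0)],
      [forall j : 'I_m, v (ord0, j) && ~~ v (ord_max, j)],
      [forall r : 'I_(2 * m), (r < m)%N ==> (h (rev_ord r, ord_max) == ~~ h (r, ord_max))] &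
      [forall r : 'I_(2 * m), forall j : 'I_m,
         ice (h (r, inord j)) (h (r, inord j.+1)) (v (inord r, j)) (v (inord r.+1, j))]].

Definition ZHT_even {F : fieldType} (a : F) (m : nat) (x y : nat -> F) : F :=
  \sum_(s : {ffun 'I_(2 * m) * 'I_m.+1 -> bool} * {ffun 'I_(2 * m).+1 * 'I_m -> bool}
          | ht_even_state s.1 s.2)
    \prod_(r < 2 * m) \prod_(j < m)
      vweight a (x (minn r (rev_ord r)) / y j) (s.1 (r, inord j)) (s.1 (r, inord j.+1))
                            (s.2 (inord r, j)) (s.2 (inord r.+1, j)).

Definition ZHT2 {F : fieldType} (a : F) (m : nat) (x y : nat -> F) : F :=
  ZHT_even a m x y / Zdw a m x y.

(* ---------- Odd half-turn model ----------
   rows r : 'I_(2m+1), columns j : 'I_(m+1); vertex (r, j) exists iff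
   j < m, or j = m and r > m.  Row r has parameter x_(min(r, 2m-r)).
   h (r, j) : horizontal edge left of column j (j = 0..m+1);
   v (r, j) : vertical edge above row r (r = 0..2m+1).
   Joined edges:
   - h (m, m) (right of (m, m-1)) with v (m+1, m) (above (m+1, m)):
     points right iff points down;
   - for r < m, h (r, m) (right of (r, m-1)) with h (2m-r, m+1) (right of (2m-r, m)),
     one orientation: points right at row r iff points left at row 2m-r.
   Edge variables not belonging to the lattice (h (r, m+1) and v (r, m) for r <= m)
   are pinned to [false] so that they do not contribute.
   The central ASM entry is 1 iff h (m, m) is [true]. *)
Definition overtex (m r j : nat) : bool := [|| (j < m)%N | (j == m) && (m < r)%N].

Definition ht_odd_state (m : nat) (h : {ffun 'I_(2 * m).+1 * 'I_m.+2 -> bool})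
    (v : {ffun 'I_(2 * m).+2 * 'I_m.+1 -> bool}) : bool :=
  [&& [forall r : 'I_(2 * m).+1, h (r, ord0)],
      [forall j : 'I_m.+1, (j < m)%N ==> v (ord0, j)],
      [forall j : 'I_m.+1, ~~ v (ord_max, j)],
      v (inord m.+1, ord_max) == ~~ h (inord m, inord m),
      [forall r : 'I_(2 * m).+1,
         (r < m)%N ==> (h (inord (2 * m - r), ord_max) == ~~ h (r, inord m))],
      [forall r : 'I_(2 * m).+1, (r <= m)%N ==> ~~ h (r, ord_max)],
      [forall r : 'I_(2 * m).+2, (r <= m)%N ==> ~~ v (r, ord_max)] &
      [forall r : 'I_(2 * m).+1, forall j : 'I_m.+1, overtex m r j ==>
         ice (h (r, inord j)) (h (r, inord j.+1)) (v (inord r, j)) (v (inord r.+1, j))]].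

Definition ZHT_odd {F : fieldType} (sign : bool) (a : F) (m : nat) (x y : nat -> F) : F :=
  \sum_(s : {ffun 'I_(2 * m).+1 * 'I_m.+2 -> bool} * {ffun 'I_(2 * m).+2 * 'I_m.+1 -> bool}
          | ht_odd_state s.1 s.2 && (s.1 (inord m, inord m) == sign))
    \prod_(r < (2 * m).+1) \prod_(j < m.+1 | overtex m r j)
      vweight a (x (minn r (2 * m - r)) / y j) (s.1 (r, inord j)) (s.1 (r, inord j.+1))
                            (s.2 (inord r, j)) (s.2 (inord r.+1, j)).

Definition ZHTplus {F : fieldType} (a : F) m (x y : nat -> F) := ZHT_odd true a m x y.
Definition ZHTminus {F : fieldType} (a : F) m (x y : nat -> F) := ZHT_odd false a m x y.

(* Main.v *)
(** Write [z = x_{m+1} / y_{m+1}].  The theorem is the solution of the linear system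
      sigma(a^2) Z(+)            + sigma(a) (z + 1/z) Z(-)  =  Z(m+1; x, y) Z2(2m; x', y'),
      sigma(a) (z + 1/z) Z(+)  + sigma(a^2) Z(-)            =  Z(m; x', y') Z2(2m+2; x, y),
    whose determinant is [sigma(a)^2 sigma(a z) sigma(a / z)].
    By the Yang-Baxter equation the partition functions are symmetric in the row and in the
    column parameters, so each identity can be proved by Laurent interpolation: at
    [x = a^{-1} y] or [x = a y] a corner of the lattice freezes.  The half-turn factor [Z2]
    is given independently by the expansion of a determinant.  For the even model one
    treats, more generally, two innermost rows with independent parameters [u], [v]: two
    combinations of its two refinements (by the orientation of the innermost U-turn) factor
    as [Z * Z2], by interpolation in the outermost row.  For the odd model one interpolates
    in [y_{m+1}] at [x_i / a]: there the line of [x_i] can be pulled through the other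
    lines, which leaves that refined even model for [i <= m], and the even model for
    [i = m+1].  This requires the parameters to be in general position; the exceptional
    ones follow by specialization along a polynomial curve. *)

Require Import Defs.
From mathcomp Require Import all_boot all_algebra.
From mathcomp Require Import complex reals.
From mathcomp Require Import ring zify.
Set Implicit Arguments.
Unset Strict Implicit.
Unset Printing Implicit Defensive.
Import GRing.Theory.
Local Open Scope ring_scope.

(** * Yang-Baxter commutation of rows *)

(** An identity containing [Z2] can be interpolated only if [Z2] is a Laurent polynomial in the
    variable, which is not visible from a quotient of partition functions. The expansion makes its
    poles explicit; in the rows they cancel by antisymmetry, and there characteristic 2 is excluded.
    The function [htw z = sigma a * (z + z^-1)] fits the nodes: at [z = a] and at [z = a^-1] it
    equals [sigma (a ^+ 2)], the weight of a turn, so that [Z2] obeys there the same recursion as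
    [Z]. The coefficients of the two factorizations of the refined even model come from the case of
    one column; frozen lines carry them unchanged to every size. For [u = v] the coefficients agree,
    and [HT = Z * Z2] results. The odd model at [y_{m+1} = x_i / a], [i <= m], produces exactly
    these two combinations, with [u = x_{m+1}] and [v = x_i]. The first relation has [m + 1] terms
    in [y_{m+1}], as many as there are nodes [x_i / a]. The second has one more; its additional node
    is [a * x_{m+1}], where the left-hand sides of both relations coincide. *)

Section SixVertex.
Variables (F : fieldType) (a : F).
Implicit Types (z x y u v p : F) (zs xs ys X : seq F) (l r b : bool).
Implicit Types (us ds ls rs ms : seq bool).

(** Reflection in the main diagonal followed by reversal of all arrows: types 1 to 4 are fixed, and
    types 5 and 6, of equal weight, are exchanged. *)
Lemma vweight_tr z l r b c : vweight a z l r b c = vweight a z b c l r.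
Proof. by case: l r b c => [] [] [] []. Qed.

(** Rotation by 180 degrees. Booleans record absolute directions, so each edge is negated when it
    moves; this is the source of the [rev (map negb _)] below. *)
Lemma vweight_rot z l r b c :
  vweight a z (~~ r) (~~ l) (~~ c) (~~ b) = vweight a z l r b c.
Proof. by case: l r b c => [] [] [] []. Qed.

(** The third vertex is the crossing of the two rows: the line of [p * z] passes it from left to
    right, that of [z] from bottom to top. In this position its parameter is the ratio [p] shifted
    by [a]. The proof checks the 64 choices of outer edges. *)
Lemma vweight_YBE p z (l1 l2 u d q c : bool) : a != 0 -> p != 0 -> z != 0 ->
  \sum_(b1 : bool) \sum_(b2 : bool) \sum_(m : bool)
     vweight a (p * z) l1 b1 u m * vweight a z l2 b2 m d * vweight a (a * p) b1 q c b2
  = \sum_(q' : bool) \sum_(c' : bool) \sum_(m : bool)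
     vweight a (a * p) l1 q' c' l2 * vweight a z c' c u m * vweight a (p * z) q' q m d.
Proof.
move=> a0 p0 z0; rewrite !big_bool /=.
case: l1 l2 u d q c => [] [] [] [] [] []; rewrite /vweight /= /sigma ?mulr0 ?mul0r ?addr0 ?add0r //.
all: field; rewrite ?a0 ?p0 ?z0 ?oner_neq0 //.
Qed.

(** Edge configurations are sequences, so that sums over them split along [::] and [++] when
    lattices are cut. *)
Fixpoint words n : seq (seq bool) :=
  if n is k.+1 then map (cons true) (words k) ++ map (cons false) (words k)
  else [:: [::]].

Lemma mem_words n us : (us \in words n) = (size us == n).
Proof.
elim: n us => [|n IH] [|b us] //=; rewrite mem_cat.
  by apply/norP; split; apply/mapP => -[].
rewrite eqSS -IH; apply/orP/idP => [[]/mapP[s Hs [_ ->]] //|Hu].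
by case: b; [left|right]; apply/map_f.
Qed.

Lemma size_words n us : us \in words n -> size us = n.
Proof. by rewrite mem_words => /eqP. Qed.

Lemma words_uniq n : uniq (words n).
Proof.
elim: n => //= n IH; rewrite cat_uniq !map_inj_uniq ?IH //=; try by move=> ? ? [].
by rewrite andbT; apply/hasPn => s /mapP[t _ ->]; apply/mapP => -[].
Qed.

Lemma big_words0 (f : seq bool -> F) : \sum_(s <- words 0) f s = f [::].
Proof. by rewrite big_seq1. Qed.

Lemma big_wordsS n (f : seq bool -> F) :
  \sum_(s <- words n.+1) f s = \sum_(b : bool) \sum_(s <- words n) f (b :: s).
Proof. by rewrite big_cat !big_map big_bool. Qed.

Lemma big_words_cat m n (f : seq bool -> F) :
  \sum_(s <- words (m + n)) f s
  = \sum_(s <- words m) \sum_(t <- words n) f (s ++ t).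
Proof.
elim: m f => [|m IH] f; first by rewrite big_words0.
by rewrite addSn !big_wordsS; apply: eq_bigr => b _; rewrite IH.
Qed.

Lemma big_words_reindex n (h : seq bool -> seq bool) (f : seq bool -> F) :
  injective h -> (forall s, size (h s) = size s) ->
  \sum_(s <- words n) f (h s) = \sum_(s <- words n) f s.
Proof.
move=> hI hs; rewrite -(big_map h xpredT f).
apply: perm_big; apply: uniq_perm; rewrite ?map_inj_uniq ?words_uniq //.
have sub : {subset map h (words n) <= words n}.
  by move=> s /mapP[t Ht ->]; rewrite mem_words hs -mem_words.
have := uniq_min_size _ sub; rewrite map_inj_uniq // words_uniq size_map => /(_ isT).
by rewrite leqnn => /(_ isT)[_ E] s; rewrite E.
Qed.

Lemma big_words_delta n us (f : seq bool -> F) : size us = n ->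
  \sum_(s <- words n) (us == s)%:R * f s = f us.
Proof.
move=> Hu; rewrite (bigD1_seq us) ?words_uniq ?mem_words ?Hu //= eqxx mul1r.
by rewrite big1 ?addr0 // => s; rewrite eq_sym => /negPf->; rewrite mul0r.
Qed.

Lemma big_bool_delta b (f : bool -> F) : \sum_(c : bool) (b == c)%:R * f c = f b.
Proof. by rewrite big_bool; case: b; rewrite /= ?eqxx mul1r mul0r ?addr0 ?add0r. Qed.

Fixpoint rowZ zs l us ds r : F :=
  match zs, us, ds with
  | [::], [::], [::] => (l == r)%:R
  | z :: zs, u :: us, d :: ds =>
      \sum_(b : bool) vweight a z l b u d * rowZ zs b us ds r
  | _, _, _ => 0
  end.

(* Left and right edges [ls], [rs] of the rows, top and bottom edges [us], [ds] of
   the columns; the vertex in row [x] and column [y] has parameter [f x y]. *)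
Fixpoint gridZ (f : F -> F -> F) xs ys ls rs us ds : F :=
  match xs, ls, rs with
  | [::], [::], [::] => ((us == ds) && (size us == size ys))%:R
  | x :: xs, l :: ls, r :: rs =>
      \sum_(ms <- words (size ys)) rowZ (map (f x) ys) l us ms r * gridZ f xs ys ls rs ms ds
  | _, _, _ => 0
  end.

Lemma row_sizeu zs l us ds r : size us != size zs -> rowZ zs l us ds r = 0.
Proof.
elim: zs l us ds => [|z zs IH] l [|u us] [|d ds] //= H.
by rewrite big1 // => b _; rewrite IH ?mulr0.
Qed.

Lemma row_sized zs l us ds r : size ds != size zs -> rowZ zs l us ds r = 0.
Proof.
elim: zs l us ds => [|z zs IH] l [|u us] [|d ds] //= H.
by rewrite big1 // => b _; rewrite IH ?mulr0.
Qed.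

Lemma grid_sizeu f xs ys ls rs us ds : size us != size ys -> gridZ f xs ys ls rs us ds = 0.
Proof.
case: xs ls rs => [|x xs] [|l ls] [|r rs] //= H; first by rewrite (negPf H) andbF.
by rewrite big1 // => ms _; rewrite row_sizeu ?mul0r ?size_map.
Qed.

Lemma grid_sized f xs ys ls rs us ds : size ds != size ys -> gridZ f xs ys ls rs us ds = 0.
Proof.
elim: xs ls rs us => [|x xs IH] [|l ls] [|r rs] us //= H.
  by case: eqP => // ->; rewrite (negPf H).
by rewrite big1 // => ms _; rewrite IH ?mulr0.
Qed.

(** Rows and columns sum the same weights in different order. The induction on the rows peels one
    vertex off the first column, which [vweight_tr] reads as a vertex of the transposed lattice. *)
Lemma grid_colS f xs y ys ls rs (u : bool) us (d : bool) ds :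
  gridZ f xs (y :: ys) ls rs (u :: us) (d :: ds) =
  \sum_(ms <- words (size xs)) rowZ (map (f^~ y) xs) u ls ms d * gridZ f xs ys ms rs us ds.
Proof.
elim: xs ls rs u us => [|x xs IH] [|l ls] [|r rs] u us; rewrite ?big_words0 //=.
- rewrite -mulnb natrM -[(size us).+1 == _]/(size us == size ys) eqseq_cons.
  by case: (u == d); case: (us == ds); case: (size us == _); rewrite ?mul0r ?mul1r ?mulr0.
- by rewrite mulr0.
- by rewrite mul0r.
- by rewrite mul0r.
- by rewrite big1 // => ms _; rewrite mul0r.
- by rewrite big1 // => ms _; rewrite mul0r.
- by rewrite (big_wordsS (size xs)) big1 // => b _; rewrite big1 // => s _; rewrite mulr0.
rewrite !big_wordsS.
under eq_bigr => m _ do under eq_bigr => ms _ do rewrite /= IH mulr_suml.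
under [RHS]eq_bigr => q _ do under eq_bigr => qs _ do rewrite /= mulr_suml.
under [RHS]eq_bigr => q _ do rewrite exchange_big /=.
rewrite [RHS]exchange_big /=; apply: eq_bigr => m _.
under eq_bigr => ms _ do (under eq_bigr => b _ do rewrite mulr_sumr).
rewrite exchange_big /=; apply: eq_bigr => b _.
rewrite exchange_big /=; apply: eq_bigr => qs _.
rewrite mulr_sumr; apply: eq_bigr => ms _.
by rewrite vweight_tr; ring.
Qed.

Lemma grid_row0 f xs ls rs us ds :
  gridZ f xs [::] ls rs us ds
  = ((ls == rs) && (size ls == size xs))%:R * ((us == [::]) && (ds == [::]))%:R.
Proof.
elim: xs ls rs us => [|x xs IH] [|l ls] [|r rs] us; rewrite ?andbF ?mul0r ?mul1r //=.
  by case: us => [|? ?]; case: ds => [|? ?]; rewrite ?eqxx ?andbF //= andbF.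
rewrite big_words0 IH eqseq_cons eqSS /=; case: us => [|? ?]; last by rewrite mul0r mulr0.
by rewrite -!mulnb !natrM !mulrA.
Qed.

Lemma grid_tr f xs ys ls rs us ds :
  gridZ f xs ys ls rs us ds = gridZ (fun y x => f x y) ys xs us ds ls rs.
Proof.
elim: ys ls us ds => [|y ys IH] ls us ds.
  rewrite grid_row0; case: us => [|u us]; case: ds => [|d ds]; rewrite ?mulr1 ?mulr0 //=.
case: us => [|u us]; first by rewrite grid_sizeu.
case: ds => [|d ds]; first by rewrite grid_sized.
by rewrite grid_colS; apply: eq_bigr => ms _; rewrite IH.
Qed.

Lemma row_cat zs1 zs2 l us1 us2 ds1 ds2 r :
  size us1 = size zs1 -> size ds1 = size zs1 ->
  rowZ (zs1 ++ zs2) l (us1 ++ us2) (ds1 ++ ds2) r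
  = \sum_(b : bool) rowZ zs1 l us1 ds1 b * rowZ zs2 b us2 ds2 r.
Proof.
elim: zs1 l us1 ds1 => [|z zs IH] l [|u us] [|d ds] //= => [_ _|[Hu] [Hd]].
  by rewrite big_bool_delta.
under eq_bigr => b _ do rewrite IH // mulr_sumr.
rewrite exchange_big /=; apply: eq_bigr => c _.
by rewrite mulr_suml; apply: eq_bigr => b _; rewrite mulrA.
Qed.

Lemma grid_catr f xs1 xs2 ys ls1 ls2 rs1 rs2 us ds :
  size ls1 = size xs1 -> size rs1 = size xs1 ->
  gridZ f (xs1 ++ xs2) ys (ls1 ++ ls2) (rs1 ++ rs2) us ds
  = \sum_(ms <- words (size ys)) gridZ f xs1 ys ls1 rs1 us ms * gridZ f xs2 ys ls2 rs2 ms ds.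
Proof.
elim: xs1 ls1 rs1 us => [|x xs IH] [|l ls] [|r rs] us //= => [_ _|[Hl] [Hr]].
  case: (eqVneq (size us) (size ys)) => Hs.
    by under eq_bigr => ms _ do rewrite andbT; rewrite big_words_delta.
  rewrite grid_sizeu // big1 // => ms _; rewrite andbF mul0r //.
under eq_bigr => b _ do rewrite IH // mulr_sumr.
rewrite exchange_big /=; apply: eq_bigr => c _.
by rewrite mulr_suml; apply: eq_bigr => b _; rewrite mulrA.
Qed.

Lemma grid_catc f xs ys1 ys2 ls rs us1 us2 ds1 ds2 :
  size us1 = size ys1 -> size ds1 = size ys1 ->
  gridZ f xs (ys1 ++ ys2) ls rs (us1 ++ us2) (ds1 ++ ds2)
  = \sum_(ms <- words (size xs)) gridZ f xs ys1 ls ms us1 ds1 * gridZ f xs ys2 ms rs us2 ds2.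
Proof.
move=> Hu Hd; rewrite grid_tr grid_catr //.
by apply: eq_bigr => ms _; congr (_ * _); rewrite [LHS]grid_tr.
Qed.

Lemma grid1r f x ys l r us ds :
  gridZ f [:: x] ys [:: l] [:: r] us ds = rowZ (map (f x) ys) l us ds r.
Proof.
rewrite /=; case: (eqVneq (size ds) (size ys)) => Hs.
  rewrite -[RHS](big_words_delta (n := size ys) (fun ms => rowZ (map (f x) ys) l us ms r)) //.
  rewrite big_seq [RHS]big_seq; apply: eq_bigr => ms Hm.
  by rewrite mulrC (size_words Hm) eqxx andbT eq_sym.
rewrite row_sized ?size_map // big_seq big1 // => ms Hm.
case: eqP => [E|_]; last by rewrite mulr0.
by rewrite -E (size_words Hm) eqxx in Hs.
Qed.

Lemma row_rot zs l us ds r : size us = size zs -> size ds = size zs ->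
  rowZ (rev zs) (~~ r) (rev (map negb ds)) (rev (map negb us)) (~~ l) = rowZ zs l us ds r.
Proof.
elim: zs l us ds => [|z zs IH] l [|u us] [|d ds] //= => [_ _|[Hu] [Hd]].
  by case: l r => [] [].
rewrite !rev_cons -!cats1 row_cat ?size_rev ?size_map //.
rewrite (reindex_inj negb_inj) /=; apply: eq_bigr => b _.
rewrite IH // mulrC; congr (_ * _).
rewrite /=; rewrite big_bool /=.
case: l; rewrite ?mulr0 ?addr0 ?add0r ?mulr1 ?[vweight _ _ _ true]vweight_rot.
  by rewrite -[false]/(~~ true) vweight_rot.
by rewrite -[true]/(~~ false) vweight_rot.
Qed.

Lemma negbs_inj : injective (fun s : seq bool => rev (map negb s)).
Proof. by move=> s t /(can_inj revK) /(inj_map negb_inj). Qed.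

Lemma size_revneg (s : seq bool) : size (rev (map negb s)) = size s.
Proof. by rewrite size_rev size_map. Qed.

Lemma grid_rot f xs ys ls rs us ds :
  size ls = size xs -> size rs = size xs -> size us = size ys -> size ds = size ys ->
  gridZ f (rev xs) (rev ys) (rev (map negb rs)) (rev (map negb ls))
    (rev (map negb ds)) (rev (map negb us)) = gridZ f xs ys ls rs us ds.
Proof.
move=> Hl Hr Hu Hd; elim: xs ls rs us Hl Hr Hu => [|x xs IH] [|l ls] [|r rs] us //=.
  by move=> _ _ Hu; rewrite (inj_eq negbs_inj) !size_rev size_map Hd Hu eq_sym.
move=> [Hl] [Hr] Hu; rewrite !rev_cons -!cats1 grid_catr ?size_revneg ?size_rev //.
rewrite -[LHS](@big_words_reindex _ _ _ negbs_inj size_revneg).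
rewrite big_seq [RHS]big_seq; apply: eq_bigr => ms Hm.
have Hm' : size ms = size ys by rewrite (size_words Hm).
by rewrite IH // grid1r map_rev row_rot ?size_map // mulrC.
Qed.

Definition rowZ2 zs1 zs2 l1 l2 us ds r1 r2 : F :=
  \sum_(ms <- words (size us)) rowZ zs1 l1 us ms r1 * rowZ zs2 l2 ms ds r2.

Lemma row2_cons z1 zs1 z2 zs2 l1 l2 (u : bool) us (d : bool) ds r1 r2 :
  rowZ2 (z1 :: zs1) (z2 :: zs2) l1 l2 (u :: us) (d :: ds) r1 r2
  = \sum_(b1 : bool) \sum_(b2 : bool) \sum_(m : bool)
      vweight a z1 l1 b1 u m * vweight a z2 l2 b2 m d * rowZ2 zs1 zs2 b1 b2 us ds r1 r2.
Proof.
rewrite /rowZ2 [size _]/= big_wordsS /=.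
under eq_bigr => m _.
  under eq_bigr => ms _ do rewrite mulr_suml.
  rewrite exchange_big /=.
  under eq_bigr => b1 _ do (under eq_bigr => ms _ do rewrite mulr_sumr; rewrite exchange_big /=).
over.
rewrite exchange_big /=; apply: eq_bigr => b1 _.
rewrite exchange_big /=; apply: eq_bigr => b2 _.
apply: eq_bigr => m _; rewrite mulr_sumr; apply: eq_bigr => ms _; ring.
Qed.

(** The train argument: a crossing of the two rows placed at their right ends travels through all
    columns and comes out at the left ends, with the rows exchanged. *)
Lemma RTT p zs l1 l2 us ds (q c : bool) : a != 0 -> p != 0 -> 0 \notin zs ->
  size us = size zs -> size ds = size zs ->
  \sum_(r1 : bool) \sum_(r2 : bool)
     rowZ2 (map ( *%R p) zs) zs l1 l2 us ds r1 r2 * vweight a (a * p) r1 q c r2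
  = \sum_(q' : bool) \sum_(c' : bool)
     vweight a (a * p) l1 q' c' l2 * rowZ2 zs (map ( *%R p) zs) c' q' us ds c q.
Proof.
move=> a0 p0; elim: zs l1 l2 us ds => [|z zs IH] l1 l2 [|u us] [|d ds] //=.
  move=> _ _ _; rewrite /rowZ2 /= !big_bool !big_seq1.
  by case: l1 l2 q c => [] [] [] []; rewrite /=; ring.
rewrite in_cons negb_or => /andP[]; rewrite eq_sym => z0 Hz [Hu] [Hd].
under eq_bigr => r1 _ do under eq_bigr => r2 _ do rewrite row2_cons.
(* The induction hypothesis carries the crossing through all columns but the first; [vweight_YBE]
   takes it through the first. *)
transitivity (\sum_(b1 : bool) \sum_(b2 : bool) \sum_(m : bool)
   vweight a (p * z) l1 b1 u m * vweight a z l2 b2 m d *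
   \sum_(q' : bool) \sum_(c' : bool)
     vweight a (a * p) b1 q' c' b2 * rowZ2 zs (map ( *%R p) zs) c' q' us ds c q).
  under [RHS]eq_bigr => b1 _ do under eq_bigr => b2 _ do
    under eq_bigr => m _ do rewrite -IH //.
  by rewrite !big_bool /=; ring.
transitivity (\sum_(q' : bool) \sum_(c' : bool)
  (\sum_(b1 : bool) \sum_(b2 : bool) \sum_(m : bool)
     vweight a (p * z) l1 b1 u m * vweight a z l2 b2 m d * vweight a (a * p) b1 q' c' b2)
  * rowZ2 zs (map ( *%R p) zs) c' q' us ds c q).
  by rewrite !big_bool /=; ring.
transitivity (\sum_(q' : bool) \sum_(c' : bool)
  (\sum_(q0 : bool) \sum_(c0 : bool) \sum_(m : bool)
     vweight a (a * p) l1 q0 c0 l2 * vweight a z c0 c' u m * vweight a (p * z) q0 q' m d)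
  * rowZ2 zs (map ( *%R p) zs) c' q' us ds c q).
  by apply: eq_bigr => q' _; apply: eq_bigr => c' _; rewrite vweight_YBE.
under [RHS]eq_bigr => q' _ do under eq_bigr => c' _ do rewrite row2_cons.
by rewrite !big_bool /=; ring.
Qed.

(** With both left edges [true] and both outgoing right edges [false], the ice rule leaves one state
    of the crossing on each side. Both have weight [sigma (a * (a * p))], which cancels. *)
Lemma rowB_comm p zs us ds : a != 0 -> p != 0 -> 0 \notin zs ->
  sigma (a * (a * p)) != 0 -> size us = size zs -> size ds = size zs ->
  rowZ2 (map ( *%R p) zs) zs true true us ds false false
  = rowZ2 zs (map ( *%R p) zs) true true us ds false false.
Proof.
move=> a0 p0 Hz Hs Hu Hd; have := RTT true true false false a0 p0 Hz Hu Hd.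
rewrite !big_bool /vweight /= ?mulr0 ?mul0r ?addr0 ?add0r mulrC.
by apply: mulfI.
Qed.
End SixVertex.

(** * Symmetry and frozen regions of generic lattices *)

(** Adjacent transpositions generate all permutations. Invariance is required only at rearrangements
    of [S], so that assumptions on the entries of [S] stay available. *)
Lemma adjacent_swap_perm (T : eqType) (A : Type) (G : seq T -> A) (S : seq T) :
  (forall s1 x y s2, perm_eq S (s1 ++ x :: y :: s2) ->
     G (s1 ++ x :: y :: s2) = G (s1 ++ y :: x :: s2)) ->
  forall s, perm_eq S s -> G S = G s.
Proof.
move=> H.
have move_in x t1 pre t2 : perm_eq S (pre ++ x :: t1 ++ t2) ->
    G (pre ++ x :: t1 ++ t2) = G (pre ++ t1 ++ x :: t2).
  elim: t1 pre => [|y t1 IH] pre //= E; rewrite H // -cat_rcons IH ?cat_rcons //.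
  apply: perm_trans E _; rewrite perm_cat2l.
  rewrite -[x :: y :: _]/([:: x; y] ++ _) -[y :: x :: _]/([:: y; x] ++ _).
  by rewrite perm_cat2r (perm_catC [:: x] [:: y]).
suff main s t pre : perm_eq S (pre ++ s) -> perm_eq s t -> G (pre ++ s) = G (pre ++ t).
  by move=> s E; apply: (main S s [::]).
elim: s t pre => [|x s IH] t pre ES E.
  by have -> : t = [::] by apply/nilP; rewrite /nilp -(perm_size E).
have /splitPr Ht : x \in t by rewrite -(perm_mem E) mem_head.
case: Ht E => t1 t2 E.
have E' : perm_eq s (t1 ++ t2).
  rewrite -(perm_cons x); apply: perm_trans E _.
  by rewrite perm_sym -[_ :: _]/([:: x] ++ _) -[x :: t2]/([:: x] ++ _) perm_catCA.
rewrite -cat_rcons (IH (t1 ++ t2)) ?cat_rcons // move_in //.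
by apply: perm_trans ES _; rewrite perm_cat2l perm_cons.
Qed.

Section GenericLattices.
Variables (F : fieldType) (a : F).
Implicit Types (z x y u v p : F) (zs xs ys X Y : seq F) (l r b : bool).
Implicit Types (us ds ls rs ms : seq bool).

Local Notation rowZ := (rowZ a).
Local Notation gridZ := (gridZ a).
Local Notation grd := (gridZ (fun x y => x / y)).
Local Notation T n := (nseq n true).
Local Notation O n := (nseq n false).

(** The first condition separates nodes of the same kind; those with [a ^+ 2] keep nodes away from
    other parameters, hence from the poles of [Z2]; those with [a ^+ 4] separate [a * x] from
    [y / a] and keep the crossing weights nonzero. *)
Definition sep x y :=
  [&& x ^+ 2 != y ^+ 2, a ^+ 2 * x ^+ 2 != y ^+ 2, a ^+ 2 * y ^+ 2 != x ^+ 2,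
      a ^+ 4 * x ^+ 2 != y ^+ 2 & a ^+ 4 * y ^+ 2 != x ^+ 2].

(* [s] lists the row and column parameters together: the interpolation nodes [a^{-1} y] and
   [a y] then have distinct squares and the Yang-Baxter weights do not vanish. *)
Definition generic (s : seq F) :=
  [/\ a != 0, a ^+ 4 != 1, 0 \notin s, uniq s & {in s &, forall x y, x != y -> sep x y}].

Lemma generic_sub s t : uniq t -> {subset t <= s} -> generic s -> generic t.
Proof.
move=> Ht sub [a0 a4 s0 _ H]; split=> //; first by apply: contraNN s0; apply: sub.
by move=> x y /sub xs /sub ys; apply: H.
Qed.

Lemma generic_perm s t : perm_eq s t -> generic s -> generic t.
Proof.
move=> E H; apply: (generic_sub _ _ H); last by move=> x; rewrite (perm_mem E).
by case: H => _ _ _ + _; rewrite (perm_uniq E).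
Qed.

Lemma generic_cons x s : generic (x :: s) -> generic s.
Proof.
move=> H; apply: generic_sub (H); last by move=> y; rewrite in_cons orbC => ->.
by case: H => _ _ _ /= /andP[].
Qed.

Lemma generic_catl s t : generic (s ++ t) -> generic s.
Proof.
move=> H; apply: generic_sub (H); last by move=> y; rewrite mem_cat => ->.
by case: H => _ _ _; rewrite cat_uniq => /and3P[].
Qed.

Lemma generic_catr s t : generic (s ++ t) -> generic t.
Proof.
move=> H; apply: generic_sub (H); last by move=> y; rewrite mem_cat orbC => ->.
by case: H => _ _ _; rewrite cat_uniq => /and3P[].
Qed.

Lemma generic_neq0 x s : generic s -> x \in s -> x != 0.
Proof. by move=> [_ _ s0 _ _] xs; apply: contraNneq s0 => <-. Qed.

Lemma sigma_eq0 z : z != 0 -> (sigma z == 0) = (z ^+ 2 == 1).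
Proof.
move=> z0; rewrite /sigma subr_eq0 expr2 -(inj_eq (mulfI z0) z).
by rewrite mulfV.
Qed.

Lemma grid_rows_perm f xs xs' ys us ds :
  size us = size ys -> size ds = size ys ->
  (forall x x' vs ws, x \in xs -> x' \in xs -> size vs = size ys -> size ws = size ys ->
     rowZ2 a (map (f x) ys) (map (f x') ys) true true vs ws false false
     = rowZ2 a (map (f x') ys) (map (f x) ys) true true vs ws false false) ->
  perm_eq xs xs' ->
  gridZ f xs ys (T (size xs)) (O (size xs)) us ds
  = gridZ f xs' ys (T (size xs')) (O (size xs')) us ds.
Proof.
move=> Hu Hd Hp; move: xs'.
apply: (@adjacent_swap_perm F F (fun xs => gridZ f xs ys (T (size xs)) (O (size xs)) us ds)).
move=> s1 x x' s2 Hs.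
have [xin x'in] : x \in xs /\ x' \in xs.
  by rewrite !(perm_mem Hs) !mem_cat !in_cons !eqxx !orbT.
have split y y' : gridZ f (s1 ++ y :: y' :: s2) ys (T (size (s1 ++ y :: y' :: s2)))
    (O (size (s1 ++ y :: y' :: s2))) us ds
  = \sum_(ms <- words (size ys)) \sum_(ns <- words (size ys))
      gridZ f s1 ys (T (size s1)) (O (size s1)) us ms *
      (rowZ2 a (map (f y) ys) (map (f y') ys) true true ms ns false false *
       gridZ f s2 ys (T (size s2)) (O (size s2)) ns ds).
  rewrite size_cat !nseqD grid_catr ?size_nseq //.
  rewrite big_seq [RHS]big_seq; apply: eq_bigr => ms /size_words Hms.
  rewrite -mulr_sumr; congr (_ * _).
  rewrite -[y :: y' :: s2]/([:: y; y'] ++ s2) size_cat !nseqD grid_catr //.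
  rewrite big_seq [RHS]big_seq; apply: eq_bigr => ns /size_words Hns; congr (_ * _).
  rewrite -[[:: y; y']]/([:: y] ++ [:: y']) -[T _]/([:: true] ++ [:: true]).
  rewrite -[O _]/([:: false] ++ [:: false]).
  rewrite grid_catr // /rowZ2 Hms; apply: eq_bigr => ks _.
  by rewrite !grid1r.
rewrite !split big_seq [RHS]big_seq; apply: eq_bigr => ms /size_words Hms.
rewrite big_seq [RHS]big_seq; apply: eq_bigr => ns /size_words Hns.
by congr (_ * (_ * _)); apply: Hp.
Qed.

Lemma sigma_ratio_neq0 x y : a != 0 -> x != 0 -> y != 0 ->
  a ^+ 4 * x ^+ 2 != y ^+ 2 -> sigma (a * (a * (x / y))) != 0.
Proof.
move=> a0 x0 y0 H; rewrite sigma_eq0 ?mulf_neq0 ?invr_eq0 //; apply: contraNneq H => E.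
have -> : a ^+ 4 * x ^+ 2 = (a * (a * (x / y))) ^+ 2 * y ^+ 2 by field; rewrite ?y0 ?oner_neq0.
by rewrite E mul1r.
Qed.

Lemma generic_ratio s x y : generic s -> x \in s -> y \in s -> a ^+ 4 * x ^+ 2 != y ^+ 2.
Proof.
move=> [a0 a4 s0 _ H] xs ys; case: (eqVneq x y) => [<-|]; last by case/H/and5P.
by rewrite -subr_eq0 -{2}[x ^+ 2]mul1r -mulrBl mulf_neq0 ?subr_eq0 // expf_neq0 //;
  apply: contraNneq s0 => <-.
Qed.

(** Exchanging two rows is a symmetric statement, so one of the two crossing weights may vanish.
    This weaker form is needed for lists that contain a node [a * y], which need not be generic. *)
Definition commuting (s : seq F) := 0 \notin s /\ {in s &, forall x x', x != x' ->
  (a ^+ 4 * x ^+ 2 != x' ^+ 2) || (a ^+ 4 * x' ^+ 2 != x ^+ 2)}.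

Lemma generic_commuting s : generic s -> commuting s.
Proof. by move=> G; split=> [|x x' xs x's _]; [case: G|rewrite (generic_ratio G)]. Qed.

Lemma rowB_comm_ratio x x' zs us ds : a != 0 -> x != 0 -> x' != 0 -> 0 \notin zs ->
  (a ^+ 4 * x ^+ 2 != x' ^+ 2) || (a ^+ 4 * x' ^+ 2 != x ^+ 2) ->
  size us = size zs -> size ds = size zs ->
  rowZ2 a (map ( *%R x) zs) (map ( *%R x') zs) true true us ds false false
  = rowZ2 a (map ( *%R x') zs) (map ( *%R x) zs) true true us ds false false.
Proof.
move=> a0 x0 x'0 z0 H Hu Hd.
wlog H1 : x x' x0 x'0 {H} / a ^+ 4 * x ^+ 2 != x' ^+ 2.
  by move=> W; case/orP: H => H; [apply: W|symmetry; apply: W].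
have -> : map ( *%R x) zs = map ( *%R (x / x')) (map ( *%R x') zs).
  by rewrite -map_comp; apply: eq_map => z /=; rewrite mulrA mulfVK.
apply: rowB_comm; rewrite ?size_map ?mulf_neq0 ?invr_eq0 ?sigma_ratio_neq0 //.
apply/mapP => -[z zin /eqP]; rewrite eq_sym mulf_eq0 (negPf x'0) /= => /eqP z00.
by rewrite -z00 zin in z0.
Qed.

Lemma grd_rows_perm xs xs' ys us ds : a != 0 -> commuting xs -> 0 \notin ys ->
  size us = size ys -> size ds = size ys -> perm_eq xs xs' ->
  grd xs ys (T (size xs)) (O (size xs)) us ds
  = grd xs' ys (T (size xs')) (O (size xs')) us ds.
Proof.
move=> a0 [X0 Hc] Hy Hu Hd; apply: grid_rows_perm => // x x' vs ws xin x'in Hv Hw.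
have [->//|xx'] := eqVneq x x'.
have Ef z : map (fun y => z / y) ys = map ( *%R z) (map GRing.inv ys) by rewrite -map_comp.
rewrite !Ef; apply: rowB_comm_ratio; rewrite ?size_map ?Hc //.
- by apply: contraNneq X0 => <-.
- by apply: contraNneq X0 => <-.
by apply/mapP => -[y yin /esym/eqP]; rewrite invr_eq0 => /eqP y0; rewrite -y0 yin in Hy.
Qed.

Lemma grd_cols_perm xs ys ys' ls rs : a != 0 -> commuting ys -> 0 \notin xs ->
  size ls = size xs -> size rs = size xs -> perm_eq ys ys' ->
  grd xs ys ls rs (T (size ys)) (O (size ys))
  = grd xs ys' ls rs (T (size ys')) (O (size ys')).
Proof.
move=> a0 [Y0 Hc] Hx Hl Hr Hp.
rewrite !(grid_tr a (fun x y => x / y)); apply: grid_rows_perm => // y y' vs ws yin y'in Hv Hw.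
have [->//|yy'] := eqVneq y y'.
have y0 : y != 0 by apply: contraNneq Y0 => <-.
have y'0 : y' != 0 by apply: contraNneq Y0 => <-.
have Ef z : map (fun x => x / z) xs = map ( *%R z^-1) xs.
  by apply: eq_map => x; rewrite mulrC.
rewrite !Ef; apply: rowB_comm_ratio; rewrite ?invr_eq0 //.
have yy'2 : y' != y by rewrite eq_sym.
rewrite !exprVn; apply/orP; have /orP[H|H] := Hc _ _ y'in yin yy'2.
  left; apply: contraNneq H => E; apply/eqP; apply: (mulIf (_ : y ^- 2 * y' ^- 2 != 0)).
    by rewrite mulf_neq0 ?invr_eq0 ?expf_neq0.
  move: E; set A := a ^+ 4 => E; transitivity (A * y ^- 2); first by field; rewrite ?y0 ?y'0 ?oner_neq0.
  by rewrite E; field; rewrite ?y0 ?y'0 ?oner_neq0.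
right; apply: contraNneq H => E; apply/eqP; apply: (mulIf (_ : y ^- 2 * y' ^- 2 != 0)).
  by rewrite mulf_neq0 ?invr_eq0 ?expf_neq0.
move: E; set A := a ^+ 4 => E; transitivity (A * y' ^- 2); first by field; rewrite ?y0 ?y'0 ?oner_neq0.
by rewrite E; field; rewrite ?y0 ?y'0 ?oner_neq0.
Qed.

(** * Frozen rows, columns and corners *)

Lemma row_up zs ds r :
  rowZ zs false (T (size zs)) ds r
  = (~~ r && (ds == T (size zs)))%:R * \prod_(z <- zs) sigma (a / z).
Proof.
elim: zs ds => [|z zs IH] [|d ds]; rewrite ?big_nil ?big_cons /= ?andbF ?mul0r //.
  by case: r; rewrite /= ?mulr1 ?mul0r.
rewrite big_bool /= !IH eqseq_cons.
by case: r {IH}; case: d; rewrite /vweight /= ?mul0r ?mulr0 ?addr0 ?add0r ?mul1r //; ring.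
Qed.

(** As in [row_up]: below top edges [true], a left edge [false] admits only type 5, so the
    horizontal edge stays [false] from then on. A right end [true] therefore excludes every turn and
    leaves type 3 throughout. *)
Lemma row_upT zs ds :
  rowZ zs true (T (size zs)) ds true
  = (ds == T (size zs))%:R * \prod_(z <- zs) sigma (a * z).
Proof.
elim: zs ds => [|z zs IH] [|d ds]; rewrite ?big_nil ?big_cons /= ?mul0r ?mulr1 //.
rewrite big_bool /= row_up !IH eqseq_cons.
by case: d; rewrite /vweight /= ?mul0r ?mulr0 ?addr0 ?add0r ?mul1r //; ring.
Qed.

Lemma row_dn zs us r :
  rowZ zs false us (O (size zs)) r
  = (~~ r && (us == O (size zs)))%:R * \prod_(z <- zs) sigma (a * z).
Proof.
elim: zs us => [|z zs IH] [|u us]; rewrite ?big_nil ?big_cons /= ?andbF ?mul0r //.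
  by case: r; rewrite /= ?mulr1 ?mul0r.
rewrite big_bool /= !IH eqseq_cons.
by case: r {IH}; case: u; rewrite /vweight /= ?mul0r ?mulr0 ?addr0 ?add0r ?mul1r //; ring.
Qed.

Lemma row_dnT zs us :
  rowZ zs true us (O (size zs)) true
  = (us == O (size zs))%:R * \prod_(z <- zs) sigma (a / z).
Proof.
elim: zs us => [|z zs IH] [|u us]; rewrite ?big_nil ?big_cons /= ?mul0r ?mulr1 //.
rewrite big_bool /= row_dn !IH eqseq_cons.
by case: u; rewrite /vweight /= ?mul0r ?mulr0 ?addr0 ?add0r ?mul1r //; ring.
Qed.

(** The hypothesis kills type 3, so the first vertex turns (type 1) and [row_up] freezes the
    rest. *)
Lemma row_first z zs ms : sigma (a * z) = 0 ->
  rowZ (z :: zs) true (T (size zs).+1) ms false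
  = (ms == false :: T (size zs))%:R * (sigma (a ^+ 2) * \prod_(z <- zs) sigma (a / z)).
Proof.
move=> Hz; case: ms => [|m ms] /=; rewrite ?mul0r // big_bool /= row_up eqseq_cons.
by case: m; rewrite /vweight /= ?Hz; ring.
Qed.

(** The hypothesis kills types 5 and 6. The last vertex is then of type 1, so the part before it
    ends with [true] and is frozen by [row_upT]. *)
Lemma row_last z zs ms : sigma (a / z) = 0 -> size ms = (size zs).+1 ->
  rowZ (rcons zs z) true (T (size zs).+1) ms false
  = (ms == rcons (T (size zs)) false)%:R * (sigma (a ^+ 2) * \prod_(z <- zs) sigma (a * z)).
Proof.
move=> Hz; case/lastP: ms => // ms m; rewrite size_rcons => -[Hm].
rewrite -[(size zs).+1]addn1 nseqD -cats1 -[in LHS](cats1 ms) row_cat ?size_nseq //.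
rewrite big_bool /= row_upT !big_bool /= eqseq_rcons.
by case: m; rewrite /vweight /= ?Hz ?andbF ?andbT ?(mul0r, mulr0, addr0, add0r, mulr1) ?mul0r; ring.
Qed.

Lemma grid_top f x xs ys r rs ds :
  gridZ f (x :: xs) ys (false :: T (size xs)) (r :: rs) (T (size ys)) ds
  = (~~ r)%:R * (\prod_(y <- ys) sigma (a / f x y) *
      gridZ f xs ys (T (size xs)) rs (T (size ys)) ds).
Proof.
rewrite /=; under [LHS]eq_bigr => ms _ do
  rewrite -(size_map (f x) ys) row_up size_map eq_sym -mulnb natrM -!mulrA mulrCA.
by rewrite big_words_delta ?size_nseq // big_map.
Qed.

Lemma grid_topT f x xs ys rs ds :
  gridZ f (x :: xs) ys (true :: T (size xs)) (true :: rs) (T (size ys)) ds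
  = \prod_(y <- ys) sigma (a * f x y) * gridZ f xs ys (T (size xs)) rs (T (size ys)) ds.
Proof.
rewrite /=; under eq_bigr => ms _ do rewrite -(size_map (f x) ys) row_upT size_map /= eq_sym -mulrA.
by rewrite big_words_delta ?size_nseq // big_map.
Qed.

(** The condition [l <= r] leaves out the one case in which the bottom row is not frozen: [true] on
    the left and [false] on the right. *)
Lemma grid_bot f x xs ys rs us l r : size rs = size xs -> (l <= r)%N ->
  gridZ f (rcons xs x) ys (rcons (T (size xs)) l) (rcons rs r) us (O (size ys))
  = (l == r)%:R * \prod_(y <- ys) sigma (if l then a / f x y else a * f x y)
    * gridZ f xs ys (T (size xs)) rs us (O (size ys)).
Proof.
move=> Hr Hlr; rewrite -!cats1 grid_catr ?size_nseq //.
under [LHS]eq_bigr => ms _ do rewrite grid1r.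
have -> : \prod_(y <- ys) sigma (if l then a / f x y else a * f x y)
   = \prod_(z <- map (f x) ys) sigma (if l then a / z else a * z) by rewrite big_map.
case: l r Hlr => [] [] //= _; rewrite ?mul0r ?mul1r.
- under eq_bigr => ms _ do rewrite -(size_map (f x) ys) row_dnT size_map eq_sym mulrCA.
  by rewrite big_words_delta ?size_nseq // mulrC.
- by rewrite big1 // => ms _; rewrite -(size_map (f x) ys) row_dn mul0r mulr0.
under eq_bigr => ms _ do rewrite -(size_map (f x) ys) row_dn size_map eq_sym mulrCA.
by rewrite big_words_delta ?size_nseq // mulrC.
Qed.

(** The upper left corner is forced to be of type 1. This freezes the first column and then the
    first row, and what remains has the same boundary. *)
Lemma grd_first x X y Y r rs : sigma (a * (x / y)) = 0 ->
  grd (x :: X) (y :: Y) (T (size X).+1) (r :: rs) (T (size Y).+1) (O (size Y).+1)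
  = (~~ r)%:R * (sigma (a ^+ 2) * \prod_(x' <- X) sigma (a / (x' / y)) *
    \prod_(k <- Y) sigma (a / (x / k)) * grd X Y (T (size X)) rs (T (size Y)) (O (size Y))).
Proof.
move=> H; rewrite grid_colS [size (x :: X)]/= map_cons.
under [LHS]eq_bigr => ms _ do rewrite -(size_map (fun x => x / y) X) row_first // size_map eq_sym -mulrA.
rewrite big_words_delta; last by rewrite /= size_nseq.
by rewrite grid_top big_map /=; ring.
Qed.

(** The same at the lower left corner, where [x] is the last row: the other admissible type there is
    6, whose weight vanishes. *)
Lemma grd_last x X y Y r rs : sigma (a / (x / y)) = 0 -> size rs = size X ->
  grd (rcons X x) (y :: Y) (T (size X).+1) (rcons rs r) (T (size Y).+1) (O (size Y).+1)
  = (~~ r)%:R * (sigma (a ^+ 2) * \prod_(x' <- X) sigma (a * (x' / y)) *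
    \prod_(k <- Y) sigma (a * (x / k)) * grd X Y (T (size X)) rs (T (size Y)) (O (size Y))).
Proof.
move=> H Hr; rewrite grid_colS size_rcons map_rcons.
under [LHS]eq_big_seq => ms /size_words Hms do
  rewrite -(size_map (fun x => x / y) X) row_last ?size_map // eq_sym -mulrA.
rewrite big_words_delta ?size_rcons ?size_nseq //.
by rewrite grid_bot //= big_map; case: r => /=; ring.
Qed.

Lemma big_words_rcons n (f : seq bool -> F) :
  \sum_(s <- words n.+1) f s = \sum_(s <- words n) \sum_(b : bool) f (rcons s b).
Proof.
rewrite -addn1 big_words_cat; apply: eq_bigr => s _.
by rewrite big_wordsS !big_bool !big_words0 !cats1.
Qed.

Lemma grid_rconsr f xs x ys rs l r us ds : size rs = size xs ->
  gridZ f (rcons xs x) ys (rcons (T (size xs)) l) (rcons rs r) us ds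
  = \sum_(ms <- words (size ys)) gridZ f xs ys (T (size xs)) rs us ms
     * rowZ (map (f x) ys) l ms ds r.
Proof.
move=> Hr; rewrite -!cats1 grid_catr ?size_nseq //.
by apply: eq_bigr => ms _; rewrite grid1r.
Qed.

Lemma nseq_rcons n : T n.+1 = rcons (T n) true.
Proof. by rewrite -addn1 nseqD cats1. Qed.

(* At [x = a * y] the line entering along row [x] and leaving along column [y] can be
   pulled through the rows of [X] and off the lattice. *)
Lemma row_corner x X y Y qs ds : a != 0 -> y != 0 -> 0 \notin X -> 0 \notin Y ->
  x = a * y -> size qs = size X -> size ds = size Y ->
  \sum_(es <- words (size Y)) \sum_(l : bool)
     grd X (rcons Y y) (T (size X)) qs (T (size Y).+1) (rcons es l)
     * rowZ (map (fun k => x / k) Y) true es ds l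
  = \prod_(k <- Y) sigma (a * (x / k)) * \prod_(x' <- X) sigma (a * (x' / y))
    * grd X Y (T (size X)) qs (T (size Y)) ds.
Proof.
move=> a0 y0 + Y0 Ex + Hds; have x0 : x != 0 by rewrite Ex mulf_neq0.
have zY : 0 \notin map (fun k => x / k) Y.
  apply/mapP => -[k kin /eqP]; rewrite eq_sym mulf_eq0 invr_eq0 (negPf x0) /= => /eqP k0.
  by rewrite -k0 kin in Y0.
elim/last_ind: X qs ds Hds => [|X x1 IH] qs ds Hds.
  case: qs => // _ _; rewrite big_nil mulr1.
  have E es l : grd [::] (rcons Y y) [::] [::] (T (size Y).+1) (rcons es l)
      = (T (size Y) == es)%:R * (true == l)%:R.
    by rewrite nseq_rcons /= eqseq_rcons !size_rcons size_nseq eqxx andbT -mulnb natrM.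
  under [LHS]eq_bigr => es _ do under eq_bigr => l _ do rewrite E -mulrA.
  under [LHS]eq_bigr => es _ do rewrite -mulr_sumr big_bool_delta.
  rewrite big_words_delta ?size_nseq // -(size_map (fun k => x / k) Y) row_upT size_map big_map.
  by rewrite /= size_nseq eqxx andbT eq_sym mulrC.
case/lastP: qs => [|qs q]; rewrite ?size_rcons // mem_rcons in_cons negb_or.
move=> /andP[x10 X0] [Hq]; rewrite eq_sym in x10.
have Em : map (fun k => x1 / k) Y = map ( *%R (x1 / x)) (map (fun k => x / k) Y).
  by rewrite -map_comp; apply: eq_map => k /=; rewrite mulrA mulfVK.
(* Since [x = a * y], the vertex of row [x1] and column [y] has precisely the parameter of the
   crossing of rows [x1] and [x], so [RTT] can move it. *)
have Ep : x1 / y = a * (x1 / x).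
  by rewrite Ex; field; rewrite ?a0 ?y0 ?oner_neq0.
transitivity (\sum_(ms <- words (size Y)) \sum_(c : bool)
   grd X (rcons Y y) (T (size X)) qs (T (size Y).+1) (rcons ms c) *
   (\sum_(p : bool) \sum_(l : bool)
      rowZ2 a (map ( *%R (x1 / x)) (map (fun k => x / k) Y)) (map (fun k => x / k) Y)
        true true ms ds p l * vweight a (a * (x1 / x)) p q c l)).
  have Eg es l : grd (rcons X x1) (rcons Y y) (T (size X).+1) (rcons qs q)
     (T (size Y).+1) (rcons es l)
   = \sum_(ms <- words (size Y)) \sum_(c : bool)
      grd X (rcons Y y) (T (size X)) qs (T (size Y).+1) (rcons ms c) *
      rowZ (map (fun k => x1 / k) (rcons Y y)) true (rcons ms c) (rcons es l) q.
    by rewrite nseq_rcons grid_rconsr // size_rcons big_words_rcons.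
  under [LHS]eq_bigr => es _ do under eq_bigr => l _ do rewrite Eg mulr_suml.
  under [LHS]eq_bigr => es _ do rewrite exchange_big /=.
  rewrite exchange_big /=; rewrite big_seq [RHS]big_seq; apply: eq_bigr => ms /size_words Hms.
  under [LHS]eq_bigr => es _ do under eq_bigr => l _ do rewrite mulr_suml.
  under [LHS]eq_bigr => es _ do rewrite exchange_big /=.
  rewrite exchange_big /=; apply: eq_bigr => c _.
  rewrite -Em /rowZ2 Hms.
  have Ec es l : size es = size Y ->
      rowZ (map (fun k => x1 / k) (rcons Y y)) true (rcons ms c) (rcons es l) q
      = \sum_(p : bool) rowZ (map (fun k => x1 / k) Y) true ms es p
         * vweight a (a * (x1 / x)) p q c l.
    move=> Hes; rewrite map_rcons -!cats1 row_cat ?size_map //; apply: eq_bigr => p _.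
    by rewrite -Ep /= big_bool /=; case: (q); rewrite ?mulr0 ?mulr1 ?addr0 ?add0r.
  under [LHS]eq_big_seq => es /size_words Hes do
    under eq_bigr => l _ do rewrite Ec // mulr_sumr mulr_suml.
  under [LHS]eq_bigr => es _ do rewrite exchange_big /=.
  rewrite exchange_big mulr_sumr; apply: eq_bigr => p _.
  rewrite exchange_big mulr_sumr; apply: eq_bigr => l _.
  rewrite mulr_suml mulr_sumr; apply: eq_bigr => es _; ring.
have x1x : x1 / x != 0 by rewrite mulf_neq0 ?invr_eq0.
rewrite ?size_rcons (nseq_rcons (size X)) grid_rconsr // mulr_sumr.
transitivity (\sum_(es <- words (size Y)) sigma (a * (x1 / y)) *
  (\sum_(ms <- words (size Y)) \sum_(c : bool)
    grd X (rcons Y y) (T (size X)) qs (T (size Y).+1) (rcons ms c)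
    * rowZ (map (fun k => x / k) Y) true ms es c) * rowZ (map (fun k => x1 / k) Y) true es ds q).
  transitivity (\sum_(ms <- words (size Y)) \sum_(c : bool) \sum_(es <- words (size Y))
     grd X (rcons Y y) (T (size X)) qs (T (size Y).+1) (rcons ms c) *
     (sigma (a * (x1 / y)) * (rowZ (map (fun k => x / k) Y) true ms es c
       * rowZ (map (fun k => x1 / k) Y) true es ds q))).
    rewrite big_seq [RHS]big_seq; apply: eq_bigr => ms /size_words Hms.
    apply: eq_bigr => c _; rewrite -!mulr_sumr; congr (_ * _).
    (* At the left ends both edges are [true], so the crossing is forced and contributes only
       [sigma (a * (x1 / y))]. *)
    rewrite RTT ?size_map // -Ep !big_bool -Em /rowZ2 Hms /vweight /=.
    by rewrite !mul0r !addr0.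
  under [LHS]eq_bigr => ms _ do rewrite exchange_big /=.
  rewrite exchange_big /=; apply: eq_bigr => es _.
  rewrite mulr_sumr mulr_suml; apply: eq_bigr => ms _.
  rewrite mulr_sumr mulr_suml; apply: eq_bigr => c _; ring.
rewrite big_seq [RHS]big_seq; apply: eq_bigr => es /size_words Hes.
by rewrite IH // big_rcons /=; ring.
Qed.
End GenericLattices.

(** * Interpolation of Laurent polynomials *)

Lemma seq_choice (T : eqType) (A : Type) (a0 : A) (P : T -> A -> Prop) (s : seq T) :
  (forall x, x \in s -> exists y, P x y) -> exists f : T -> A, forall x, x \in s -> P x (f x).
Proof.
elim: s => [|x s IH] H; first by exists (fun=> a0).
have [f Hf] := IH (fun z zs => H z (@mem_behead _ (x :: s) z zs)).
have [y Hy] := H x (mem_head _ _).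
exists (fun z => if z == x then y else f z) => z; rewrite in_cons.
by case: eqVneq => [->|] //= _ /Hf.
Qed.

Section Laurent.
Variable F : fieldType.
Implicit Types (f g : F -> F) (t c : F).

(* [laurent n f]: on nonzero arguments [f] is a combination of
   [t ^ (1 - n)], [t ^ (3 - n)], ..., [t ^ (n - 1)]. *)
Definition laurent n f := exists2 p : {poly F},
  (size p <= n)%N & forall t, t != 0 -> f t * t ^+ n = t * p.[t ^+ 2].

Lemma eq_laurent n f g : (forall t, t != 0 -> f t = g t) -> laurent n f -> laurent n g.
Proof. by move=> E [p Hp H]; exists p => // t t0; rewrite -E ?H. Qed.

Lemma laurent0 n : laurent n (fun=> 0).
Proof. by exists 0; rewrite ?size_poly0 // => t _; rewrite horner0 mul0r mulr0. Qed.

Lemma laurent_const c : laurent 1 (fun=> c).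
Proof.
exists c%:P => [|t _]; first by rewrite size_polyC leq_b1.
by rewrite hornerC mulrC expr1.
Qed.

Lemma laurentD n f g : laurent n f -> laurent n g -> laurent n (fun t => f t + g t).
Proof.
move=> [p Hp Ep] [q Hq Eq]; exists (p + q) => [|t t0].
  by rewrite (leq_trans (size_polyD _ _)) // geq_max Hp.
by rewrite hornerD mulrDl mulrDr Ep ?Eq.
Qed.

Lemma laurent_sum n (I : Type) (s : seq I) (P : pred I) (f : I -> F -> F) :
  (forall i, P i -> laurent n (f i)) -> laurent n (fun t => \sum_(i <- s | P i) f i t).
Proof.
move=> H; elim: s => [|i s IH].
  by apply: eq_laurent (laurent0 n) => t _; rewrite big_nil.
case Pi : (P i); last by apply: eq_laurent IH => t _; rewrite big_cons Pi.
by apply: eq_laurent (laurentD (H _ Pi) IH) => t _; rewrite big_cons Pi.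
Qed.

Lemma laurentM m n f g :
  laurent m f -> laurent n g -> laurent (m + n).-1 (fun t => f t * g t).
Proof.
move=> [p Hp Ep] [q Hq Eq].
have [/eqP|N] := posnP (m + n).
  rewrite addn_eq0 => /andP[/eqP m0 /eqP n0]; rewrite m0 n0 /=.
  move: Hp; rewrite m0 leqn0 size_poly_eq0 => /eqP p0.
  apply: eq_laurent (laurent0 _) => t t0; move: (Ep t t0).
  by rewrite p0 horner0 mulr0 m0 expr0 mulr1 => ->; rewrite mul0r.
exists (p * q) => [|t t0].
  apply: leq_trans (size_polyMleq _ _) _.
  by rewrite -!subn1 leq_sub2r // leq_add.
apply: (mulfI t0); rewrite hornerM mulrCA -exprS prednK // exprD.
by rewrite mulrACA Ep // Eq //; ring.
Qed.

Lemma laurentZ n c f : laurent n f -> laurent n (fun t => c * f t).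
Proof. by move=> H; have := laurentM (laurent_const c) H; rewrite add1n. Qed.

Lemma laurent_shift n f : laurent n f -> laurent n.+2 f.
Proof.
move=> [p Hp Ep]; exists (p * 'X) => [|t t0].
  by rewrite (leq_trans (size_polyMleq _ _)) // size_polyX addn2 /= ltnS ltnW // ltnS.
by rewrite hornerM hornerX [RHS]mulrA -Ep // -mulrA -exprD addn2.
Qed.

Lemma laurent_prod m (I : Type) (s : seq I) (f : I -> F -> F) :
  (forall i, laurent m.+1 (f i)) ->
  laurent (m * size s).+1 (fun t => \prod_(i <- s) f i t).
Proof.
move=> H; elim: s => [|i s IH].
  by rewrite muln0; apply: eq_laurent (laurent_const 1) => t _; rewrite big_nil.
apply: eq_laurent (_ : laurent _ (fun t => f i t * \prod_(j <- s) f j t)) => [t _|].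
  by rewrite big_cons.
by have := laurentM (H i) IH; rewrite /= mulnS addnS.
Qed.

Lemma laurent_interp n f (s : seq F) :
  laurent n f -> uniq (map (fun t => t ^+ 2) s) -> 0 \notin s -> (n <= size s)%N ->
  (forall t, t \in s -> f t = 0) -> forall t, t != 0 -> f t = 0.
Proof.
move=> [p Hp Ep] Us s0 Hn Hs t t0.
suff p0 : p = 0.
  by apply/eqP; have /eqP := Ep t t0; rewrite p0 horner0 mulr0 mulf_eq0 expf_eq0 (negPf t0) andbF orbF.
apply: (roots_geq_poly_eq0 (rs := map (fun t => t ^+ 2) s)) => //; last first.
  by rewrite size_map (leq_trans Hp).
apply/allP => _ /mapP[u us ->]; have u0 : u != 0 by apply: contraNneq s0 => <-.
by have /eqP := Ep u u0; rewrite Hs // mul0r eq_sym mulf_eq0 (negPf u0).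
Qed.

Lemma laurent_div n f c : c != 0 -> laurent n f -> f c = 0 ->
  exists2 g, laurent n.-1 g & forall t, t != 0 -> f t = sigma (t / c) * g t.
Proof.
move=> c0 [p Hp Ep] fc.
have /factor_theorem[q Eq] : root p (c ^+ 2).
  by apply/eqP; have /eqP := Ep c c0; rewrite fc mul0r eq_sym mulf_eq0 (negPf c0) => /eqP.
case: n Hp Ep => [|n] Hp Ep.
  exists (fun=> 0) => [|t t0]; first exact: laurent0.
  move: Hp (Ep t t0); rewrite leqn0 size_poly_eq0 => /eqP ->.
  by rewrite horner0 mulr0 mulr1 mulr0.
(* From [sigma (t / c) = (t ^+ 2 - c ^+ 2) / (c * t)] and the factor ['X - (c ^+ 2)%:P] of [p]. *)
exists (fun t => c * t * q.[t ^+ 2] / t ^+ n) => [|t t0].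
  exists (c *: q) => [|t t0]; last first.
    by rewrite mulfVK ?expf_neq0 // hornerZ mulrA [t * c]mulrC.
  have [->|q0] := eqVneq q 0; first by rewrite scaler0 size_poly0.
  rewrite (leq_trans (size_scale_leq _ _)) //= -ltnS.
  by move: Hp; rewrite Eq size_Mmonic ?monicXsubC // size_XsubC addn2.
apply: (mulIf (expf_neq0 n.+1 t0)); rewrite Ep // Eq hornerM hornerXsubC /sigma.
rewrite (exprS t n); have := expf_neq0 n t0; move: (t ^+ n) q.[_] => T Q T0.
by field; rewrite ?c0 ?t0 ?T0 ?oner_neq0.
Qed.

Lemma laurent_divs n f (s : seq F) : 0 \notin s -> uniq (map (fun t => t ^+ 2) s) ->
  laurent n f -> (forall c, c \in s -> f c = 0) ->
  exists2 g, laurent (n - size s) g &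
    forall t, t != 0 -> f t = \prod_(c <- s) sigma (t / c) * g t.
Proof.
elim: s n f => [|c s IH] n f /=.
  by move=> _ _ Hf _; exists f; rewrite ?subn0 // => t _; rewrite big_nil mul1r.
rewrite in_cons negb_or eq_sym => /andP[c0 s0] /andP[cs Us] Hf Hs.
have [g Hg Eg] := laurent_div c0 Hf (Hs c (mem_head _ _)).
have [c' c's|h Hh Eh] := IH _ _ s0 Us Hg.
  have c'0 : c' != 0 by apply: contraNneq s0 => <-.
  have := Hs c' (@mem_behead _ (c :: s) _ c's); rewrite Eg // => /eqP; rewrite mulf_eq0 => /orP[|/eqP//].
  rewrite sigma_eq0 ?mulf_neq0 ?invr_eq0 // exprMn exprVn => /eqP E.
  case/mapP: cs; exists c' => //.
  by apply: (mulIf (_ : c ^- 2 != 0)); rewrite ?E ?mulfV ?invr_eq0 ?expf_neq0.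
exists h => [|t t0]; last by rewrite Eg // Eh // big_cons mulrA.
by rewrite -subn1 subnAC subn1 -subnS in Hh.
Qed.

Lemma laurent_binomial c d : laurent 2 (fun t => c * t + d / t).
Proof.
exists (c *: 'X + d%:P) => [|t t0]; last first.
  by rewrite hornerD hornerZ hornerX hornerC; field; rewrite ?t0 ?oner_neq0.
rewrite (leq_trans (size_polyD _ _)) // geq_max (leq_trans (size_scale_leq _ _)) ?size_polyX //.
by rewrite (leq_trans (size_polyC_leq1 _)).
Qed.

Lemma laurent_sigmaM c : laurent 2 (fun t => sigma (c * t)).
Proof.
apply: eq_laurent (laurent_binomial c (- c^-1)) => t _.
by rewrite /sigma invfM mulNr.
Qed.

Lemma laurent_sigmaV c : laurent 2 (fun t => sigma (c / t)).
Proof.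
apply: eq_laurent (laurent_binomial (- c^-1) c) => t _.
by rewrite /sigma invf_div mulNr [RHS]addrC [c^-1 * t]mulrC.
Qed.

End Laurent.

(** Types 1 and 2 are the vertices at which the horizontal edge changes, and their weight is
    constant. If [l] and [r] differ there is an odd number of them, which costs one term and fixes
    the parity of the exponents; [laurent_shift] absorbs further pairs of turns. *)
Lemma laurent_row (F : fieldType) (a : F) (ws : seq (F -> F)) (l : bool) us ds r :
  (forall w, List.In w ws -> laurent 2 (fun t => sigma (a * w t))
     /\ laurent 2 (fun t => sigma (a / w t))) ->
  laurent (if l == r then (size ws).+1 else size ws)
    (fun t => rowZ a [seq w t | w <- ws] l us ds r).
Proof.
elim: ws l us ds => [|w ws IH] l us ds H.
  case: us => [|u us]; case: ds => [|d ds]; try exact: laurent0.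
  by rewrite /=; case: (l == r); [apply: laurent_const|apply: eq_laurent (laurent0 _ _)].
case: us => [|u us]; first exact: laurent0.
case: ds => [|d ds]; first exact: laurent0.
have [H1 H2] := H w (or_introl erefl).
have {}IH b := IH b us ds (fun w' Hw => H w' (or_intror Hw)).
have V b : laurent (if l == b then 2 else 1) (fun t => vweight a (w t) l b u d).
  case: (l) (b) (u) (d) => [] [] [] []; rewrite /vweight /=;
    first [exact: H1|exact: H2|exact: laurent_const|exact: laurent0].
rewrite /=; apply: laurent_sum => b _; have := laurentM (V b) (IH b).
by case: (l) (b) (r) => [] [] [] //= K; rewrite ?addn1 ?addnS ?addn0 //; apply: laurent_shift.
Qed.

(** * The half-turn factor *)

Section HalfTurnFactor.
Variables (F : fieldType) (a : F).
Implicit Types (x y t : F) (xs ys X Y : seq F).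

Definition sigma2 z := sigma (a * z) * sigma (a / z).
(** Chosen to equal [sigma (a ^+ 2)], the weight of a turn, at [z = a] and at [z = a^-1], the points
    where [sigma2] vanishes. *)
Definition htw z := sigma a * (z + z^-1).

Lemma htwE z : htw z = sigma a * (z + z^-1).
Proof. by []. Qed.

Lemma sigmaV z : sigma z^-1 = - sigma z :> F.
Proof. by rewrite /sigma invrK opprB. Qed.

(* Row expansion of the determinant with entries [htw (x / y) / sigma2 (x / y)],
   multiplied by the products of [sigma2] and divided by the Vandermonde-type
   products in [x] and [y]. *)
Fixpoint Z2 xs ys : F :=
  if xs is x :: X then
    \sum_(y <- ys) htw (x / y)
      * \prod_(k <- ys | k != y) (sigma2 (x / k) / sigma (k / y))
      * \prod_(x' <- X) (sigma2 (x' / y) / sigma (x / x'))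
      * Z2 X [seq k <- ys | k != y]
  else 1.

Lemma Z2_cons x X ys : Z2 (x :: X) ys =
  \sum_(y <- ys) htw (x / y)
      * \prod_(k <- ys | k != y) (sigma2 (x / k) / sigma (k / y))
      * \prod_(x' <- X) (sigma2 (x' / y) / sigma (x / x'))
      * Z2 X [seq k <- ys | k != y].
Proof. by []. Qed.

Lemma Z2_perm_y xs ys ys' : perm_eq ys ys' -> Z2 xs ys = Z2 xs ys'.
Proof.
elim: xs ys ys' => //= x X IH ys ys' E.
rewrite (perm_big _ E) /=; apply: eq_bigr => y _.
by rewrite (perm_big _ E) /= (IH _ [seq k <- ys' | k != y]) // perm_filter.
Qed.

(** Expansion along two rows. The free factor [c] serves both uses: exchanging two rows, and letting
    two rows coincide in order to compute a residue. *)
Lemma Z2_expand2 u u' X ys (c : F -> F) : uniq ys ->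
  \sum_(y <- ys) htw (u / y) * \prod_(k <- ys | k != y) (sigma2 (u / k) / sigma (k / y))
     * (sigma2 (u' / y) * c y) * Z2 (u' :: X) [seq k <- ys | k != y]
  = \sum_(y <- ys) \sum_(y' <- ys | y' != y)
      htw (u / y) * htw (u' / y') * (sigma2 (u / y') * sigma2 (u' / y)) / sigma (y' / y)
      * \prod_(k <- ys | (k != y) && (k != y'))
          (sigma2 (u / k) / sigma (k / y) * (sigma2 (u' / k) / sigma (k / y')))
      * (c y * \prod_(x' <- X) (sigma2 (x' / y') / sigma (u' / x')))
      * Z2 X [seq k <- ys | (k != y) && (k != y')].
Proof.
move=> Uy; apply: eq_big_seq => y yin; rewrite /= big_filter mulr_sumr.
rewrite big_seq_cond [RHS]big_seq_cond; apply: eq_bigr => y' /andP[y'in ny].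
have E1 (g : F -> F) : \prod_(k <- ys | k != y) g k
    = g y' * \prod_(k <- ys | (k != y) && (k != y')) g k.
  by rewrite -big_filter (bigD1_seq y') ?filter_uniq ?mem_filter ?ny //= big_filter_cond.
have Ef : [seq k <- [seq k <- ys | k != y] | k != y'] = [seq k <- ys | (k != y) && (k != y')].
  by rewrite -filter_predI; apply: eq_filter => k; rewrite /= andbC.
by rewrite Ef E1 big_filter_cond !big_split /=; ring.
Qed.

(** Exchanging the columns [y] and [y'] in the double expansion changes the sign of
    [sigma (y' / y)]; the sign of [sigma (x / x')] compensates it. *)
Lemma Z2_swap x x' X ys : uniq ys -> Z2 (x :: x' :: X) ys = Z2 (x' :: x :: X) ys.
Proof.
move=> Uy.
have E u u' : Z2 (u :: u' :: X) ys =
  \sum_(y <- ys) htw (u / y) * \prod_(k <- ys | k != y) (sigma2 (u / k) / sigma (k / y))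
     * (sigma2 (u' / y) * ((sigma (u / u'))^-1 * \prod_(x' <- X) (sigma2 (x' / y) / sigma (u / x'))))
     * Z2 (u' :: X) [seq k <- ys | k != y].
  rewrite [LHS]/=; apply: eq_bigr => y _; congr (_ * _ * _).
  by rewrite big_cons -!mulrA.
rewrite !E !Z2_expand2 // [RHS](exchange_big_dep predT) //=.
apply: eq_bigr => y _; apply: eq_big => [y'|y' _]; first by rewrite eq_sym.
under [in RHS]eq_bigl => k do rewrite andbC.
under [in RHS]eq_filter => k do rewrite andbC.
have -> : \prod_(k <- ys | (k != y) && (k != y'))
    (sigma2 (x' / k) / sigma (k / y') * (sigma2 (x / k) / sigma (k / y)))
  = \prod_(k <- ys | (k != y) && (k != y'))
    (sigma2 (x / k) / sigma (k / y) * (sigma2 (x' / k) / sigma (k / y'))).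
  by apply: eq_bigr => k _; rewrite mulrC.
rewrite -[y / y']invf_div -[x' / x]invf_div !sigmaV !invrN; ring.
Qed.

Lemma Z2_perm_x xs xs' ys : uniq ys -> perm_eq xs xs' -> Z2 xs ys = Z2 xs' ys.
Proof.
move=> Uy; apply: (@adjacent_swap_perm F F (fun s => Z2 s ys)) => s1 x x' s2 _.
elim: s1 ys Uy => [|z s1 IH] ys Uy; first exact: Z2_swap.
rewrite !cat_cons [LHS]/= [RHS]/=; apply: eq_bigr => y _.
rewrite IH ?filter_uniq //; congr (_ * _ * _); apply: perm_big.
by rewrite perm_cat2l -[x :: x' :: _]/([:: x; x'] ++ _) -[x' :: x :: _]/([:: x'; x] ++ _)
  perm_cat2r (perm_catC [:: x] [:: x']).
Qed.

Lemma filter_neq_head y Y : uniq (y :: Y) -> [seq k <- y :: Y | k != y] = Y.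
Proof.
rewrite /= eqxx => /andP[yY _] /=; apply/all_filterP/allP => k kY.
by apply: contraNneq yY => <-.
Qed.

(** Every term of the expansion other than that of [y] contains the factor [sigma2 (x / y)]. *)
Lemma Z2_node x X y Y : uniq (y :: Y) -> sigma2 (x / y) = 0 ->
  Z2 (x :: X) (y :: Y) = htw (x / y) * \prod_(k <- Y) (sigma2 (x / k) / sigma (k / y))
    * \prod_(x' <- X) (sigma2 (x' / y) / sigma (x / x')) * Z2 X Y.
Proof.
move=> Uy H0; rewrite Z2_cons big_cons -[RHS]addr0; congr (_ + _).
  by rewrite -[\prod_(k <- _ | _) _]big_filter filter_neq_head.
rewrite big_seq big1 // => y' y'Y.
have yy' : y != y' by apply: contraTneq y'Y => <-; case/andP: Uy.
by rewrite big_cons yy' H0 !mul0r mulr0 !mul0r.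
Qed.

Lemma prodrN_seq (I : Type) (s : seq I) (g : I -> F) :
  \prod_(k <- s) - g k = (-1) ^+ size s * \prod_(k <- s) g k.
Proof.
elim: s => [|k s IH]; first by rewrite !big_nil mulr1.
by rewrite !big_cons IH exprS; ring.
Qed.

Lemma sigma_ratio_sqr x y : x != 0 -> y != 0 -> x ^+ 2 != y ^+ 2 -> sigma (x / y) != 0.
Proof.
move=> x0 y0 H; rewrite sigma_eq0 ?mulf_neq0 ?invr_eq0 //; apply: contraNneq H.
rewrite exprMn exprVn => E; apply/eqP; apply: (mulIf (_ : y ^- 2 != 0)); rewrite ?invr_eq0 ?expf_neq0 //.
by rewrite E mulfV ?expf_neq0.
Qed.

(** Half of each [sigma2] cancels a denominator up to sign; the signs from rows and columns cancel
    because [X] and [Y] have equal size. The surviving factors are those of [grd_first], so [Z2] and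
    the domain-wall function obey the same recursion at this node. [Z2_nodeM] is the counterpart of
    [grd_last], without signs. *)
Lemma Z2_nodeV X y Y : a != 0 -> y != 0 -> 0 \notin X -> 0 \notin Y -> uniq Y ->
  (forall k, k \in Y -> k ^+ 2 != y ^+ 2) ->
  (forall x, x \in X -> a ^+ 2 * x ^+ 2 != y ^+ 2) -> size X = size Y ->
  Z2 ((y / a) :: X) (y :: Y) = sigma (a ^+ 2)
   * \prod_(k <- Y) sigma (a / (y / a / k)) * \prod_(x' <- X) sigma (a / (x' / y)) * Z2 X Y.
Proof.
move=> a0 y0 X0 Y0 Uy HY HX Hs; have yY : y \notin Y by apply/negP => /HY; rewrite eqxx.
have Uy' : uniq (y :: Y) by rewrite /= yY.
rewrite Z2_node //; last first.
  have -> : y / a / y = a^-1 by field; rewrite ?a0 ?y0 ?oner_neq0.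
  by rewrite /sigma2 mulfV // /sigma invr1 subrr mul0r.
have -> : \prod_(k <- Y) (sigma2 (y / a / k) / sigma (k / y))
   = \prod_(k <- Y) - sigma (a / (y / a / k)).
  rewrite big_seq [RHS]big_seq; apply: eq_bigr => k kY.
  have k0 : k != 0 by apply: contraNneq Y0 => <-.
  have sk := sigma_ratio_sqr k0 y0 (HY k kY).
  have -> : sigma2 (y / a / k) = - sigma (k / y) * sigma (a / (y / a / k)).
    rewrite /sigma2 -sigmaV; congr (sigma _ * _).
    by field; rewrite ?a0 ?y0 ?k0 ?oner_neq0.
  by rewrite mulNr mulNr mulrAC mulfV // mul1r.
have -> : \prod_(x' <- X) (sigma2 (x' / y) / sigma (y / a / x'))
   = \prod_(x' <- X) - sigma (a / (x' / y)).
  rewrite big_seq [RHS]big_seq; apply: eq_bigr => k kX.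
  have k0 : k != 0 by apply: contraNneq X0 => <-.
  have ky2 := HX k kX.
  have sk : sigma (y / a / k) != 0.
    by rewrite -mulrA -invfM sigma_ratio_sqr ?mulf_neq0 // exprMn eq_sym.
  have -> : sigma2 (k / y) = - sigma (y / a / k) * sigma (a / (k / y)).
    rewrite /sigma2 -sigmaV; congr (sigma _ * _).
    by field; rewrite ?a0 ?y0 ?k0 ?oner_neq0.
  by rewrite mulNr mulNr mulrAC mulfV // mul1r.
rewrite !prodrN_seq Hs.
have -> : htw (y / a / y) = sigma (a ^+ 2).
  by rewrite /htw /sigma; field; rewrite ?a0 ?y0 ?oner_neq0.
have : (-1) ^+ size Y * (-1) ^+ size Y = 1 :> F by rewrite -expr2 sqrr_sign.
move: ((-1) ^+ size Y) => e e2.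
transitivity (e * e * (sigma (a ^+ 2) * \prod_(k <- Y) sigma (a / (y / a / k))
  * \prod_(x' <- X) sigma (a / (x' / y)) * Z2 X Y)); first by ring.
by rewrite e2 mul1r.
Qed.

Lemma Z2_nodeM X y Y : a != 0 -> y != 0 -> 0 \notin X -> 0 \notin Y -> uniq Y ->
  (forall k, k \in Y -> k ^+ 2 != y ^+ 2) ->
  (forall x, x \in X -> a ^+ 2 * y ^+ 2 != x ^+ 2) ->
  Z2 ((a * y) :: X) (y :: Y) = sigma (a ^+ 2)
   * \prod_(k <- Y) sigma (a * (a * y / k)) * \prod_(x' <- X) sigma (a * (x' / y)) * Z2 X Y.
Proof.
move=> a0 y0 X0 Y0 Uy HY HX; have yY : y \notin Y by apply/negP => /HY; rewrite eqxx.
have Uy' : uniq (y :: Y) by rewrite /= yY.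
rewrite Z2_node //; last first.
  by rewrite mulfK // /sigma2 mulfV // {2}/sigma invr1 subrr mulr0.
have -> : \prod_(k <- Y) (sigma2 (a * y / k) / sigma (k / y))
   = \prod_(k <- Y) sigma (a * (a * y / k)).
  rewrite big_seq [RHS]big_seq; apply: eq_bigr => k kY.
  have k0 : k != 0 by apply: contraNneq Y0 => <-.
  have sk := sigma_ratio_sqr k0 y0 (HY k kY).
  rewrite /sigma2; have -> : a / (a * y / k) = k / y.
    by field; rewrite ?a0 ?y0 ?k0 ?oner_neq0.
  by rewrite mulfK.
have -> : \prod_(x' <- X) (sigma2 (x' / y) / sigma (a * y / x'))
   = \prod_(x' <- X) sigma (a * (x' / y)).
  rewrite big_seq [RHS]big_seq; apply: eq_bigr => k kX.
  have k0 : k != 0 by apply: contraNneq X0 => <-.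
  have ky2 := HX k kX.
  have sk : sigma (a * y / k) != 0 by rewrite sigma_ratio_sqr ?mulf_neq0 // exprMn.
  rewrite /sigma2; have -> : a / (k / y) = a * y / k.
    by field; rewrite ?a0 ?y0 ?k0 ?oner_neq0.
  by rewrite mulfK.
have -> // : htw (a * y / y) = sigma (a ^+ 2).
by rewrite mulfK // /htw /sigma; field; rewrite ?a0 ?y0 ?oner_neq0.
Qed.
End HalfTurnFactor.

(** * Cancellation of the poles of [Z2] in one row or column parameter *)

Section HalfTurnFactorLaurent.
Variables (F : fieldType) (a : F).
Hypothesis two_neq0 : 2%:R != 0 :> F.
Implicit Types (x y t : F) (xs ys X Y : seq F).
Local Notation sigma2 := (sigma2 a).
Local Notation htw := (htw a).
Local Notation Z2 := (Z2 a).
Local Notation sqrs s := (map (fun t => t ^+ 2) s).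

Lemma laurent_htwl y : laurent 2 (fun t => htw (t / y)).
Proof.
apply: laurentZ; apply: eq_laurent (laurent_binomial y^-1 y) => t _.
by rewrite invf_div [t / y]mulrC.
Qed.

Lemma laurent_htwr x : laurent 2 (fun t => htw (x / t)).
Proof. by apply: eq_laurent (laurent_htwl x) => t _; rewrite /htw invf_div addrC invf_div. Qed.

Lemma laurent_sigmal c y : laurent 2 (fun t => sigma (c * (t / y))).
Proof. by apply: eq_laurent (laurent_sigmaM (c / y)) => t _; rewrite mulrAC -mulrA. Qed.

Lemma laurent_sigmar c x : laurent 2 (fun t => sigma (c * (x / t))).
Proof. by apply: eq_laurent (laurent_sigmaV (c * x)) => t _; rewrite mulrA. Qed.

Lemma laurent_sigmaVl c y : laurent 2 (fun t => sigma (c / (t / y))).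
Proof. by apply: eq_laurent (laurent_sigmar c y) => t _; rewrite invf_div. Qed.

Lemma laurent_sigmaVr c x : laurent 2 (fun t => sigma (c / (x / t))).
Proof. by apply: eq_laurent (laurent_sigmal c x) => t _; rewrite invf_div. Qed.

Lemma laurent_sigma2l y : laurent 3 (fun t => sigma2 (t / y)).
Proof. exact: laurentM (laurent_sigmal a y) (laurent_sigmaVl a y). Qed.

Lemma laurent_sigma2r x : laurent 3 (fun t => sigma2 (x / t)).
Proof. exact: laurentM (laurent_sigmar a x) (laurent_sigmaVr a x). Qed.

(** Exchanging the two indices gives [S = - S]. *)
Lemma sum_antisym ys (G : F -> F -> F) : (forall y y', G y y' = - G y' y) ->
  \sum_(y <- ys) \sum_(y' <- ys | y' != y) G y y' = 0.
Proof.
move=> H; set S := LHS; suff E : S = - S.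
  by apply/eqP; rewrite -(mulrI_eq0 _ (lregP two_neq0)) mulr2n mulrDl mul1r {1}E addNr.
rewrite {1}/S [LHS](exchange_big_dep predT) //= -sumrN; apply: eq_bigr => y _.
rewrite -sumrN; apply: eq_big => [y'|y' _]; first by rewrite eq_sym.
exact: H.
Qed.

Lemma size_filter_neq y ys : uniq ys -> y \in ys -> (size [seq k <- ys | k != y]).+1 = size ys.
Proof. by move=> Uy yin; rewrite -rem_filter // size_rem // prednK //; case: (ys) yin. Qed.

(* The poles at [t ^ 2 = x ^ 2], [x \in X], cancel: the residue there is a sum antisymmetric
   in the two columns removed by [t] and [x]. *)
Lemma Z2_laurent_x X ys : 0 \notin X -> uniq (sqrs X) -> uniq ys -> size ys = (size X).+1 ->
  exists2 g, laurent (size ys).+1 g &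
    forall t, t != 0 -> (forall x, x \in X -> t ^+ 2 != x ^+ 2) -> Z2 (t :: X) ys = g t.
Proof.
move=> X0 UX Uy Hs.
(* [Z2] times the denominators [sigma (t / x')]. With [n = size ys] it has [2 * n] terms, and
   dividing out its [n - 1] zeros at [X] leaves [n + 1]. *)
pose N t := \sum_(y <- ys) htw (t / y) * \prod_(k <- ys | k != y) (sigma2 (t / k) / sigma (k / y))
  * (\prod_(x' <- X) sigma2 (x' / y)) * Z2 X [seq k <- ys | k != y].
have HN : laurent (size ys).*2 N.
  apply: (@eq_laurent _ _ (fun t => \sum_(y <- ys | y \in ys)
     (\prod_(x' <- X) sigma2 (x' / y) * Z2 X [seq k <- ys | k != y]) *
     (htw (t / y) * \prod_(k <- [seq k <- ys | k != y]) (sigma2 (t / k) / sigma (k / y))))).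
    by move=> t _; rewrite /N [RHS]big_seq; apply: eq_bigr => y _; rewrite big_filter; ring.
  apply: laurent_sum => y yin; apply: laurentZ.
  have := laurentM (laurent_htwl y) (@laurent_prod _ 2 _ [seq k <- ys | k != y]
    (fun k t => sigma2 (t / k) / sigma (k / y)) _).
  rewrite -(size_filter_neq Uy yin) addnS /= mul2n doubleS; apply => k.
  by apply: eq_laurent (laurentZ (sigma (k / y))^-1 (laurent_sigma2l k)) => t _; rewrite mulrC.
have N0 c : c \in X -> N c = 0.
  move=> cX; have E := perm_to_rem cX; rewrite /N.
  under eq_bigr => y _ do rewrite (perm_big _ E) /= big_cons
    (@Z2_perm_x _ _ _ (c :: rem c X)) ?filter_uniq //.
  rewrite Z2_expand2 //; apply: sum_antisym => y y'.
  rewrite -[y' / y]invf_div sigmaV invrN.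
  under eq_filter => k do rewrite andbC.
  under eq_bigl => k do rewrite andbC.
  by rewrite !big_split /=; ring.
have [g Hg Eg] := laurent_divs X0 UX HN N0.
exists g => [|t t0 Ht].
  by move: Hg; rewrite Hs -addnn addSnnS addKn.
have nz : \prod_(x' <- X) sigma (t / x') != 0.
  rewrite prodf_seq_neq0; apply/allP => x xX; rewrite sigma_ratio_sqr ?Ht //.
  by apply: contraNneq X0 => <-.
apply: (mulfI nz); rewrite -Eg // /N Z2_cons mulr_sumr; apply: eq_bigr => y _.
have -> : \prod_(x' <- X) (sigma2 (x' / y) / sigma (t / x'))
    = \prod_(x' <- X) sigma2 (x' / y) / \prod_(x' <- X) sigma (t / x').
  by rewrite big_split /= prodfV.
by move: nz; set s := \prod_(x' <- X) sigma _ => nz; field.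
Qed.

Local Notation sqr_inj s := {in s &, injective (fun t : F => t ^+ 2)}.

(** At [t ^ 2 = c ^ 2], [c] in [Y], the expansion has two singular terms, those of the columns [t]
    and [c], with opposite residues. The other factors depend on [t] through smaller instances of
    [Z2], whence the induction on the rows. *)
Lemma Z2_laurent_y xs Y : 0 \notin Y -> uniq Y -> sqr_inj Y -> size xs = (size Y).+1 ->
  exists2 g, laurent (size xs).+1 g &
    forall t, t != 0 -> (forall y, y \in Y -> t ^+ 2 != y ^+ 2) -> Z2 xs (t :: Y) = g t.
Proof.
elim: xs Y => // x X IH Y Y0 Uy Iy [Hs].
have {}IH y : y \in Y -> exists g, laurent (size X).+1 g /\
    forall t, t != 0 -> (forall k, k \in Y -> k != y -> t ^+ 2 != k ^+ 2) ->
      Z2 X (t :: [seq k <- Y | k != y]) = g t.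
  move=> yin; have [||k k' kin k'in||g Hg Eg] := IH [seq k <- Y | k != y].
  - by rewrite mem_filter (negPf Y0) andbF.
  - exact: filter_uniq.
  - by apply: Iy; [move: kin|move: k'in]; rewrite mem_filter => /andP[].
  - by rewrite Hs -(size_filter_neq Uy yin).
  exists g; split=> // t t0 Ht; apply: Eg => // k.
  by rewrite mem_filter => /andP[ky kY]; apply: Ht.
have [G HG] := seq_choice (fun=> 0) IH.
pose C y := htw (x / y) * \prod_(k <- Y | k != y) (sigma2 (x / k) / sigma (k / y))
   * \prod_(x' <- X) (sigma2 (x' / y) / sigma (x / x')).
(* [Z2] times the product of all [sigma (t / k)]. The first summand is the term of column [t], its
   sign coming from [sigma (k / t) = - sigma (t / k)]; [G y] is the Laurent form of the remaining
   [Z2]. *)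
pose N t := (-1) ^+ size Y * \prod_(k <- Y) sigma2 (x / k) * Z2 X Y *
    (htw (x / t) * \prod_(x' <- X) (sigma2 (x' / t) / sigma (x / x')))
  + \sum_(y <- Y) C y * (sigma2 (x / t) * \prod_(k <- [seq k <- Y | k != y]) sigma (t / k) * G y t).
have HN : laurent (size X).+1.*2 N.
  apply: laurentD.
    apply: laurentZ.
    have := laurentM (laurent_htwr x) (@laurent_prod _ 2 _ X
      (fun x' t => sigma2 (x' / t) / sigma (x / x')) _).
    rewrite addnS /= mul2n add2n -doubleS; apply => k.
    by apply: eq_laurent (laurentZ (sigma (x / k))^-1 (laurent_sigma2r k)) => t _; rewrite mulrC.
  apply: (@eq_laurent _ _ (fun t => \sum_(y <- Y | y \in Y) C y *
     (sigma2 (x / t) * \prod_(k <- [seq k <- Y | k != y]) sigma (t / k) * G y t))).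
    by move=> t _; rewrite [RHS]big_seq.
  apply: laurent_sum => y yin; apply: laurentZ.
  have H1 := @laurent_prod _ 1 _ [seq k <- Y | k != y] (fun k t => sigma (t / k)).
  have -> : (size X).+1.*2 = ((3 + (1 * size [seq k <- Y | k != y]).+1).-1 + (size X).+1).-1.
    by rewrite Hs -(size_filter_neq Uy yin) mul1n -addnn !(addnS, addSn) add0n.
  apply: laurentM (HG _ yin).1; apply: laurentM (laurent_sigma2r x) (H1 _) => k.
  by apply: eq_laurent (laurent_sigmal 1 k) => t _; rewrite mul1r.
have nz t k : t != 0 -> k \in Y -> t ^+ 2 != k ^+ 2 -> sigma (t / k) != 0.
  by move=> t0 kY; apply: sigma_ratio_sqr => //; apply: contraNneq Y0 => <-.
(* At [t = c] the terms of the columns [y] other than [c] contain [sigma (c / c) = 0], and that of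
   [c] cancels the first summand. *)
have N0 c : c \in Y -> N c = 0.
  move=> cY; have c0 : c != 0 by apply: contraNneq Y0 => <-.
  rewrite /N [\sum_(y <- Y) _](bigD1_seq c) //= [X in _ + (_ + X)]big1_seq ?addr0; last first.
    move=> y /andP[yc yY]; rewrite (bigD1_seq c) ?filter_uniq //=; last by rewrite mem_filter eq_sym yc.
    by rewrite mulfV // /sigma invr1 subrr !(mul0r, mulr0).
  rewrite -(HG _ cY).2 //; last first.
    by move=> k kY kc; apply: contraNneq kc => /(Iy _ _ cY kY) ->.
  have E : perm_eq (c :: [seq k <- Y | k != c]) Y by rewrite -rem_filter // perm_sym perm_to_rem.
  rewrite (Z2_perm_y _ _ E) /C !big_filter [\prod_(k <- Y) sigma2 _](bigD1_seq c) //=.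
  have -> : \prod_(k <- Y | k != c) (sigma2 (x / k) / sigma (k / c))
    = \prod_(k <- Y | k != c) sigma2 (x / k) / \prod_(k <- Y | k != c) sigma (k / c).
    by rewrite big_split /= prodfV.
  rewrite -(size_filter_neq Uy cY).
  have -> : \prod_(k <- Y | k != c) sigma (c / k)
     = (-1) ^+ size [seq k <- Y | k != c] * \prod_(k <- Y | k != c) sigma (k / c).
    rewrite -[in RHS]big_filter -prodrN_seq big_filter; apply: eq_bigr => k _.
    by rewrite -sigmaV invf_div.
  have nz' : \prod_(k <- Y | k != c) sigma (k / c) != 0.
    rewrite prodf_seq_neq0; apply/allP => k kY; apply/implyP => kc; rewrite nz //.
      by apply: contraNneq Y0 => <-.
    by apply: contraNneq kc => /(Iy _ _ kY cY) ->.
  by rewrite exprS; move: nz'; set s := \prod_(k <- Y | k != c) sigma (k / c) => nz'; field.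
have [g Hg Eg] := laurent_divs Y0 (etrans (map_inj_in_uniq Iy) Uy) HN N0.
exists g => [|t t0 Ht]; first by move: Hg; rewrite -Hs -addnn addSnnS addKn.
have tY : t \notin Y by apply: contraTN isT => /Ht; rewrite eqxx.
have nzP : \prod_(k <- Y) sigma (t / k) != 0.
  by rewrite prodf_seq_neq0; apply/allP => k kY /=; rewrite nz ?Ht.
apply: (mulfI nzP); rewrite -Eg // /N Z2_cons big_cons mulrDr; congr (_ + _).
  have UtY : uniq (t :: Y) by rewrite /= tY.
  rewrite -[\prod_(k <- _ :: _ | _) _]big_filter filter_neq_head //.
  have -> : \prod_(k <- Y) (sigma2 (x / k) / sigma (k / t))
    = \prod_(k <- Y) sigma2 (x / k) / \prod_(k <- Y) sigma (k / t).
    by rewrite big_split /= prodfV.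
  have -> : \prod_(k <- Y) sigma (k / t) = (-1) ^+ size Y * \prod_(k <- Y) sigma (t / k).
    by rewrite -prodrN_seq; apply: eq_bigr => k _; rewrite -sigmaV invf_div.
  have e1 : ((-1) ^+ size Y)^-1 = (-1) ^+ size Y :> F by rewrite invr_sign.
  rewrite invfM e1.
  by move: nzP; set s := \prod_(k <- Y) sigma (t / k) => nzP; field.
rewrite mulr_sumr; apply: eq_big_seq => y yY.
have ty : t != y by apply: contraNneq tY => ->.
rewrite /= ty big_cons ty (HG _ yY).2 // => [|k kY _]; last exact: Ht.
rewrite (bigD1_seq y) //= big_filter /C.
by have := nz _ _ t0 yY (Ht _ yY); set s := sigma (t / y) => sn; field.
Qed.
End HalfTurnFactorLaurent.

(** * The even model *)

Section EvenModels.
Variables (F : fieldType) (a : F).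
Hypothesis two_neq0 : 2%:R != 0 :> F.
Implicit Types (x y u v t : F) (xs ys X Y : seq F) (b : bool).
Local Notation grd := (gridZ a (fun x y => x / y)).
Local Notation T n := (nseq n true).
Local Notation O n := (nseq n false).
Local Notation neg p := (rev (map negb p)).
Local Notation sqr_inj s := {in s &, injective (fun t : F => t ^+ 2)}.

Lemma big_words_cons n (f : seq bool -> F) : \sum_(s <- words n.+1) f s
  = \sum_(s <- words n) f (true :: s) + \sum_(s <- words n) f (false :: s).
Proof. by rewrite big_wordsS big_bool. Qed.

Definition Zd xs ys := grd xs ys (T (size xs)) (O (size xs)) (T (size ys)) (O (size ys)).

(** [p] lists the right edges of the upper rows. A U-turn reverses the direction and the lower rows
    come in mirror order, hence [neg p]. *)
Definition HT X ys := \sum_(p <- words (size X))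
  grd (X ++ rev X) ys (T (size (X ++ rev X))) (p ++ neg p) (T (size ys)) (O (size ys)).

(* The half-turn model whose two innermost rows carry independent parameters [u] and [v],
   restricted to states whose innermost joined edge leaves row [u] with orientation [b]. *)
Definition innerHT b X u v ys := \sum_(p <- words (size X))
  grd (X ++ [:: u, v & rev X]) ys (T (size (X ++ [:: u, v & rev X])))
    (p ++ [:: b, ~~ b & neg p]) (T (size ys)) (O (size ys)).

Lemma HT_rcons X v ys : HT (rcons X v) ys = innerHT true X v v ys + innerHT false X v v ys.
Proof.
rewrite /HT size_rcons big_words_rcons exchange_big big_bool /= /innerHT rev_rcons cat_rcons.
by congr (_ + _); apply: eq_bigr => p _; rewrite map_rcons rev_rcons cat_rcons.
Qed.

Lemma Zd_perm_x xs xs' ys : a != 0 -> commuting a xs -> 0 \notin ys -> perm_eq xs xs' ->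
  Zd xs ys = Zd xs' ys.
Proof. by move=> a0 Hg Hy; apply: grd_rows_perm; rewrite ?size_nseq. Qed.

Lemma Zd_perm_y xs ys ys' : a != 0 -> commuting a ys -> 0 \notin xs -> perm_eq ys ys' ->
  Zd xs ys = Zd xs ys'.
Proof. by move=> a0 Hg Hy; apply: grd_cols_perm; rewrite ?size_nseq. Qed.

Lemma innerHT_perm_y b X u v ys ys' : a != 0 -> commuting a ys -> 0 \notin X -> u != 0 -> v != 0 ->
  perm_eq ys ys' -> innerHT b X u v ys = innerHT b X u v ys'.
Proof.
move=> a0 Hg X0 u0 v0 E; apply: eq_big_seq => p /size_words Hp.
apply: grd_cols_perm => //; rewrite ?size_nseq //.
  by rewrite mem_cat !in_cons mem_rev !negb_or X0 ![0 == _]eq_sym u0 v0.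
by rewrite !size_cat /= size_revneg size_rev Hp.
Qed.

Lemma Zd_first x X y Y : sigma (a * (x / y)) = 0 -> Zd (x :: X) (y :: Y)
  = sigma (a ^+ 2) * \prod_(x' <- X) sigma (a / (x' / y)) * \prod_(k <- Y) sigma (a / (x / k))
    * Zd X Y.
Proof. by move=> H; rewrite /Zd grd_first // mul1r. Qed.

Lemma Zd_last x X y Y : sigma (a / (x / y)) = 0 -> Zd (rcons X x) (y :: Y)
  = sigma (a ^+ 2) * \prod_(x' <- X) sigma (a * (x' / y)) * \prod_(k <- Y) sigma (a * (x / k))
    * Zd X Y.
Proof.
move=> H; rewrite /Zd size_rcons -[O (size X).+1](_ : rcons (O (size X)) false = _); last first.
  by rewrite -cats1 -[(size X).+1]addn1 nseqD.
by rewrite grd_last ?size_nseq // mul1r.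
Qed.

Lemma innerHT_first b x X u v y Y : sigma (a * (x / y)) = 0 ->
  innerHT b (x :: X) u v (y :: Y)
  = sigma (a ^+ 2) * \prod_(x' <- X ++ [:: u, v & rev (x :: X)]) sigma (a / (x' / y))
    * (\prod_(k <- Y) sigma (a / (x / k))) ^+ 2 * innerHT b X u v Y.
Proof.
move=> H; rewrite /innerHT big_words_cons.
rewrite [X in X + _]big1 ?add0r => [|p _]; last first.
  by rewrite [size (_ ++ _)]/= !cat_cons grd_first // mul0r.
rewrite mulr_sumr; apply: eq_big_seq => p /size_words Hp.
rewrite [size (_ ++ _)]/= !cat_cons grd_first // mul1r [rev (x :: X)]rev_cons map_cons rev_cons.
have E : X ++ [:: u, v & rcons (rev X) x] = rcons (X ++ [:: u, v & rev X]) x.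
  by rewrite rcons_cat.
have E' : p ++ [:: b, ~~ b & rcons (neg p) true] = rcons (p ++ [:: b, ~~ b & neg p]) true.
  by rewrite rcons_cat.
rewrite {2}E E' E size_rcons nseq_rcons grid_bot //; last first.
  by rewrite !size_cat /= size_revneg size_rev Hp.
by rewrite mul1r; ring.
Qed.

(** Here the lower copy of the row is frozen by its corner, and the U-turn then freezes the top row
    through [grid_topT]. *)
Lemma innerHT_last b x X u v y Y : sigma (a / (x / y)) = 0 ->
  innerHT b (x :: X) u v (y :: Y)
  = sigma (a ^+ 2) * \prod_(x' <- x :: X ++ [:: u, v & rev X]) sigma (a * (x' / y))
    * (\prod_(k <- Y) sigma (a * (x / k))) ^+ 2 * innerHT b X u v Y.
Proof.
move=> H; rewrite /innerHT big_words_cons.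
have E : x :: X ++ [:: u, v & rev (x :: X)] = rcons (x :: X ++ [:: u, v & rev X]) x.
  by rewrite rev_cons rcons_cons rcons_cat.
have E' q p : (q :: p) ++ [:: b, ~~ b & neg (q :: p)]
    = rcons (q :: p ++ [:: b, ~~ b & neg p]) (~~ q).
  by rewrite map_cons rev_cons rcons_cons rcons_cat.
have Es p : size p = size X -> size (p ++ [:: b, ~~ b & neg p]) = size (X ++ [:: u, v & rev X]).
  by move=> Hp; rewrite !size_cat /= size_revneg size_rev Hp.
rewrite !cat_cons E size_rcons.
rewrite [X in _ + X]big_seq [X in _ + X]big1 ?addr0 => [|p /size_words Hp]; last first.
  by rewrite E' grd_last ?mul0r //= Es.
rewrite mulr_sumr; apply: eq_big_seq => p /size_words Hp.
rewrite E' grd_last //; last by rewrite /= Es.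
by rewrite mul1r [size (_ :: _)]/= grid_topT; ring.
Qed.

Lemma laurent_row_x ys l us ds r :
  laurent (if l == r then (size ys).+1 else size ys)
    (fun t => rowZ a (map (fun y => t / y) ys) l us ds r).
Proof.
rewrite -(size_map (fun y t => t / y)).
apply: eq_laurent (@laurent_row F a (map (fun y t => t / y) ys) l us ds r _) => [t _|w].
  by rewrite -map_comp.
elim: ys => //= y ys IH [<-|/IH //].
by split; [apply: laurent_sigmal|apply: laurent_sigmaVl].
Qed.

Lemma laurent_row_y xs l us ds r :
  laurent (if l == r then (size xs).+1 else size xs)
    (fun t => rowZ a (map (fun x => x / t) xs) l us ds r).
Proof.
rewrite -(size_map (fun x t => x / t)).
apply: eq_laurent (@laurent_row F a (map (fun x t => x / t) xs) l us ds r _) => [t _|w].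
  by rewrite -map_comp.
elim: xs => //= x xs IH [<-|/IH //].
by split; [apply: laurent_sigmar|apply: laurent_sigmaVr].
Qed.

Lemma laurent_Zd_x X ys : laurent (size ys) (fun t => Zd (t :: X) ys).
Proof.
apply: laurent_sum => ms _; apply: eq_laurent (laurentZ _ (laurent_row_x ys true _ ms false)) => t _.
by rewrite mulrC.
Qed.

Lemma laurent_Zd_y xs Y : laurent (size xs) (fun t => Zd xs (t :: Y)).
Proof.
apply: (@eq_laurent _ _ (fun t => \sum_(ms <- words (size xs))
  grd xs Y ms (O (size xs)) (T (size Y)) (O (size Y))
  * rowZ a (map (fun x => x / t) xs) true (T (size xs)) ms false)).
  by move=> t _; rewrite /Zd grid_colS; apply: eq_bigr => ms _; rewrite mulrC.
by apply: laurent_sum => ms _; apply: laurentZ (laurent_row_y xs true _ ms false).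
Qed.

(** The two copies of the row end with opposite edges, so exactly one of them loses a term. *)
Lemma laurent_innerHT b X u v ys :
  laurent (size ys).*2 (fun t => innerHT b (t :: X) u v ys).
Proof.
pose M := X ++ [:: u, v & rev X].
apply: (@eq_laurent _ _ (fun t => \sum_(p <- words (size X)) \sum_(q : bool)
  \sum_(ms <- words (size ys)) \sum_(ns <- words (size ys))
   grd M ys (T (size M)) (p ++ [:: b, ~~ b & neg p]) ms ns *
   (rowZ a (map (fun y => t / y) ys) true (T (size ys)) ms q
    * rowZ a (map (fun y => t / y) ys) true ns (O (size ys)) (~~ q)))).
  move=> t _; rewrite /innerHT big_wordsS exchange_big /=.
  apply: eq_bigr => q _; apply: eq_big_seq => p /size_words Hp; apply: eq_bigr => ms _.
  have E : X ++ [:: u, v & rev (t :: X)] = rcons M t by rewrite rev_cons rcons_cat.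
  have E' : p ++ [:: b, ~~ b & rev (~~ q :: map negb p)]
      = rcons (p ++ [:: b, ~~ b & neg p]) (~~ q) by rewrite rev_cons rcons_cat.
  rewrite E E' size_rcons nseq_rcons grid_rconsr; last first.
    by rewrite !size_cat /= size_revneg size_rev Hp.
  by rewrite mulr_sumr; apply: eq_bigr => ns _; ring.
apply: laurent_sum => p _; apply: laurent_sum => q _.
apply: laurent_sum => ms _; apply: laurent_sum => ns _; apply: laurentZ.
have := laurentM (laurent_row_x ys true (T (size ys)) ms q)
  (laurent_row_x ys true ns (O (size ys)) (~~ q)).
by rewrite -addnn; case: (q); rewrite ?addnS.
Qed.

Lemma generic_sqr_inj s : generic a s -> sqr_inj s.
Proof.
move=> [_ _ _ _ H] x y xs ys /= E; apply/eqP/negPn/negP => /(H _ _ xs ys) /and5P[].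
by rewrite E eqxx.
Qed.

Lemma generic_cross s x y : generic a s -> x \in s -> y \in s -> x != y ->
  a ^+ 2 * x ^+ 2 != y ^+ 2.
Proof. by move=> [_ _ _ _ H] xs ys /(H _ _ xs ys) /and5P[]. Qed.

(** Nodes of different kinds are separated by [generic_ratio], which for one and the same [y] is the
    condition [a ^+ 4 != 1]. *)
Lemma node_sqr_uniq ys : generic a ys ->
  uniq (map (fun t => t ^+ 2) (map (fun y => y / a) ys ++ map (fun y => a * y) ys)).
Proof.
move=> G; have [a0 a4 _ Uy _] := G; have Iy := generic_sqr_inj G.
rewrite map_cat -!map_comp cat_uniq; apply/and3P; split.
- rewrite map_inj_in_uniq // => y y' yin y'in /=; rewrite !exprMn => /mulIf E.
  by apply: Iy => //; apply: E; rewrite expf_neq0 ?invr_eq0.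
- apply/hasPn => _ /mapP[y yin ->]; apply/mapP => -[y' y'in /=]; rewrite !exprMn exprVn => E.
  have /eqP := generic_ratio G yin y'in; apply.
  by apply: (mulIf (_ : a ^- 2 != 0)); rewrite ?invr_eq0 ?expf_neq0 // -E; field.
rewrite map_inj_in_uniq // => y y' yin y'in /=; rewrite !exprMn => /mulfI E.
by apply: Iy => //; apply: E; rewrite expf_neq0.
Qed.

Lemma commuting_cons x s : x != 0 -> commuting a s ->
  (forall x', x' \in s -> a ^+ 4 * x' ^+ 2 != x ^+ 2) -> commuting a (x :: s).
Proof.
move=> x0 [s0 H] Hx; split; first by rewrite in_cons negb_or s0 eq_sym x0.
move=> z z'; rewrite !in_cons => /orP[/eqP->|zs] /orP[/eqP->|z's] zz'.
- by rewrite eqxx in zz'.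
- by rewrite Hx ?orbT.
- by rewrite Hx.
by rewrite H.
Qed.

(** * Factorization of the refined even model; [s] and [s'] are [u] and [v] in either order *)

Section Factorization.
Variables (c1 c2 c : F) (u v s s' : F).
Hypothesis uv_perm : perm_eq [:: u; v] [:: s; s'].
Hypothesis base : forall y, y != 0 ->
  c1 * innerHT true [::] u v [:: y] + c2 * innerHT false [::] u v [:: y]
  = c * Zd [:: s] [:: y] * Z2 a [:: s'] [:: y].

Let prod_uv X g : \prod_(x <- X ++ [:: u, v & rev X]) g x
  = \prod_(x <- X ++ [:: s]) g x * \prod_(x <- X ++ [:: s']) g x :> F.
Proof.
rewrite !big_cat /= (_ : \prod_(x <- [:: u, v & rev X]) g x = g s * g s' * \prod_(x <- X) g x).
  by rewrite !big_seq1; ring.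
rewrite -[[:: u, v & rev X]]/([:: u; v] ++ rev X) big_cat /= (perm_big _ uv_perm) /=.
by rewrite big_cons big_seq1 (perm_big X) // perm_rev.
Qed.

Lemma innerHT_factor X ys : size ys = (size X).+1 ->
  generic a (X ++ s :: ys) -> generic a (X ++ s' :: ys) ->
  c1 * innerHT true X u v ys + c2 * innerHT false X u v ys
  = c * Zd (X ++ [:: s]) ys * Z2 a (X ++ [:: s']) ys.
Proof.
elim: X ys => [|x X IH] ys Hs Gs Gs'.
  case: ys Hs Gs {Gs'} => [|y []] // _ G; apply: base.
  by apply: generic_neq0 G _; rewrite /= !in_cons eqxx !orbT.
have [a0 a4 nzs Us Seps] := Gs.
have [_ _ nzs' Us' Seps'] := Gs'.
have Gy : generic a ys by apply: generic_cons (generic_catr Gs).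
have nzy y : y \in ys -> y != 0 by move=> yin; apply: generic_neq0 Gy yin.
have nzX z : z \in X ++ [:: s; s'] -> z != 0.
  rewrite mem_cat => /orP[zX|].
    by apply: generic_neq0 Gs _; rewrite mem_cat in_cons zX !orbT.
  rewrite !inE => /orP[/eqP->|/eqP->].
    by apply: generic_neq0 Gs _; rewrite mem_cat mem_head orbT.
  by apply: generic_neq0 Gs' _; rewrite mem_cat mem_head orbT.
have uv_mem z : z \in [:: u; v] -> z \in X ++ [:: s; s'].
  by rewrite (perm_mem uv_perm) mem_cat orbC => ->.
have u0 : u != 0 by apply/nzX/uv_mem; rewrite mem_head.
have v0 : v != 0 by apply/nzX/uv_mem; rewrite !inE eqxx orbT.
have X0 : 0 \notin X by apply/negP => zX; have := nzX 0; rewrite mem_cat zX eqxx => /(_ isT).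
have s0 : s != 0 by apply: nzX; rewrite mem_cat !inE eqxx orbT.
have x0 : x != 0 by apply: generic_neq0 Gs _; rewrite mem_head.
have Gxs' : generic a (x :: X ++ [:: s']).
  by apply: generic_catl (_ : generic a (_ ++ ys)); rewrite -cat_cons -catA.
have Gxs : generic a (x :: X ++ [:: s]).
  by apply: generic_catl (_ : generic a (_ ++ ys)); rewrite -cat_cons -catA.
have GXs := generic_cons Gxs; have GXs' := generic_cons Gxs'.
have [_ _ NXs' UXs' _] := GXs'.
have Uy : uniq ys by case: Gy.
have Cy := generic_commuting Gy.
have szX z : size ys = (size (X ++ [:: z])).+1 by rewrite Hs size_cat addn1.
have [g Hg Eg] := Z2_laurent_x a two_neq0 NXs'
  (etrans (map_inj_in_uniq (generic_sqr_inj GXs')) UXs') Uy (szX s').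
(* [g] replaces [Z2], so that no poles remain. The factor [Zd] has [size ys] terms and [g] one more;
   their product has [2 * size ys]. *)
pose D t := c1 * innerHT true (t :: X) u v ys + c2 * innerHT false (t :: X) u v ys
  - c * Zd (t :: X ++ [:: s]) ys * g t.
have HD : laurent (size ys).*2 D.
  apply: laurentD; first by apply: laurentD; apply: laurentZ; apply: laurent_innerHT.
  have -> : (size ys).*2 = (size ys + (size ys).+1).-1 by rewrite addnS addnn.
  apply: eq_laurent (laurentZ (- c) (laurentM (laurent_Zd_x (X ++ [:: s]) ys) Hg)) => t _.
  by ring.
have D0 t : t != 0 -> D t = 0.
  apply: (laurent_interp HD (node_sqr_uniq Gy)) => [||t'].
  - rewrite mem_cat negb_or; apply/andP; split; apply/mapP => -[y yin /esym/eqP].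
      by rewrite mulf_eq0 invr_eq0 (negPf a0) orbF (negPf (nzy _ yin)).
    by rewrite mulf_eq0 (negPf a0) (negPf (nzy _ yin)).
  - by rewrite size_cat !size_map addnn.
  rewrite mem_cat => yin'; have [y yin Et] : exists2 y, y \in ys & (t' = y / a) \/ (t' = a * y).
    by case/orP: yin' => /mapP[y yin Et]; exists y; auto.
  have y0 := nzy y yin; have Ey := perm_to_rem yin; set Y := rem y ys in Ey.
  have sY : size Y = (size X).+1 by have := perm_size Ey; rewrite Hs /= => -[].
  have GyY z : generic a ((x :: X) ++ z :: ys) -> generic a ((X ++ [:: z]) ++ y :: Y).
    move=> G; apply: generic_perm (_ : generic a ((X ++ [:: z]) ++ ys)).
      by rewrite perm_cat2l.
    by rewrite -catA; apply: generic_cons G.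
  have yX z x' : generic a ((X ++ [:: z]) ++ y :: Y) -> x' \in X ++ [:: z] ->
      (a ^+ 2 * x' ^+ 2 != y ^+ 2) && (a ^+ 2 * y ^+ 2 != x' ^+ 2).
    move=> G1 x'in.
    have [x'G yG] : x' \in (X ++ [:: z]) ++ y :: Y /\ y \in (X ++ [:: z]) ++ y :: Y.
      by rewrite !(mem_cat _ _ (y :: Y)) x'in mem_head orbT.
    have x'y : x' != y.
      apply: contraTneq x'in => ->; have [_ _ _ +] := G1; rewrite cat_uniq => /and3P[_ /hasPn/(_ y)].
      by rewrite mem_head => /(_ isT).
    by rewrite !(generic_cross G1) // eq_sym.
  have GY z : generic a ((X ++ [:: z]) ++ y :: Y) -> generic a (X ++ z :: Y).
    rewrite -catA /= => G; apply: (@generic_cons F a y); apply: generic_perm G.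
    by apply/permP => f; rewrite /= !count_cat /=; ring.
  have IHY := IH Y sY (GY _ (GyY _ Gs)) (GY _ (GyY _ Gs')).
  have G1 := GyY _ Gs'; have G2 := GyY _ Gs.
  have [Y0 UY Yy] : [/\ 0 \notin Y, uniq Y & forall k, k \in Y -> k ^+ 2 != y ^+ 2].
    have GyY' := generic_perm Ey Gy; have GY' := generic_cons GyY'.
    have [_ _ ? ? _] := GY'; split=> // k kY; apply/eqP => /(generic_sqr_inj GyY').
    rewrite mem_head in_cons kY orbT => /(_ isT isT) Eky.
    by have [_ _ _ +] := GyY'; rewrite -Eky /= kY.
  case: Et => ->.
  - have t0 : y / a != 0 by rewrite mulf_neq0 ?invr_eq0.
    have H1 : sigma (a * (y / a / y)) = 0.
      have -> : a * (y / a / y) = 1 by field; rewrite ?a0 ?y0 ?oner_neq0.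
      by rewrite /sigma invr1 subrr.
    rewrite /D -Eg //; last first.
      move=> x' x'in; have /andP[+ _] := yX _ _ G1 x'in; rewrite exprMn exprVn.
      by apply: contraNneq => <-; apply/eqP; field.
    have t0X : 0 \notin y / a :: X by rewrite in_cons negb_or X0 eq_sym t0.
    rewrite !(innerHT_perm_y _ a0 Cy t0X u0 v0 Ey) (Zd_perm_y a0 Cy _ Ey); last first.
      by rewrite -cat_cons mem_cat negb_or t0X inE eq_sym.
    rewrite (Z2_perm_y _ _ Ey) Z2_nodeV //; last 2 first.
    - by move=> x' x'in; case/andP: (yX _ _ G1 x'in).
    - by rewrite size_cat addn1.
    rewrite Zd_first // !innerHT_first //.
    (* The lower copy of row [y / a] also crosses column [y], with weight
       [sigma (a / a^-1) = sigma (a ^+ 2)]. *)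
    rewrite rev_cons [\prod_(x' <- _ ++ [:: u, v & rcons _ _]) _](_ : _ =
       sigma (a ^+ 2) * \prod_(x' <- X ++ [:: u, v & rev X]) sigma (a / (x' / y))); last first.
      rewrite -[u :: _]/([:: u, v & rcons (rev X) (y / a)]) -!rcons_cons -rcons_cat big_rcons /=.
      rewrite mulrC; congr (sigma _ * _); by field; rewrite ?a0 ?y0 ?oner_neq0.
    rewrite prod_uv.
    set P1 := \prod_(x' <- X ++ [:: s]) _; set P2 := \prod_(x' <- X ++ [:: s']) _.
    set P3 := \prod_(k <- Y) _.
    transitivity (sigma (a ^+ 2) * (sigma (a ^+ 2) * (P1 * P2)) * P3 ^+ 2 *
       ((c1 * innerHT true X u v Y + c2 * innerHT false X u v Y)
         - c * Zd (X ++ [:: s]) Y * Z2 a (X ++ [:: s']) Y)); first by ring.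
    by rewrite IHY subrr mulr0.
  - have t0 : a * y != 0 by rewrite mulf_neq0.
    have H1 : sigma (a / (a * y / y)) = 0.
      by rewrite mulfK // mulfV // /sigma invr1 subrr.
    rewrite /D -Eg //; last first.
      by move=> x' x'in; have /andP[_ +] := yX _ _ G1 x'in; rewrite exprMn.
    have t0X : 0 \notin a * y :: X by rewrite in_cons negb_or X0 eq_sym t0.
    (* To use the lower left corner, the row [a * y] of [Zd] is moved from the top to the bottom. *)
    have Ct : commuting a (a * y :: X ++ [:: s]).
      apply: commuting_cons (generic_commuting GXs) _ => // x' x'in.
      have /andP[+ _] := yX _ _ G2 x'in; apply: contraNneq; rewrite exprMn => E.
      apply/eqP; apply: (mulfI (_ : a ^+ 2 != 0)); first by rewrite expf_neq0.
      by rewrite -E; ring.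
    rewrite !(innerHT_perm_y _ a0 Cy t0X u0 v0 Ey) (Zd_perm_y a0 Cy _ Ey); last first.
      by rewrite -cat_cons mem_cat negb_or t0X inE eq_sym.
    rewrite (Z2_perm_y _ _ Ey) Z2_nodeM //; last first.
    - by move=> x' x'in; case/andP: (yX _ _ G1 x'in).
    rewrite (@Zd_perm_x _ (rcons (X ++ [:: s]) (a * y))) //; last 2 first.
    - by rewrite -(perm_mem Ey); apply/negP => /nzy; rewrite eqxx.
    - by rewrite perm_sym perm_rcons.
    rewrite Zd_last // !innerHT_last // big_cons prod_uv mulfK // -expr2.
    set P1 := \prod_(x' <- X ++ [:: s]) _; set P2 := \prod_(x' <- X ++ [:: s']) _.
    set P3 := \prod_(k <- Y) _.
    transitivity (sigma (a ^+ 2) * (sigma (a ^+ 2) * (P1 * P2)) * P3 ^+ 2 *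
       ((c1 * innerHT true X u v Y + c2 * innerHT false X u v Y)
         - c * Zd (X ++ [:: s]) Y * Z2 a (X ++ [:: s']) Y)); first by ring.
    by rewrite IHY subrr mulr0.
have := D0 x x0; rewrite /D -Eg //; first by move/eqP; rewrite subr_eq0 => /eqP.
move=> x' x'in; apply/negP => /eqP E.
have := generic_sqr_inj Gxs' (mem_head _ _) _ E; rewrite in_cons x'in orbT => /(_ isT) Ex.
by have [_ _ _ +] := Gxs'; rewrite Ex /= x'in.
Qed.
End Factorization.
End EvenModels.

(** * The odd model *)

Section OddModel.
Variables (F : fieldType) (a : F).
Hypothesis two_neq0 : 2%:R != 0 :> F.
Implicit Types (x y u v t : F) (xs ys X Y : seq F) (b : bool).
Local Notation grd := (gridZ a (fun x y => x / y)).
Local Notation T n := (nseq n true).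
Local Notation O n := (nseq n false).
Local Notation neg p := (rev (map negb p)).
Local Notation Zd := (Zd a).
Local Notation innerHT := (innerHT a).
Local Notation HT := (HT a).
Local Notation Z2 := (Z2 a).
Local Notation htw := (htw a).

Lemma Zd1 x y : Zd [:: x] [:: y] = sigma (a ^+ 2).
Proof.
by rewrite /(Zd _ _) /= !(big_cons, big_nil, big_bool) /= /vweight /=; ring.
Qed.

Lemma innerHT0 b u v y : innerHT b [::] u v [:: y]
  = sigma (a ^+ 2) * (if b then sigma (a * (u / y)) else sigma (a / (v / y))).
Proof.
rewrite /(innerHT _ _ _ _) /= !(big_cons, big_nil, big_bool) /=.
by case: b; rewrite /vweight /=; do 3 rewrite /= ?(big_cons, big_nil, big_bool) /=; ring.
Qed.

Lemma Z2_1 x y : Z2 [:: x] [:: y] = htw (x / y).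
Proof. by rewrite Z2_cons big_seq1 big_cons eqxx /= !big_nil !mulr1. Qed.

(** For one column this is [sigma (a ^+ 2) * sigma (a * u / y) + htw (a * u / v) * sigma (a * y / v)
    = sigma (a ^+ 2 * u / v) * htw (v / y)], times [sigma (a ^+ 2)]. *)
Lemma innerHT_factor_u X u v ys : size ys = (size X).+1 -> u != 0 -> v != 0 ->
  generic a (X ++ u :: ys) -> generic a (X ++ v :: ys) ->
  sigma (a ^+ 2) * innerHT true X u v ys + htw (a * u / v) * innerHT false X u v ys
  = sigma (a ^+ 2 * u / v) * Zd (X ++ [:: u]) ys * Z2 (X ++ [:: v]) ys.
Proof.
move=> Hs u0 v0 Gu Gv; have [a0 _ _ _ _] := Gu.
apply: innerHT_factor => // y y0; rewrite !innerHT0 Zd1 Z2_1 !htwE /sigma.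
by field; rewrite ?a0 ?u0 ?v0 ?y0 ?oner_neq0.
Qed.

Lemma innerHT_factor_v X u v ys : size ys = (size X).+1 -> u != 0 -> v != 0 ->
  generic a (X ++ u :: ys) -> generic a (X ++ v :: ys) ->
  htw (a * u / v) * innerHT true X u v ys + sigma (a ^+ 2) * innerHT false X u v ys
  = sigma (a ^+ 2 * u / v) * Zd (X ++ [:: v]) ys * Z2 (X ++ [:: u]) ys.
Proof.
move=> Hs u0 v0 Gu Gv; have [a0 _ _ _ _] := Gu.
apply: innerHT_factor => //; first by rewrite (perm_catC [:: u] [:: v]).
move=> y y0; rewrite !innerHT0 Zd1 Z2_1 !htwE /sigma.
by field; rewrite ?a0 ?u0 ?v0 ?y0 ?oner_neq0.
Qed.

Lemma htw_a : a != 0 -> htw a = sigma (a ^+ 2).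
Proof. by move=> a0; rewrite !htwE /sigma; field; rewrite ?a0 ?oner_neq0. Qed.

Lemma htw_V : a != 0 -> htw a^-1 = sigma (a ^+ 2).
Proof. by move=> a0; rewrite -htw_a // !htwE invrK addrC. Qed.

(** Two equal innermost rows: both coefficients and the constant on the right become
    [sigma (a ^+ 2)], nonzero by genericity. *)
Lemma HT_factor X ys : size ys = size X -> generic a (X ++ ys) -> HT X ys = Zd X ys * Z2 X ys.
Proof.
case/lastP: X => [|X v]; rewrite ?size_rcons.
  case: ys => // _ _; rewrite /(HT _ _) big_seq1 /(Zd _ _) /=; ring.
rewrite cat_rcons => Hs G; have [a0 a4 _ _ _] := G.
have v0 : v != 0 by apply: generic_neq0 G _; rewrite mem_cat mem_head orbT.
have := innerHT_factor_u Hs v0 v0 G G; rewrite !mulfK // htw_a // -mulrDr -HT_rcons -!mulrA.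
rewrite !cats1; apply: mulfI; rewrite sigma_eq0 ?expf_neq0 // -exprM //.
Qed.

(* The lower half of the lattice is turned by 180 degrees and put to the right of the upper
   half, so that the rows [X] run through all columns.  The middle row [u] crosses only the
   columns [ys]; its lower edges [gs] are glued to the columns on the right, and its right
   edge [b] to the column [y]. *)
Definition oddHT b X u ys y :=
  \sum_(es <- words (size ys)) \sum_(gs <- words (size ys))
    grd X (ys ++ y :: rev ys) (T (size X)) (O (size X)) (T (size (ys ++ y :: rev ys)))
      (es ++ b :: neg gs) * rowZ a (map (fun k => u / k) ys) true es gs b.

(** In the unfolded lattice each line of [X] is a single row with ends [true] and [false], so
    ordinary row commutation applies. *)
Lemma oddHT_perm_x b X X' u ys y : a != 0 -> commuting a X -> 0 \notin ys -> y != 0 ->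
  perm_eq X X' -> oddHT b X u ys y = oddHT b X' u ys y.
Proof.
move=> a0 HX Y0 y0 E; apply: eq_big_seq => es /size_words He; apply: eq_big_seq => gs /size_words Hg.
congr (_ * _); apply: grd_rows_perm => //; rewrite ?size_nseq //.
  by rewrite mem_cat in_cons mem_rev !negb_or Y0 eq_sym y0.
by rewrite !size_cat /= size_revneg size_rev He Hg.
Qed.

Lemma revnegK : involutive (fun p : seq bool => neg p).
Proof.
move=> p; rewrite map_rev revK -map_comp (eq_map (g := id)) ?map_id // => c /=.
by rewrite negbK.
Qed.

Lemma grd_rot_right X ys ps fs : size ps = size X -> size fs = size ys ->
  grd X (rev ys) ps (O (size X)) (T (size ys)) fs
  = grd (rev X) ys (T (size X)) (neg ps) (neg fs) (O (size ys)).
Proof.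
move=> Hp Hf; rewrite -grid_rot ?size_nseq ?size_rev // revK.
by rewrite !map_nseq !rev_nseq.
Qed.

Lemma row_rot_right x b ys fs gs : size fs = size ys -> size gs = size ys ->
  rowZ a (map (fun k => x / k) (rev ys)) b fs (neg gs) false
  = rowZ a (map (fun k => x / k) ys) true gs (neg fs) (~~ b).
Proof.
move=> Hf Hg; rewrite -row_rot ?size_map ?size_rev ?size_map // map_rev !revK.
by rewrite map_rev revK -map_comp (eq_map (g := id)) ?map_id // => c /=; rewrite negbK.
Qed.

(** Only one column depends on [t], with top edge [true] and bottom edge [b]; it is isolated by
    cutting the lattice on both sides. *)
Lemma laurent_oddHT b X u ys :
  laurent (if b then (size X).+1 else size X) (fun t => oddHT b X u ys t).
Proof.
apply: (@eq_laurent _ _ (fun t => \sum_(es <- words (size ys) | size es == size ys)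
  \sum_(gs <- words (size ys)) \sum_(ps <- words (size X)) \sum_(qs <- words (size X))
   (grd X ys (T (size X)) ps (T (size ys)) es *
    grd X (rev ys) qs (O (size X)) (T (size ys)) (neg gs) *
    rowZ a (map (fun k => u / k) ys) true es gs b)
   * rowZ a (map (fun x => x / t) X) true ps qs b)).
  move=> t _; rewrite /oddHT [RHS]big_seq [LHS]big_mkcond [RHS]big_mkcond; apply: eq_bigr => es _.
  rewrite mem_words; case: eqP => // Hes; apply: eq_bigr => gs _.
  rewrite size_cat nseqD grid_catc ?size_nseq // mulr_suml; apply: eq_bigr => ps _.
  rewrite /= size_rev grid_colS mulr_sumr mulr_suml; apply: eq_bigr => qs _; ring.
apply: laurent_sum => es _; apply: laurent_sum => gs _; apply: laurent_sum => ps _.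
apply: laurent_sum => qs _; apply: laurentZ.
exact: (laurent_row_y a X true ps qs b).
Qed.

Lemma HT_expand X ys : HT X ys = \sum_(ps <- words (size X)) \sum_(gs <- words (size ys))
  grd X ys (T (size X)) ps (T (size ys)) gs
  * grd (rev X) ys (T (size X)) (neg ps) gs (O (size ys)).
Proof.
apply: eq_big_seq => ps /size_words Hp.
by rewrite size_cat nseqD grid_catr ?size_nseq // size_rev.
Qed.

Lemma innerHT_expand b X u v ys : innerHT b X u v ys =
  \sum_(ps <- words (size X)) \sum_(es <- words (size ys)) \sum_(gs <- words (size ys))
  \sum_(fs <- words (size ys))
    grd X ys (T (size X)) ps (T (size ys)) es
    * rowZ a (map (fun k => u / k) ys) true es gs b
    * rowZ a (map (fun k => v / k) ys) true gs fs (~~ b)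
    * grd (rev X) ys (T (size X)) (neg ps) fs (O (size ys)).
Proof.
apply: eq_big_seq => ps /size_words Hp.
rewrite size_cat nseqD grid_catr ?size_nseq // [size (_ :: _)]/= size_rev.
apply: eq_bigr => es _; rewrite /= mulr_sumr; apply: eq_bigr => gs _.
by rewrite !mulr_sumr; apply: eq_bigr => fs _; ring.
Qed.

Lemma grd_mid X ys y ss (c : bool) fs : size ss = size ys -> size fs = size ys ->
  grd X (ys ++ y :: rev ys) (T (size X)) (O (size X)) (T (size (ys ++ y :: rev ys)))
    (ss ++ c :: fs)
  = \sum_(ps <- words (size X))
      grd X (rcons ys y) (T (size X)) ps (T (size ys).+1) (rcons ss c)
      * grd (rev X) ys (T (size X)) (neg ps) (neg fs) (O (size ys)).
Proof.
move=> Hs Hf; rewrite -!cat_rcons size_cat size_rcons nseqD grid_catc ?size_nseq ?size_rcons ?Hs //.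
apply: eq_big_seq => ps /size_words Hp.
by rewrite size_rev grd_rot_right.
Qed.

(** Row [x] falls apart at column [y]. Its left part turns up into the column and is pulled off by
    [row_corner]; its right part, turned back into the lower half, becomes a row joined to row [u]
    by the edge [b]. This is the refined even model with inner rows [u] and [x]. *)
Lemma oddHT_corner b X x u ys y : a != 0 -> y != 0 -> 0 \notin X -> 0 \notin ys -> x = a * y ->
  oddHT b (rcons X x) u ys y
  = sigma (a ^+ 2) * (\prod_(k <- ys) sigma (a * (x / k)) * \prod_(x' <- X) sigma (a * (x' / y)))
    * innerHT b X u x ys.
Proof.
move=> a0 y0 X0 Y0 Ex.
(* Types 5 and 6 vanish and types 1 to 4 all weigh [sigma (a ^+ 2)]: the vertex becomes two turns,
   joining left to upper and lower to right edge. *)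
have V p c q : vweight a (x / y) p q c b = sigma (a ^+ 2) * ((p == c)%:R * (b == q)%:R).
  rewrite Ex mulfK // /vweight; have -> : sigma (a / a) = 0 by rewrite mulfV // /sigma invr1 subrr.
  by rewrite -expr2; case: p c q (b) => [] [] [] [] /=; ring.
have Row ss c fs es gs : size ss = size ys -> size es = size ys ->
    rowZ a (map (fun k => x / k) (ys ++ y :: rev ys)) true (ss ++ c :: fs) (es ++ b :: gs) false
    = sigma (a ^+ 2) * (rowZ a (map (fun k => x / k) ys) true ss es c
       * rowZ a (map (fun k => x / k) (rev ys)) b fs gs false).
  move=> Hs He; rewrite map_cat row_cat ?size_map //=.
  under eq_bigr => p _ do under eq_bigr => q _ do rewrite V -!mulrA.
  by rewrite !big_bool; case: c (b) => [] [] /=; ring.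
rewrite innerHT_expand /oddHT.
transitivity (\sum_(es <- words (size ys)) \sum_(gs <- words (size ys))
  \sum_(ps <- words (size X)) \sum_(fs <- words (size ys))
   sigma (a ^+ 2) * (\sum_(ss <- words (size ys)) \sum_(c : bool)
      grd X (rcons ys y) (T (size X)) ps (T (size ys).+1) (rcons ss c)
      * rowZ a (map (fun k => x / k) ys) true ss es c)
    * (rowZ a (map (fun k => u / k) ys) true es gs b
    * rowZ a (map (fun k => x / k) ys) true gs (neg fs) (~~ b)
    * grd (rev X) ys (T (size X)) (neg ps) (neg fs) (O (size ys)))).
  apply: eq_big_seq => es /size_words He; apply: eq_big_seq => gs /size_words Hg.
  rewrite size_rcons nseq_rcons -[O (size X).+1](_ : rcons (O (size X)) false = _); last first.
    by rewrite -cats1 -[(size X).+1]addn1 nseqD.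
  rewrite grid_rconsr ?size_nseq //.
  rewrite [X in words X]size_cat big_words_cat mulr_suml.
  transitivity (\sum_(ss <- words (size ys)) \sum_(c : bool) \sum_(fs <- words (size ys))
    \sum_(ps <- words (size X))
      sigma (a ^+ 2) * (grd X (rcons ys y) (T (size X)) ps (T (size ys).+1) (rcons ss c)
        * rowZ a (map (fun k => x / k) ys) true ss es c)
      * (rowZ a (map (fun k => u / k) ys) true es gs b
        * rowZ a (map (fun k => x / k) ys) true gs (neg fs) (~~ b)
        * grd (rev X) ys (T (size X)) (neg ps) (neg fs) (O (size ys)))).
    apply: eq_big_seq => ss /size_words Hss; rewrite [size (_ :: _)]/= size_rev big_wordsS mulr_suml.
    apply: eq_bigr => c _; rewrite mulr_suml; apply: eq_big_seq => fs /size_words Hf.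
    rewrite Row // row_rot_right // grd_mid // !mulr_suml; apply: eq_bigr => ps _; ring.
  under [LHS]eq_bigr => ss _ do under eq_bigr => c _ do rewrite exchange_big /=.
  under [LHS]eq_bigr => ss _ do rewrite exchange_big /=.
  rewrite exchange_big /=; apply: eq_bigr => ps _.
  under [LHS]eq_bigr => ss _ do rewrite exchange_big /=.
  rewrite exchange_big /=; apply: eq_bigr => fs _.
  rewrite mulr_sumr mulr_suml; apply: eq_bigr => ss _.
  by rewrite mulr_sumr mulr_suml.
set K := (X in _ = X * _); rewrite mulr_sumr.
under [RHS]eq_bigr => ps _ do rewrite mulr_sumr.
rewrite [RHS]exchange_big; apply: eq_big_seq => es /size_words He.
under [RHS]eq_bigr => ps _ do rewrite mulr_sumr.
rewrite [RHS]exchange_big; apply: eq_bigr => gs _; apply: eq_big_seq => ps /size_words Hp.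
rewrite [in RHS]mulr_sumr -[RHS](@big_words_reindex F _ _ _ negbs_inj size_revneg).
by apply: eq_bigr => fs _; rewrite row_corner // /K; ring.
Qed.

(** Summing over [b] glues row [u] to the lower end of column [y]. At [u = a * y] this whole line
    comes off by [row_corner], leaving the even model. *)
Lemma oddHT_turn X u ys y : a != 0 -> y != 0 -> 0 \notin X -> 0 \notin ys -> u = a * y ->
  oddHT true X u ys y + oddHT false X u ys y
  = \prod_(k <- ys) sigma (a * (u / k)) * \prod_(x' <- X) sigma (a * (x' / y)) * HT X ys.
Proof.
move=> a0 y0 X0 Y0 Eu; rewrite HT_expand.
transitivity (\sum_(gs <- words (size ys)) \sum_(ps <- words (size X))
  (\sum_(ss <- words (size ys)) \sum_(c : bool)
      grd X (rcons ys y) (T (size X)) ps (T (size ys).+1) (rcons ss c)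
      * rowZ a (map (fun k => u / k) ys) true ss gs c)
  * grd (rev X) ys (T (size X)) (neg ps) gs (O (size ys))).
  transitivity (\sum_(b : bool) oddHT b X u ys y); first by rewrite big_bool.
  transitivity (\sum_(b : bool) \sum_(es <- words (size ys)) \sum_(gs <- words (size ys))
    \sum_(ps <- words (size X)) grd X (rcons ys y) (T (size X)) ps (T (size ys).+1) (rcons es b)
      * rowZ a (map (fun k => u / k) ys) true es gs b
      * grd (rev X) ys (T (size X)) (neg ps) gs (O (size ys))).
    apply: eq_bigr => b _; apply: eq_big_seq => es /size_words He.
    apply: eq_big_seq => gs /size_words Hg; rewrite grd_mid ?size_revneg // mulr_suml.
    by apply: eq_bigr => ps _; rewrite revnegK; ring.
  rewrite exchange_big /=.
  under [LHS]eq_bigr => es _ do rewrite exchange_big /=.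
  rewrite exchange_big /=; apply: eq_bigr => gs _.
  under [LHS]eq_bigr => es _ do rewrite exchange_big /=.
  rewrite exchange_big /=; apply: eq_bigr => ps _.
  by rewrite mulr_suml; apply: eq_bigr => es _; rewrite mulr_suml.
rewrite exchange_big mulr_sumr; apply: eq_big_seq => ps /size_words Hp.
rewrite mulr_sumr; apply: eq_big_seq => gs /size_words Hg.
by rewrite row_corner // mulrA.
Qed.

Section Identities.
Variables (X ys : seq F) (u : F).
Hypothesis size_ys : size ys = size X.
Hypothesis gen : generic a (u :: X ++ ys).

Let a0 : a != 0. Proof. by case: gen. Qed.
Let u0 : u != 0. Proof. by apply: generic_neq0 gen _; rewrite mem_head. Qed.
Let genXy : generic a (X ++ ys). Proof. exact: generic_cons gen. Qed.
Let genuX : generic a (u :: X). Proof. exact: (@generic_catl F a (u :: X) ys). Qed.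
Let genX : generic a X. Proof. exact: generic_cons genuX. Qed.
Let X0 : 0 \notin X. Proof. by case: genX. Qed.
Let Y0 : 0 \notin ys. Proof. by case: (generic_catr genXy). Qed.
Let Uy : uniq ys. Proof. by case: (generic_catr genXy). Qed.

Let ty0 t : t != 0 -> 0 \notin t :: ys.
Proof. by move=> t0; rewrite in_cons negb_or eq_sym t0. Qed.

Let Zd_rcons x X' : perm_eq (u :: X) (rcons X' x) ->
  Zd (u :: X) (x / a :: ys) = sigma (a ^+ 2) * \prod_(x' <- X') sigma (a * (x' / (x / a)))
    * \prod_(k <- ys) sigma (a * (x / k)) * Zd X' ys.
Proof.
move=> E; have x0 : x != 0.
  by apply: generic_neq0 genuX _; rewrite (perm_mem E) mem_rcons mem_head.
rewrite (Zd_perm_x a0 (generic_commuting genuX) _ E) ?ty0 ?mulf_neq0 ?invr_eq0 //.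
rewrite Zd_last //; have -> : a / (x / (x / a)) = 1 by field; rewrite ?a0 ?x0 ?oner_neq0.
by rewrite /sigma invr1 subrr.
Qed.

Let split_row x : x \in X -> exists X', [/\ perm_eq X (rcons X' x),
  generic a (X' ++ u :: ys), generic a (X' ++ x :: ys) & size ys = (size X').+1].
Proof.
move=> xX; have E : perm_eq X (rcons (rem x X) x) by rewrite perm_sym perm_rcons perm_sym perm_to_rem.
exists (rem x X); split=> //; last by rewrite size_ys (perm_size E) size_rcons.
- apply: (@generic_cons F a x); apply: generic_perm gen; apply/permP => f.
  by have /permP/(_ f) := E; rewrite -cats1 /= !count_cat /= addn0 => ->; ring.
apply: (@generic_cons F a u); apply: generic_perm gen; apply/permP => f.
by have /permP/(_ f) := E; rewrite -cats1 /= !count_cat /= addn0 => ->; ring.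
Qed.

Let node_nz t : t \in map (fun x => x / a) (u :: X) -> t != 0.
Proof.
by case/mapP => x /(generic_neq0 genuX) x0 ->; rewrite mulf_neq0 ?invr_eq0.
Qed.

(** The factor [htw] multiplies the part with [b = false], which has one term fewer, so all summands
    have [size X + 1] terms, as many as there are nodes. *)
Lemma oddHT_relA y : y != 0 ->
  sigma (a ^+ 2) * oddHT true X u ys y + htw (u / y) * oddHT false X u ys y
  = Zd (u :: X) (y :: ys) * Z2 X ys.
Proof.
pose D t := sigma (a ^+ 2) * oddHT true X u ys t + htw (u / t) * oddHT false X u ys t
  - Zd (u :: X) (t :: ys) * Z2 X ys.
suff D0 : forall t, t != 0 -> D t = 0 by move=> /D0/eqP; rewrite subr_eq0 => /eqP.
have HD : laurent (size X).+1 D.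
  apply: laurentD; first apply: laurentD.
  - exact: laurentZ (laurent_oddHT true X u ys).
  - exact: (laurentM (laurent_htwr a u) (laurent_oddHT false X u ys)).
  apply: eq_laurent (laurentZ (- Z2 X ys) (laurent_Zd_y a (u :: X) ys)) => t _; ring.
apply: (laurent_interp HD (s := map (fun x => x / a) (u :: X))).
- by have := node_sqr_uniq genuX; rewrite map_cat cat_uniq => /and3P[].
- by apply/negP => /node_nz; rewrite eqxx.
- by rewrite size_map.
move=> t tin; have t0 := node_nz tin; case/mapP: tin => x xin Et.
have Ex : x = a * t by rewrite Et mulrC mulfVK.
have x0 : x != 0 by rewrite Ex mulf_neq0.
move: xin; rewrite in_cons /D => /orP[/eqP xu|/split_row[X' [E Gu Gx Hs]]].
  have Eu : u = a * t by rewrite -xu.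
  have -> : htw (u / t) = sigma (a ^+ 2) by rewrite Eu mulfK // htw_a.
  rewrite -mulrDr oddHT_turn // HT_factor // Et xu (Zd_rcons (x := u) (X' := X)); last by rewrite perm_sym perm_rcons.
  by ring.
have X'0 : 0 \notin X' by have [_ _ + _ _] := generic_catl Gu.
rewrite !(oddHT_perm_x _ _ a0 (generic_commuting genX) Y0 t0 E) !oddHT_corner //.
rewrite Et (Zd_rcons (X' := u :: X')) ?rcons_cons ?perm_cons // -Et big_cons.
have := innerHT_factor_u Hs u0 x0 Gu Gx.
have -> : a * u / x = u / t by rewrite Ex; field; rewrite ?a0 ?t0 ?oner_neq0.
have -> : a ^+ 2 * u / x = a * (u / t) by rewrite Ex; field; rewrite ?a0 ?t0 ?oner_neq0.
have -> : Z2 (X' ++ [:: x]) ys = Z2 X ys by apply: Z2_perm_x; rewrite // cats1 perm_sym.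
have -> : Zd (X' ++ [:: u]) ys = Zd (u :: X') ys.
  apply: Zd_perm_x => //; last by rewrite perm_catC.
  by apply/generic_commuting/(@generic_catl F a _ ys); rewrite -catA.
move=> W; set K := _ * \prod_(x' <- X') _; set c := sigma (a ^+ 2).
transitivity (c * K * (c * innerHT true X' u x ys + htw (u / t) * innerHT false X' u x ys
   - sigma (a * (u / t)) * Zd (u :: X') ys * Z2 X ys)); first by rewrite /K; ring.
by rewrite W subrr mulr0.
Qed.

(** Now [htw] multiplies the wider part, so one more node is needed. At [y = a * u] one has
    [htw (u / y) = sigma (a ^+ 2)], and the relation reduces to [oddHT_relA] and a comparison of
    right-hand sides. The condition on [y] avoids the poles of [Z2]. *)
Lemma oddHT_relB y : y != 0 -> (forall k, k \in ys -> y ^+ 2 != k ^+ 2) ->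
  htw (u / y) * oddHT true X u ys y + sigma (a ^+ 2) * oddHT false X u ys y
  = Zd X ys * Z2 (u :: X) (y :: ys).
Proof.
have Iy := generic_sqr_inj (generic_catr genXy).
have [g Hg Eg] : exists2 g, laurent (size (u :: X)).+1 g & forall t, t != 0 ->
    (forall k, k \in ys -> t ^+ 2 != k ^+ 2) -> Z2 (u :: X) (t :: ys) = g t.
  by apply: Z2_laurent_y; rewrite //= size_ys.
move=> y0 Hy; rewrite Eg //; move: y y0 {Hy}.
pose D t := htw (u / t) * oddHT true X u ys t + sigma (a ^+ 2) * oddHT false X u ys t
  - Zd X ys * g t.
suff D0 : forall t, t != 0 -> D t = 0 by move=> y /D0/eqP; rewrite subr_eq0 => /eqP.
have HD : laurent (size X).+2 D.
  apply: laurentD; first apply: laurentD.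
  - exact: (laurentM (laurent_htwr a u) (laurent_oddHT true X u ys)).
  - exact: laurent_shift (laurentZ _ (laurent_oddHT false X u ys)).
  apply: eq_laurent (laurentZ (- Zd X ys) Hg) => t _; ring.
have uX_ys x k : x \in u :: X -> k \in ys -> k ^+ 2 != (x / a) ^+ 2.
  move=> xin kin; have xk : k != x.
    apply: contraTneq xin => <-; have [_ _ _ +] := gen.
    by rewrite -cat_cons cat_uniq => /and3P[_ /hasPn/(_ k kin)].
  have : a ^+ 2 * k ^+ 2 != x ^+ 2.
    by apply: (generic_cross gen) => //; rewrite -cat_cons mem_cat ?xin ?kin ?orbT.
  rewrite exprMn exprVn; apply: contraNneq => ->; apply/eqP; by field.
have uX_ysM k : k \in ys -> k ^+ 2 != (a * u) ^+ 2.
  move=> kin; have xk : u != k.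
    by apply: contraTneq kin => <-; have [_ _ _ +] := gen; rewrite /= mem_cat negb_or => /andP[/andP[]].
  rewrite exprMn eq_sym; apply: (generic_cross gen) => //; first by rewrite mem_head.
  by rewrite in_cons mem_cat kin !orbT.
apply: (laurent_interp HD (s := rcons (map (fun x => x / a) (u :: X)) (a * u))).
- have := node_sqr_uniq genuX; rewrite [map (fun y => a * y) _]/= -cat_rcons map_cat cat_uniq.
  by case/and3P.
- rewrite mem_rcons in_cons negb_or eq_sym mulf_neq0 //=.
  by apply/negP => /node_nz; rewrite eqxx.
- by rewrite size_rcons size_map.
(* For [t = u / a] and [t = a * u] both relations have the same left-hand side. *)
have relA t : t != 0 -> htw (u / t) = sigma (a ^+ 2) ->
    (forall k, k \in ys -> t ^+ 2 != k ^+ 2) ->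
    Zd (u :: X) (t :: ys) * Z2 X ys = Zd X ys * Z2 (u :: X) (t :: ys) -> D t = 0.
  move=> t0 Hh Hk E; rewrite /D -Eg // -E -oddHT_relA // Hh subrr //.
have uxX x : x \in X -> u != x.
  by move=> xX; apply: contraTneq xX => <-; have [_ _ _ /= /andP[]] := genuX.
move=> t; rewrite mem_rcons in_cons => /orP[/eqP->|tin].
  have t0 : a * u != 0 by rewrite mulf_neq0.
  have Eu : u = a * u / a by rewrite mulrAC mulfV ?mul1r.
  have Ev : u / (a * u) = a^-1 by field; rewrite ?a0 ?u0 ?oner_neq0.
  apply: relA => //; first by rewrite Ev htw_V.
    by move=> k kin; rewrite eq_sym uX_ysM.
  rewrite Zd_first; last by rewrite Ev mulfV // /sigma invr1 subrr.
  rewrite {3}Eu Z2_nodeV // -?Eu; first by ring.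
  move=> x xX; rewrite exprMn (inj_eq (mulfI _)) ?expf_neq0 //.
  apply/eqP => /(generic_sqr_inj genuX); rewrite mem_head in_cons xX orbT => /(_ isT isT) E.
  by have := uxX _ xX; rewrite E eqxx.
have t0 := node_nz tin; case/mapP: tin => x xin Et.
have Ex : x = a * t by rewrite Et mulrC mulfVK.
have x0 : x != 0 by rewrite Ex mulf_neq0.
have Hk k : k \in ys -> k ^+ 2 != t ^+ 2 by move=> kin; rewrite Et uX_ys.
have nodeM X' : 0 \notin X' -> {subset X' <= u :: X} -> x \notin X' ->
    Z2 (x :: X') (t :: ys) = sigma (a ^+ 2) * \prod_(k <- ys) sigma (a * (x / k))
      * \prod_(x' <- X') sigma (a * (x' / t)) * Z2 X' ys.
  move=> X'0 sub xX'; rewrite Ex Z2_nodeM // => x' x'X; rewrite -exprMn -Ex.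
  by apply: contraNneq xX' => E; rewrite (generic_sqr_inj genuX xin (sub _ x'X) E).
move: xin; rewrite in_cons => /orP[/eqP xu|xX].
  apply: relA => //; first by rewrite -xu Ex mulfK // htw_a.
    by move=> k kin; rewrite eq_sym Hk.
  rewrite -xu nodeM // => [|x' x'X|]; last 2 first.
  - by rewrite in_cons x'X orbT.
  - by rewrite xu; have [_ _ _ /= /andP[]] := genuX.
  rewrite Et xu (Zd_rcons (x := u) (X' := X)); last by rewrite perm_sym perm_rcons.
  by ring.
have ux := uxX _ xX; have [X' [E Gu Gx Hs]] := split_row xX.
have X'0 : 0 \notin X' by have [_ _ + _ _] := generic_catl Gu.
have sub : {subset X' <= X} by move=> z zX'; rewrite (perm_mem E) mem_rcons in_cons zX' orbT.
have xX' : x \notin X' by have [_ _ _ +] := genX; rewrite (perm_uniq E) rcons_uniq => /andP[].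
rewrite /D -Eg //; last by move=> k kin; rewrite eq_sym Hk.
rewrite !(oddHT_perm_x _ _ a0 (generic_commuting genX) Y0 t0 E) !oddHT_corner //.
have tys : uniq (t :: ys).
  by rewrite /= Uy andbT; apply/negP => /Hk; rewrite eqxx.
have Ep : perm_eq (u :: X) (x :: u :: X').
  apply/permP => f; have /permP/(_ f) := E; rewrite -cats1 /= !count_cat /= addn0 => ->; ring.
rewrite (Z2_perm_x _ tys Ep) nodeM //; last 3 first.
- by rewrite in_cons negb_or X'0 eq_sym u0.
- by move=> z; rewrite !in_cons => /orP[->//|/sub->]; rewrite orbT.
- by rewrite in_cons negb_or eq_sym ux.
rewrite big_cons.
have := innerHT_factor_v Hs u0 x0 Gu Gx.
have -> : a * u / x = u / t by rewrite Ex; field; rewrite ?a0 ?t0 ?oner_neq0.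
have -> : a ^+ 2 * u / x = a * (u / t) by rewrite Ex; field; rewrite ?a0 ?t0 ?oner_neq0.
have -> : Z2 (X' ++ [:: u]) ys = Z2 (u :: X') ys by apply: Z2_perm_x; rewrite // perm_catC.
have -> : Zd (X' ++ [:: x]) ys = Zd X ys.
  rewrite cats1; symmetry; apply: Zd_perm_x => //; exact: generic_commuting.
move=> W; set K := _ * \prod_(x' <- X') _; set c := sigma (a ^+ 2).
transitivity (c * K * (htw (u / t) * innerHT true X' u x ys + c * innerHT false X' u x ys
   - sigma (a * (u / t)) * Zd X ys * Z2 (u :: X') ys)); first by rewrite /K; ring.
by rewrite W subrr mulr0.
Qed.
End Identities.
End OddModel.

(** * From lattice states to sums over rows *)

Section PathSums.
Variable F : fieldType.

Lemma big_ffun_cons n (S : finType) (G : {ffun 'I_n.+1 -> S} -> F) :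
  \sum_f G f = \sum_(s : S) \sum_(g : {ffun 'I_n -> S})
    G [ffun i : 'I_n.+1 => oapp g s (unlift ord0 i)].
Proof.
rewrite pair_bigA /=.
pose h (p : S * {ffun 'I_n -> S}) := [ffun i : 'I_n.+1 => oapp p.2 p.1 (unlift ord0 i)].
rewrite (reindex h) //; exists (fun f : {ffun 'I_n.+1 -> S} =>
  (f ord0, [ffun i : 'I_n => f (lift ord0 i)])) => [[s g] _|f _].
  by rewrite /h ffunE unlift_none; congr (_, _); apply/ffunP => i; rewrite !ffunE liftK.
apply/ffunP => i; rewrite !ffunE.
by case: unliftP => [j ->|->] /=; rewrite ?ffunE.
Qed.

Lemma big_ffun0 (S : finType) (G : {ffun 'I_0 -> S} -> F) (f : {ffun 'I_0 -> S}) :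
  \sum_g G g = G f.
Proof.
by rewrite (bigD1 f) //= big1 ?addr0 // => g /eqP[]; apply/ffunP => i; have := ltn_ord i; rewrite ltn0.
Qed.

Lemma big_ffun_curry (I J S : finType) (G : {ffun I * J -> S} -> F) :
  \sum_h G h = \sum_(H : {ffun I -> {ffun J -> S}}) G [ffun p => H p.1 p.2].
Proof.
pose c (H : {ffun I -> {ffun J -> S}}) := [ffun p : I * J => H p.1 p.2].
rewrite (reindex c) //; exists (fun h : {ffun I * J -> S} => [ffun i => [ffun j => h (i, j)]]) => H _.
  by apply/ffunP => i; apply/ffunP => j; rewrite !ffunE.
by apply/ffunP => -[i j]; rewrite !ffunE.
Qed.

Section Path.
Variable S : finType.

(** The entry [(s, t)] of the product of the transfer matrices [K 0], ..., [K (n - 1)]. *)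
Fixpoint pathw n (K : nat -> S -> S -> F) s t : F :=
  if n is k.+1 then \sum_(s' : S) K 0%N s s' * pathw k (fun i => K i.+1) s' t
  else (s == t)%:R.

Lemma inord_lift n i : (i <= n)%N -> inord i.+1 = lift ord0 (inord i : 'I_n.+1) :> 'I_n.+2.
Proof. by move=> Hi; apply: val_inj; rewrite /= inordK // /bump inordK. Qed.

Lemma pathwE n (K : nat -> S -> S -> F) s t :
  \sum_(V : {ffun 'I_n.+1 -> S}) ((V ord0 == s) && (V ord_max == t))%:R
     * \prod_(i < n) K i (V (inord i)) (V (inord i.+1))
  = pathw n K s t.
Proof.
elim: n K s => [|n IH] K s.
  rewrite big_ffun_cons /= (bigD1 s) //= [X in _ + X]big1 ?addr0 => [|s' /negPf ns].
    rewrite (big_ffun0 _ [ffun=> s]) big_ord0 mulr1 !ffunE unlift_none /= eqxx.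
    by rewrite (_ : ord_max = ord0) ?unlift_none //; apply: val_inj.
  by rewrite big1 // => g _; rewrite ffunE unlift_none /= ns mul0r.
rewrite big_ffun_cons /= (bigD1 s) //= [X in _ + X]big1 ?addr0 => [|s' /negPf ns]; last first.
  by rewrite big1 // => g _; rewrite ffunE unlift_none /= ns mul0r.
under [RHS]eq_bigr => s' _ do rewrite -IH mulr_sumr.
rewrite exchange_big; apply: eq_bigr => g _.
rewrite (bigD1 (g ord0)) //= [X in _ + X]big1 ?addr0 => [|s' /negPf ns]; last first.
  by rewrite eq_sym ns mul0r mulr0.
rewrite eqxx !ffunE unlift_none /= eqxx (_ : ord_max = lift ord0 ord_max); last exact: val_inj.
rewrite liftK /= mulrCA; congr (_ * _); rewrite big_ord_recl /= (_ : inord 0 = ord0); last first.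
  by apply: val_inj; rewrite /= inordK.
rewrite ffunE unlift_none inord_lift // ffunE liftK /=; congr (_ * _).
  by congr (K _ _ (g _)); apply: val_inj; rewrite /= inordK.
apply: eq_bigr => i _; rewrite /bump /= add1n !inord_lift ?ltn_ord //; last exact: ltnW.
by rewrite !ffunE !liftK.
Qed.

Lemma pathw_cat m n (K : nat -> S -> S -> F) s t :
  pathw (m + n) K s t = \sum_(s' : S) pathw m K s s' * pathw n (fun i => K (m + i)%N) s' t.
Proof.
elim: m K s => [|m IH] K s /=.
  rewrite (bigD1 s) //= eqxx mul1r big1 ?addr0 // => s' /negPf ns.
  by rewrite eq_sym ns mul0r.
under eq_bigr => s1 _ do rewrite IH mulr_sumr.
rewrite exchange_big /=; apply: eq_bigr => s2 _.
by rewrite mulr_suml; apply: eq_bigr => s1 _; rewrite mulrA.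
Qed.

Lemma eq_pathw n (K K' : nat -> S -> S -> F) s t :
  (forall i s1 s2, (i < n)%N -> K i s1 s2 = K' i s1 s2) -> pathw n K s t = pathw n K' s t.
Proof.
elim: n K K' s => //= n IH K K' s H; apply: eq_bigr => s' _.
by rewrite H // (IH _ (fun i => K' i.+1)) // => i s1 s2 Hi; rewrite H.
Qed.

End Path.

Definition word n (f : {ffun 'I_n -> bool}) : seq bool := [seq f i | i <- enum 'I_n].

Lemma size_word n (f : {ffun 'I_n -> bool}) : size (word f) = n.
Proof. by rewrite size_map size_enum_ord. Qed.

Lemma nth_word n (f : {ffun 'I_n -> bool}) (i : 'I_n) : nth false (word f) i = f i.
Proof. by rewrite (nth_map i) ?size_enum_ord // nth_ord_enum. Qed.

Lemma word_inj n : injective (@word n).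
Proof. by move=> f g E; apply/ffunP => i; rewrite -!nth_word E. Qed.

Lemma word_const n b : word [ffun _ : 'I_n => b] = nseq n b.
Proof.
apply: (@eq_from_nth _ false) => [|i]; rewrite size_word ?size_nseq // => Hi.
by rewrite (nth_word _ (Ordinal Hi)) ffunE nth_nseq Hi.
Qed.

Lemma big_ffun_words n (G : seq bool -> F) :
  \sum_(f : {ffun 'I_n -> bool}) G (word f) = \sum_(s <- words n) G s.
Proof.
rewrite -(big_map (@word n) xpredT G); apply: perm_big; apply: uniq_perm.
- by rewrite map_inj_uniq ?index_enum_uniq //; apply: word_inj.
- exact: words_uniq.
move=> s; rewrite mem_words; apply/mapP/eqP => [[f _ ->]|Hs]; first by rewrite size_word.
exists [ffun i : 'I_n => nth false s i]; first by rewrite mem_index_enum.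
apply: (@eq_from_nth _ false) => [|i]; rewrite ?size_word Hs // => Hi.
by rewrite (nth_word _ (Ordinal Hi)) ffunE.
Qed.

End PathSums.

(** * States of rectangular lattices as row-by-row sums *)

Section Link.
Variables (F : fieldType) (a : F).
Implicit Types (xs ys zs : seq F) (us ds ls rs : seq bool).
Local Notation T n := (nseq n true).
Local Notation O n := (nseq n false).
Local Notation grd := (gridZ a (fun x y => x / y)).

Lemma pathw_row zs us ds l r : size us = size zs -> size ds = size zs ->
  pathw (size zs) (fun i b c => vweight a (nth 0 zs i) b c (nth false us i) (nth false ds i)) l r
  = rowZ a zs l us ds r.
Proof.
elim: zs us ds l => [|z zs IH] [|u us] [|d ds] l //= [Hu] [Hd].
by apply: eq_bigr => b _; rewrite IH.
Qed.

Lemma row_ffun m (z : nat -> F) (u d : {ffun 'I_m -> bool}) l r :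
  \sum_(e : {ffun 'I_m.+1 -> bool}) ((e ord0 == l) && (e ord_max == r))%:R
     * \prod_(j < m) vweight a (z j) (e (inord j)) (e (inord j.+1)) (u j) (d j)
  = rowZ a (mkseq z m) l (word u) (word d) r.
Proof.
rewrite -pathw_row ?size_mkseq ?size_word // -pathwE.
apply: eq_bigr => e _; congr (_ * _); apply: eq_bigr => j _.
by rewrite nth_mkseq // !nth_word.
Qed.

Lemma pathw_grid m xs ys ls rs (s t : {ffun 'I_m -> bool}) (f : F -> F -> F) :
  size ys = m -> size ls = size xs -> size rs = size xs ->
  pathw (size xs) (fun i s t => rowZ a (map (f (nth 0 xs i)) ys) (nth false ls i)
    (word s) (word t) (nth false rs i)) s t
  = gridZ a f xs ys ls rs (word s) (word t).
Proof.
move=> Hm; elim: xs ls rs s => [|x xs IH] [|l ls] [|r rs] s //= => [_ _|[Hl] [Hr]].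
  by rewrite size_word Hm eqxx andbT (inj_eq (@word_inj m)).
rewrite Hm -[RHS]big_ffun_words; apply: eq_bigr => s' _.
by rewrite -IH.
Qed.

Lemma prod_forallb (I : finType) (P : pred I) :
  \prod_i (P i)%:R = [forall i, P i]%:R :> F.
Proof.
have [/forallP H|/forallPn[i /negPf Hi]] := boolP [forall i, P i].
  by rewrite big1 // => i _; rewrite H.
by rewrite (bigD1 i) //= Hi mul0r.
Qed.

(** With all vertical edges fixed the rows are independent, and distributivity turns the sum over
    horizontal edges into a product. *)
Lemma rows_sum n m (z : nat -> nat -> F) (rho : {ffun 'I_n -> bool})
    (v : {ffun 'I_n.+1 -> {ffun 'I_m -> bool}}) :
  \sum_(h : {ffun 'I_n * 'I_m.+1 -> bool})
    ([forall i, h (i, ord0)] && ([ffun i => h (i, ord_max)] == rho))%:R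
    * \prod_(i < n) \prod_(j < m) vweight a (z i j) (h (i, inord j)) (h (i, inord j.+1))
        (v (inord i) j) (v (inord i.+1) j)
  = \prod_(i < n) rowZ a (mkseq (z i) m) true (word (v (inord i))) (word (v (inord i.+1))) (rho i).
Proof.
under [RHS]eq_bigr => i _ do rewrite -row_ffun.
rewrite bigA_distr_bigA big_ffun_curry; apply: eq_bigr => H _.
rewrite big_split /=; congr (_ * _); last first.
  by apply: eq_bigr => i _; apply: eq_bigr => j _; rewrite !ffunE.
rewrite prod_forallb; congr (nat_of_bool _)%:R.
apply/andP/forallP => [[/forallP H0 /eqP/ffunP Hr] i|H0].
  by have := H0 i; have := Hr i; rewrite !ffunE /= => <- ->; rewrite !eqxx.
split; first by apply/forallP => i; rewrite ffunE /=; have /andP[/eqP->] := H0 i.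
by apply/eqP/ffunP => i; rewrite !ffunE /=; have /andP[_ /eqP->] := H0 i.
Qed.

(** The condition [Phi] on the right ends is left open in order to cover both domain walls and
    U-turns. *)
Lemma lattice_sum n m (X Y : nat -> F) (Phi : pred (seq bool)) :
  \sum_(h : {ffun 'I_n * 'I_m.+1 -> bool}) \sum_(v : {ffun 'I_n.+1 * 'I_m -> bool})
    ([&& [forall i, h (i, ord0)], [forall j, v (ord0, j) && ~~ v (ord_max, j)]
      & Phi (word [ffun i => h (i, ord_max)])])%:R
    * \prod_(i < n) \prod_(j < m) vweight a (X i / Y j) (h (i, inord j)) (h (i, inord j.+1))
        (v (inord i, j)) (v (inord i.+1, j))
  = \sum_(rs <- words n | Phi rs)
      grd (mkseq X n) (mkseq Y m) (T n) rs (T m) (O m).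
Proof.
rewrite exchange_big [RHS]big_mkcond -[RHS]big_ffun_words /= big_ffun_curry /=.
transitivity (\sum_(V : {ffun 'I_n.+1 -> {ffun 'I_m -> bool}}) \sum_(rho : {ffun 'I_n -> bool})
   (Phi (word rho))%:R * (((V ord0 == [ffun=> true]) && (V ord_max == [ffun=> false]))%:R
   * \prod_(i < n) rowZ a (mkseq (fun j => X i / Y j) m) true (word (V (inord i)))
       (word (V (inord i.+1))) (rho i))).
  apply: eq_bigr => V _.
  under [RHS]eq_bigr => rho _ do rewrite -(rows_sum (fun i j => X i / Y j)) !mulr_sumr.
  rewrite exchange_big; apply: eq_bigr => h _.
  rewrite (bigD1 [ffun i => h (i, ord_max)]) //= [X in _ + X]big1 ?addr0 => [|rho /negPf nr].
    rewrite eqxx andbT !mulrA; congr (_ * _); last first.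
      by apply: eq_bigr => i _; apply: eq_bigr => j _; rewrite !ffunE.
    rewrite -!natrM !mulnb; congr (nat_of_bool _)%:R.
    rewrite [X in [&& _, X & _]](_ : _ = (V ord0 == [ffun=> true]) && (V ord_max == [ffun=> false])).
      by rewrite [LHS]andbC; congr (_ && _); rewrite andbC.
    apply/forallP/andP => [H|[/eqP H0 /eqP H1] j]; last by rewrite !ffunE /= H0 H1 !ffunE.
    by split; apply/eqP/ffunP => j; have := H j; rewrite !ffunE /= => /andP[];
      [move->|move=> _ /negPf->].
  by rewrite [_ == rho]eq_sym nr andbF mul0r !mulr0.
rewrite exchange_big; apply: eq_bigr => rho _.
case: (Phi _); last by rewrite big1 // => V _; rewrite mul0r.
under eq_bigr => V _ do rewrite mul1r.
rewrite -!word_const.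
pose s b : {ffun 'I_m -> bool} := [ffun=> b].
rewrite -(@pathw_grid m _ _ _ _ (s true) (s false)) ?size_mkseq ?size_word // -pathwE.
apply: eq_bigr => V _; congr (_ * _); apply: eq_bigr => i _.
by rewrite nth_mkseq // !nth_word ffunE /mkseq -map_comp.
Qed.
End Link.

Section Translation.
Variables (F : fieldType) (a : F).
Implicit Types (us ds ls rs : seq bool).
Local Notation T n := (nseq n true).
Local Notation O n := (nseq n false).
Local Notation neg p := (rev (map negb p)).
Local Notation grd := (gridZ a (fun x y => x / y)).

Lemma vweight_notice z l r u d : ~~ ice l r u d -> vweight a z l r u d = 0.
Proof. by case: l r u d => [] [] [] []. Qed.

Lemma forall_and (I : finType) (P Q : pred I) :
  [forall i, P i && Q i] = [forall i, P i] && [forall i, Q i].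
Proof.
apply/forallP/andP => [H|[/forallP H1 /forallP H2] i]; last by rewrite H1 H2.
by split; apply/forallP => i; case/andP: (H i).
Qed.

Lemma word_eqO n (f : {ffun 'I_n -> bool}) : (word f == O n) = [forall i, ~~ f i].
Proof.
rewrite -word_const (inj_eq (@word_inj n)); apply/eqP/forallP => [-> i|H]; first by rewrite ffunE.
by apply/ffunP => i; rewrite ffunE; have /negPf := H i.
Qed.

Lemma if_ice (I J : finType) (P : bool) (c Q : I -> J -> bool) (w : I -> J -> F) :
  (forall i j, Q i j -> ~~ c i j -> w i j = 0) ->
  (if P && [forall i, forall j, Q i j ==> c i j] then \prod_i \prod_(j | Q i j) w i j else 0)
  = P%:R * \prod_i \prod_(j | Q i j) w i j.
Proof.
case: P => [] H; rewrite ?mul0r ?mul1r //=.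
have [//|/forallPn[i /forallPn[j]]] := boolP [forall i, forall j, Q i j ==> c i j].
rewrite negb_imply => /andP[Qij /H w0].
by rewrite (bigD1 i) //= (bigD1 j) //= w0 // !mul0r.
Qed.

Lemma if_iceT (I J : finType) (P : bool) (c : I -> J -> bool) (w : I -> J -> F) :
  (forall i j, ~~ c i j -> w i j = 0) ->
  (if P && [forall i, forall j, c i j] then \prod_i \prod_j w i j else 0)
  = P%:R * \prod_i \prod_j w i j.
Proof. by move=> H; apply: (@if_ice I J P c (fun _ _ => true)) => i j _; apply: H. Qed.

Lemma ZdwE n (x y : nat -> F) : Zdw a n x y = Zd a (mkseq x n) (mkseq y n).
Proof.
transitivity (\sum_(rs <- words n | rs == O n)
  grd (mkseq x n) (mkseq y n) (T n) rs (T n) (O n)); last first.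
  rewrite big_mkcond /= /Zd !size_mkseq -[RHS](big_words_delta (n := n)
    (fun rs => grd (mkseq x n) (mkseq y n) (T n) rs (T n) (O n))) ?size_nseq //.
  by apply: eq_bigr => rs _; rewrite eq_sym; case: eqP => [->|_]; rewrite ?mul1r ?mul0r.
rewrite -lattice_sum /Zdw big_mkcond /= pair_bigA; apply: eq_bigr => -[h v] _ /=.
rewrite -(@if_iceT _ _ _ (fun i j : 'I_n => ice (h (i, inord j)) (h (i, inord j.+1))
  (v (inord i, j)) (v (inord i.+1, j)))); last by move=> i j; apply: vweight_notice.
congr (if _ then _ else _); rewrite /dw_state !andbA; congr (_ && _).
rewrite word_eqO forall_and andbAC; congr (_ && _ && _).
by apply: eq_forallb => i; rewrite ffunE.
Qed.

Lemma uturn_words m (G : seq bool -> F) :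
  \sum_(rs <- words (2 * m) |
      [forall r : 'I_(2 * m), (r < m)%N ==> (nth false rs (rev_ord r) == ~~ nth false rs r)]) G rs
  = \sum_(p <- words m) G (p ++ neg p).
Proof.
rewrite big_mkcond mul2n -addnn big_words_cat; apply: eq_big_seq => p /size_words Hp /=.
rewrite -[RHS](big_words_delta (n := m) (fun q => G (p ++ q))) ?size_revneg //.
apply: eq_big_seq => q /size_words Hq.
rewrite (_ : [forall r, _] = (neg p == q)); first by case: eqP; rewrite ?mul1r ?mul0r.
apply/forallP/eqP => [H|<- r]; last first.
  apply/implyP => Hr /=; rewrite !nth_cat Hp Hr.
  have -> : (m + m - r.+1 < m)%N = false by lia.
  rewrite nth_rev size_map Hp; last by lia.
  by rewrite (nth_map false) ?Hp; [apply/eqP; congr (~~ nth _ _ _)|]; lia.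
apply: (@eq_from_nth _ false) => [|i]; rewrite size_revneg Hp // => Hi.
have Hi' : (m - i.+1 < m + m)%N by lia.
have := H (Ordinal Hi'); rewrite /= !nth_cat Hp.
have -> : (m - i.+1 < m)%N by lia.
have -> : (m + m - (m - i.+1).+1 < m)%N = false by lia.
have -> : (m + m - (m - i.+1).+1 - m = i)%N by lia.
move=> /eqP ->; rewrite nth_rev size_map Hp // (nth_map false) // Hp; lia.
Qed.

Lemma mkseq_uturn m (x : nat -> F) :
  mkseq (fun r => x (minn r (2 * m - r.+1))) (2 * m) = mkseq x m ++ rev (mkseq x m).
Proof.
apply: (@eq_from_nth _ 0); first by rewrite size_cat size_rev !size_mkseq; lia.
move=> i; rewrite size_mkseq => Hi.
rewrite nth_mkseq // nth_cat size_mkseq; case: ltnP => Him.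
  by rewrite nth_mkseq //; congr (x _); lia.
rewrite nth_rev size_mkseq; last by lia.
by rewrite nth_mkseq; [congr (x _)|]; lia.
Qed.

Lemma ZHT_evenE m (x y : nat -> F) : ZHT_even a m x y = HT a (mkseq x m) (mkseq y m).
Proof.
rewrite /HT !size_cat !size_rev !size_mkseq addnn -mul2n -mkseq_uturn.
rewrite -(uturn_words m (fun rs => grd (mkseq (fun r => x (minn r (2 * m - r.+1))) (2 * m))
  (mkseq y m) (T (2 * m)) rs (T m) (O m))).
rewrite -lattice_sum /ZHT_even big_mkcond /= pair_bigA; apply: eq_bigr => -[h v] _ /=.
rewrite -(@if_iceT _ _ _ (fun (i : 'I_(2 * m)) (j : 'I_m) =>
  ice (h (i, inord j)) (h (i, inord j.+1)) (v (inord i, j)) (v (inord i.+1, j)))); last first.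
  by move=> i j; apply: vweight_notice.
congr (if _ then _ else _); rewrite /ht_even_state !andbA; congr (_ && _ && _ && _).
by apply: eq_forallb => r; rewrite -[(2 * m - r.+1)%N]/(nat_of_ord (rev_ord r)) !nth_word !ffunE.
Qed.
End Translation.

(** * States of the odd lattice, with its truncated last column *)

Section OddTranslation.
Variables (F : fieldType) (a : F).
Implicit Types (us ds ls rs : seq bool).
Local Notation T n := (nseq n true).
Local Notation O n := (nseq n false).
Local Notation neg p := (rev (map negb p)).
Local Notation grd := (gridZ a (fun x y => x / y)).

(** Undoes the unfolding: the part to the right of the columns [ys] is turned back below the middle
    row. Column [y] is then entered from above by [~~ b], since the joined edge points right iff it
    points down. *)
Lemma oddHT_split b X u ys y : oddHT a b X u ys y
  = \sum_(p <- words (size X)) \sum_(g <- words (size ys))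
      grd (rcons X u) ys (T (size X).+1) (rcons p b) (T (size ys)) g
      * grd (rev X) (rcons ys y) (T (size X)) (neg p) (rcons g (~~ b)) (O (size ys).+1).
Proof.
have HR p g : size p = size X -> size g = size ys ->
    grd (rev X) (rcons ys y) (T (size X)) (neg p) (rcons g (~~ b)) (O (size ys).+1)
    = grd X (y :: rev ys) p (O (size X)) (T (size ys).+1) (b :: neg g).
  move=> Hp Hg; rewrite -[RHS]grid_rot ?size_nseq //= ?size_rev ?size_nseq ?size_map ?Hg //.
  rewrite rev_cons revK rev_cons revnegK -/(O (size ys).+1) -/(T (size ys).+1).
  by rewrite [in RHS]map_nseq rev_nseq -[false :: map _ _]/(map negb (T (size ys).+1)) map_nseq rev_nseq.
under [RHS]eq_big_seq => p /size_words Hp do under eq_big_seq => g /size_words Hg do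
  rewrite nseq_rcons grid_rconsr // HR // mulr_suml.
under [RHS]eq_bigr => p _ do rewrite exchange_big /=.
rewrite exchange_big /=; apply: eq_big_seq => e /size_words He.
rewrite exchange_big /=; apply: eq_big_seq => g /size_words Hg.
rewrite size_cat nseqD grid_catc ?size_nseq // mulr_suml; apply: eq_bigr => p _.
by rewrite [size (_ :: _)]/= size_rev; ring.
Qed.

Lemma pathwS (R : finType) n (K : nat -> R -> R -> F) s t :
  pathw n.+1 K s t = \sum_(s' : R) K 0%N s s' * pathw n (fun i => K i.+1) s' t.
Proof. by []. Qed.

Section Rows.
Variable m : nat.
Local Notation S := {ffun 'I_m.+1 -> bool}.

(** Each step tests that the pinned edge above its row is [false], so intermediate vectors reduce to
    words of length [m]. The final vector is not tested: its last entry is the joined middle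
    edge. *)
Lemma pathw_trunc n (K : nat -> seq bool -> seq bool -> F) (s t : S) xs (ys : seq F) ls rs :
  size ys = m -> size xs = n.+1 -> size ls = size xs -> size rs = size xs ->
  (forall i s t, (i < n.+1)%N ->
     K i s t = rowZ a (map (fun y => nth 0 xs i / y) ys) (nth false ls i) s t (nth false rs i)) ->
  pathw n.+1 (fun i (s t : S) =>
    (~~ s ord_max)%:R * K i (take m (word s)) (take m (word t))) s t
  = (~~ s ord_max)%:R * grd xs ys ls rs (take m (word s)) (take m (word t)).
Proof.
move=> Hy; elim: n K s xs ls rs => [|n IH] K s [|x xs] [|l ls] [|r rs] //.
  case: xs => // _; case: ls => // _; case: rs => // _ HK.
  rewrite grid1r /= (bigD1 t) //= eqxx mulr1 big1 ?addr0 => [|t' /negPf nt].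
    by rewrite HK.
  by rewrite nt mulr0.
move=> [Hx] [Hl] [Hr] HK.
have HK' i s1 t1 : (i < n.+1)%N -> K i.+1 s1 t1
    = rowZ a (map (fun y => nth 0 xs i / y) ys) (nth false ls i) s1 t1 (nth false rs i).
  by move=> Hi; rewrite HK.
rewrite pathwS.
pose G ss := (~~ s ord_max)%:R * K 0%N (take m (word s)) (take m ss)
   * ((~~ nth false ss m)%:R * grd xs ys ls rs (take m ss) (take m (word t))).
transitivity (\sum_(s1 : S) G (word s1)).
  apply: eq_bigr => s1 _; rewrite /G -[m in nth _ _ m]/(nat_of_ord (@ord_max m)) nth_word.
  by rewrite -(IH (fun i => K i.+1)).
rewrite big_ffun_words big_words_rcons /G /= Hy mulr_sumr; apply: eq_big_seq => w /size_words Hw.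
rewrite big_bool /= !nth_rcons Hw ltnn eqxx /= -!cats1 !take_size_cat // HK //=; ring.
Qed.

Lemma row_pinned (z : nat -> F) (s t : S) rho :
  \sum_(e : {ffun 'I_m.+2 -> bool}) ([&& e ord0, e (inord m) == rho & ~~ e ord_max])%:R
    * \prod_(j < m.+1 | (j < m)%N) vweight a (z j) (e (inord j)) (e (inord j.+1)) (s j) (t j)
  = rowZ a (mkseq z m) true (take m (word s)) (take m (word t)) rho.
Proof.
have szt (f : S) : size (take m (word f)) = m by rewrite size_take size_word ltnSn.
(* The last of the [m + 1] steps only compares the edge right of the last vertex with [rho]; the
   pinned edge after it is fixed by the end point [false] of the path. *)
pose K i b c := if (i < m)%N then vweight a (nth 0 (mkseq z m) i) b c
   (nth false (take m (word s)) i) (nth false (take m (word t)) i) else (b == rho)%:R.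
transitivity (pathw m.+1 K true false).
  rewrite -pathwE; apply: eq_bigr => e _.
  rewrite big_mkcond /= big_ord_recr [in RHS]big_ord_recr /= /K ltnn mulr1 [RHS]mulrCA [LHS]mulrC; congr (_ * _).
    by apply: eq_bigr => j _; rewrite ltn_ord nth_mkseq // !nth_take // -!nth_word.
  rewrite -natrM mulnb; congr (nat_of_bool _)%:R.
  by case: (e ord0) (e ord_max) (e (inord m) == rho) => [] [] [].
rewrite (_ : pathw m.+1 K true false = pathw (m + 1) K true false); last by rewrite addn1.
rewrite pathw_cat.
transitivity (\sum_c pathw m K true c * (c == rho)%:R).
  apply: eq_bigr => c _; rewrite /= (bigD1 false) //= ?eqxx ?mulr1 big1 ?addr0 => [|c' /negPf nc].
    by rewrite addn0 /K ltnn.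
  by rewrite nc mulr0.
under eq_bigr => c _ do rewrite mulrC eq_sym.
rewrite big_bool_delta -pathw_row ?size_mkseq ?szt //; apply: eq_pathw => i s1 s2 Hi.
by rewrite /K Hi.
Qed.

Definition odd_row (z : nat -> F) i r (s t : S) := if (i <= m)%N
  then rowZ a (mkseq z m) true (take m (word s)) (take m (word t)) r
  else rowZ a (mkseq z m.+1) true (word s) (word t) r.

Lemma odd_rowE (z : nat -> F) i r (s t : S) :
  \sum_(e : {ffun 'I_m.+2 -> bool})
    ([&& e ord0, (if (i <= m)%N then e (inord m) else e ord_max) == r
       & (i <= m)%N ==> ~~ e ord_max])%:R
    * \prod_(j < m.+1 | overtex m i j) vweight a (z j) (e (inord j)) (e (inord j.+1)) (s j) (t j)
  = odd_row z i r s t.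
Proof.
rewrite /odd_row; case: leqP => Hi.
  rewrite -row_pinned; apply: eq_bigr => e _; congr (_ * _).
  by apply: eq_bigl => j; rewrite /overtex [(m < i)%N]ltnNge Hi andbF orbF.
rewrite -row_ffun; apply: eq_bigr => e _; rewrite andbT eqb_id; congr (_ * _).
by apply: eq_bigl => j; rewrite /overtex Hi andbT orbC -leq_eqVlt -ltnS ltn_ord.
Qed.

Lemma odd_rows_sum (z : nat -> nat -> F) n (rho : {ffun 'I_n -> bool}) (V : {ffun 'I_n.+1 -> S}) :
  \sum_(h : {ffun 'I_n * 'I_m.+2 -> bool})
    ([&& [forall i, h (i, ord0)], [forall i : 'I_n, (i <= m)%N ==> ~~ h (i, ord_max)]
       & [ffun i : 'I_n => if (i <= m)%N then h (i, inord m) else h (i, ord_max)] == rho])%:R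
    * \prod_(i < n) \prod_(j < m.+1 | overtex m i j) vweight a (z i j) (h (i, inord j))
        (h (i, inord j.+1)) (V (inord i) j) (V (inord i.+1) j)
  = \prod_(i < n) odd_row (z i) i (rho i) (V (inord i)) (V (inord i.+1)).
Proof.
under [RHS]eq_bigr => i _ do rewrite -odd_rowE.
rewrite bigA_distr_bigA big_ffun_curry; apply: eq_bigr => H _.
rewrite big_split /=; congr (_ * _); last first.
  by apply: eq_bigr => i _; apply: eq_bigr => j _; rewrite !ffunE.
rewrite prod_forallb; congr (nat_of_bool _)%:R.
apply/and3P/forallP => [[/forallP H0 /forallP Hp /eqP/ffunP Hr] i|H0].
  have := H0 i; have := Hr i; have := Hp i; rewrite !ffunE /= => -> <- ->.
  by rewrite eqxx.
split.
- by apply/forallP => i; rewrite ffunE /=; have /and3P[] := H0 i.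
- by apply/forallP => i; rewrite ffunE /=; have /and3P[] := H0 i.
by apply/eqP/ffunP => i; rewrite !ffunE /=; have /and3P[_ /eqP] := H0 i.
Qed.

Lemma uturn_words_odd b (G : seq bool -> F) :
  \sum_(rs <- words (2 * m).+1 |
      [forall r : 'I_(2 * m).+1, (r < m)%N ==>
        (nth false rs (2 * m - r)%N == ~~ nth false rs r)] && (nth false rs m == b)) G rs
  = \sum_(p <- words m) G (p ++ b :: neg p).
Proof.
rewrite big_mkcond (_ : (2 * m).+1 = (m + m.+1)%N); last by lia.
rewrite big_words_cat; apply: eq_big_seq => p /size_words Hp /=.
rewrite big_wordsS -[RHS](big_bool_delta b (fun c => G (p ++ c :: neg p))); apply: eq_bigr => c _.
rewrite -(big_words_delta (n := m) (fun q => G (p ++ c :: q))) ?size_revneg // mulr_sumr.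
apply: eq_big_seq => q /size_words Hq.
rewrite nth_cat Hp ltnn subnn /= eq_sym.
rewrite (_ : [forall r, _] = (neg p == q)).
  by case: (neg p == q); case: (b == c); rewrite /= ?mul1r ?mul0r.
apply/forallP/eqP => [H|<- r]; last first.
  apply/implyP => Hr /=; rewrite !nth_cat Hp Hr.
  have -> : (2 * m - r < m)%N = false by lia.
  have -> : (2 * m - r - m = (m - r.+1).+1)%N by lia.
  rewrite /= nth_rev size_map Hp; last by lia.
  by rewrite (nth_map false) ?Hp; [apply/eqP; congr (~~ nth _ _ _)|]; lia.
apply: (@eq_from_nth _ false) => [|i]; rewrite size_revneg Hp // => Hi.
have Hi' : (m - i.+1 < m + m.+1)%N by lia.
have := H (Ordinal Hi'); rewrite /= !nth_cat Hp.
have -> : (m - i.+1 < m)%N by lia.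
have -> : (2 * m - (m - i.+1) < m)%N = false by lia.
have -> : (2 * m - (m - i.+1) - m = i.+1)%N by lia.
move=> /eqP /= ->; rewrite nth_rev size_map Hp // (nth_map false) // Hp; lia.
Qed.

(** The pinning conditions and the joined middle edge are attached to the steps that see the edges
    concerned, so that the whole state condition becomes a product over rows. *)
Definition odd_step b (z : nat -> nat -> F) (rho : nat -> bool) i (s t : S) :=
  (((i <= m)%N ==> ~~ s ord_max) && ((i == m) ==> (t ord_max == ~~ b)))%:R
    * odd_row (z i) i (rho i) s t.

Let s0 : S := [ffun j : 'I_m.+1 => (j < m)%N].
Let t0 : S := [ffun=> false].

Lemma odd_columns b (V : {ffun 'I_(2 * m).+2 -> S}) :
  [&& [forall j : 'I_m.+1, (j < m)%N ==> V ord0 j], [forall j, ~~ V ord_max j],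
      V (inord m.+1) ord_max == ~~ b
    & [forall r : 'I_(2 * m).+2, (r <= m)%N ==> ~~ V r ord_max]]
  = ((V ord0 == s0) && (V ord_max == t0))
    && [forall i : 'I_(2 * m).+1, ((i <= m)%N ==> ~~ V (inord i) ord_max)
        && ((nat_of_ord i == m) ==> (V (inord i.+1) ord_max == ~~ b))].
Proof.
have m_lt : (m < (2 * m).+1)%N by lia.
apply/and4P/andP => [[/forallP H0 /forallP H1 Hb /forallP Hp]|[/andP[/eqP H0 /eqP H1] /forallP Hi]].
  split; last first.
    apply/forallP => i; apply/andP; split; apply/implyP => Him; last by rewrite (eqP Him).
    have := Hp (inord i); rewrite inordK ?Him //.
    by apply: leq_trans (ltn_ord i) _.
  apply/andP; split; apply/eqP/ffunP => j; rewrite ffunE; last by have /negPf := H1 j.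
  have := H0 j; case: ltnP => //= Hj _; have /negPf := Hp ord0.
  by have -> : j = ord_max by apply: val_inj => /=; apply/eqP; rewrite eqn_leq -ltnS ltn_ord.
split.
- by apply/forallP => j; apply/implyP => Hj; rewrite H0 ffunE.
- by apply/forallP => j; rewrite H1 ffunE.
- by have /andP[_] := Hi (Ordinal m_lt); rewrite eqxx.
apply/forallP => r; apply/implyP => Hr.
have Hr' : (r < (2 * m).+1)%N by lia.
have /andP[] := Hi (Ordinal Hr'); rewrite /= Hr /= => + _.
by have -> : inord r = r by apply: val_inj; rewrite /= inordK.
Qed.

Lemma odd_pathw b (x y : nat -> F) (p q : seq bool) : size p = m -> size q = m ->
  pathw (2 * m).+1 (odd_step b (fun i j => x (minn i (2 * m - i)) / y j)
    (nth false (p ++ b :: q))) s0 t0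
  = \sum_(g <- words m) grd (rcons (mkseq x m) (x m)) (mkseq y m) (T m.+1) (rcons p b) (T m) g
     * grd (rev (mkseq x m)) (rcons (mkseq y m) (y m)) (T m) q (rcons g (~~ b)) (O m.+1).
Proof.
move=> Hp Hq; set K := odd_step _ _ _.
pose K2 i us ds := rowZ a (map (fun k => nth 0 (rcons (mkseq x m) (x m)) i / k) (mkseq y m))
  (nth false (T m.+1) i) us ds (nth false (rcons p b) i).
pose K0 i (s t : S) := (~~ s ord_max)%:R * K2 i (take m (word s)) (take m (word t)).
have map_y c n : map (fun k => c / k) (mkseq y n) = mkseq (fun j => c / y j) n.
  by rewrite /mkseq -map_comp.
(* The product is cut below the middle row: the [m + 1] steps above use truncated rows, the [m]
   steps below full ones. *)
have top s : pathw m.+1 K s0 s = (s ord_max == ~~ b)%:R *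
    grd (rcons (mkseq x m) (x m)) (mkseq y m) (T m.+1) (rcons p b) (T m) (take m (word s)).
  transitivity ((s ord_max == ~~ b)%:R * pathw m.+1 K0 s0 s); last first.
    rewrite [pathw _ K0 _ _](@pathw_trunc m K2 s0 s (rcons (mkseq x m) (x m)) (mkseq y m)
      (T m.+1) (rcons p b)); rewrite ?size_rcons ?size_nseq ?size_mkseq ?Hp //.
    rewrite ffunE /= ltnn mul1r; congr (_ * gridZ _ _ _ _ _ _ _ _).
    apply: (@eq_from_nth _ false) => [|i]; rewrite size_take size_word ltnSn ?size_nseq // => Hi.
    have Hi' : (i < m.+1)%N by lia.
    by rewrite nth_take // (nth_word _ (Ordinal Hi')) ffunE /= nth_nseq Hi.
  have split K1 : pathw m.+1 K1 s0 s = \sum_(s1 : S) pathw m K1 s0 s1 * K1 m s1 s.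
    rewrite (_ : pathw m.+1 K1 s0 s = pathw (m + 1) K1 s0 s); last by rewrite addn1.
    rewrite pathw_cat; apply: eq_bigr => s1 _; congr (_ * _).
    by rewrite /= (bigD1 s) //= eqxx mulr1 big1 ?addn0 ?addr0 // => s2 /negPf ns; rewrite ns mulr0.
  rewrite !split mulr_sumr; apply: eq_bigr => s1 _.
  have KE i s2 s3 : (i <= m)%N -> K i s2 s3 = ((i == m) ==> (s3 ord_max == ~~ b))%:R * K0 i s2 s3.
    move=> Hi; rewrite /K /odd_step /odd_row Hi /K0 /K2 map_y -mulnb natrM -mulrA mulrCA.
    rewrite nth_nseq ltnS Hi nth_rcons nth_rcons size_mkseq Hp nth_cat Hp.
    have -> : minn i (2 * m - i) = i by lia.
    by case: ltngtP Hi => // [Him|->] _; rewrite ?nth_mkseq // subnn.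
  rewrite (eq_pathw (K' := K0)) => [|i s2 s3 Hi]; last first.
    by rewrite KE 1?ltnW // (ltn_eqF Hi) mul1r.
  by rewrite KE // eqxx mulrCA.
have bot s : pathw m (fun i => K (m.+1 + i)%N) s t0
    = grd (rev (mkseq x m)) (rcons (mkseq y m) (y m)) (T m) q (word s) (O m.+1).
  rewrite -(word_const m.+1 false) -/t0 -[RHS](@pathw_grid F a m.+1 (rev (mkseq x m))
    (rcons (mkseq y m) (y m)) (T m) q s t0 (fun x y => x / y)) ?size_rev ?size_mkseq
    ?size_rcons ?size_mkseq ?size_nseq //.
  apply: eq_pathw => i s1 s2 Hi; rewrite /K /odd_step /odd_row.
  have -> : (m.+1 + i <= m)%N = false by lia.
  have -> : (m.+1 + i == m)%N = false by lia.
  rewrite mul1r nth_nseq Hi nth_cat Hp.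
  have -> : (m.+1 + i < m)%N = false by lia.
  have -> : (m.+1 + i - m = i.+1)%N by lia.
  have -> : rcons (mkseq y m) (y m) = mkseq y m.+1 by rewrite mkseqS.
  rewrite map_y nth_rev size_mkseq // nth_mkseq; last by lia.
  by have -> : minn (m.+1 + i) (2 * m - (m.+1 + i)) = (m - i.+1)%N by lia.
rewrite (_ : (2 * m).+1 = (m.+1 + m)%N); last by lia.
rewrite pathw_cat.
pose G us := (nth false us m == ~~ b)%:R
  * grd (rcons (mkseq x m) (x m)) (mkseq y m) (T m.+1) (rcons p b) (T m) (take m us)
  * grd (rev (mkseq x m)) (rcons (mkseq y m) (y m)) (T m) q us (O m.+1).
transitivity (\sum_(s : S) G (word s)).
  apply: eq_bigr => s _; rewrite /G top bot.
  by rewrite -[m in nth _ _ m]/(nat_of_ord (@ord_max m)) nth_word.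
rewrite big_ffun_words big_words_rcons; apply: eq_big_seq => g /size_words Hg.
rewrite (bigD1 (~~ b)) //= /G [X in _ + X]big1 ?addr0 => [|c /negPf nc].
  by rewrite nth_rcons Hg ltnn eqxx eqxx mul1r -!cats1 take_size_cat.
by rewrite nth_rcons Hg ltnn eqxx nc !mul0r.
Qed.

Lemma ZHT_oddE b (x y : nat -> F) :
  ZHT_odd b a m x y = oddHT a b (mkseq x m) (x m) (mkseq y m) (y m).
Proof.
pose z i j := x (minn i (2 * m - i)) / y j.
pose Phi rs := [forall r : 'I_(2 * m).+1, (r < m)%N ==>
   (nth false rs (2 * m - r)%N == ~~ nth false rs r)] && (nth false rs m == b).
pose Vc (V : {ffun 'I_(2 * m).+2 -> S}) :=
  [&& [forall j : 'I_m.+1, (j < m)%N ==> V ord0 j], [forall j, ~~ V ord_max j],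
      V (inord m.+1) ord_max == ~~ b
    & [forall r : 'I_(2 * m).+2, (r <= m)%N ==> ~~ V r ord_max]].
(* A row ends after [m] columns down to the middle row and after [m + 1] columns below it. *)
pose ends (h : {ffun 'I_(2 * m).+1 * 'I_m.+2 -> bool}) :=
  [ffun i : 'I_(2 * m).+1 => if (i <= m)%N then h (i, inord m) else h (i, ord_max)].
transitivity (\sum_(rs <- words (2 * m).+1 | Phi rs)
  pathw (2 * m).+1 (odd_step b z (nth false rs)) s0 t0); last first.
  rewrite (@uturn_words_odd b (fun rs => pathw (2 * m).+1 (odd_step b z (nth false rs)) s0 t0)).
  rewrite oddHT_split !size_mkseq; apply: eq_big_seq => p /size_words Hp.
  by rewrite odd_pathw // size_revneg Hp.
transitivity (\sum_(rho : {ffun 'I_(2 * m).+1 -> bool}) \sum_(V : {ffun 'I_(2 * m).+2 -> S})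
  ((Phi (word rho))%:R * (Vc V)%:R) * \sum_(h : {ffun 'I_(2 * m).+1 * 'I_m.+2 -> bool})
    ([&& [forall i, h (i, ord0)], [forall i : 'I_(2 * m).+1, (i <= m)%N ==> ~~ h (i, ord_max)]
       & ends h == rho])%:R
    * \prod_(i < (2 * m).+1) \prod_(j < m.+1 | overtex m i j) vweight a (z i j) (h (i, inord j))
        (h (i, inord j.+1)) (V (inord i) j) (V (inord i.+1) j)); last first.
  rewrite [RHS]big_mkcond -[RHS]big_ffun_words; apply: eq_bigr => rho _.
  under eq_bigr => V _ do rewrite odd_rows_sum -mulrA.
  rewrite -mulr_sumr; case: (Phi _); rewrite ?mul0r // mul1r -pathwE.
  apply: eq_bigr => V _; rewrite /Vc odd_columns -mulnb natrM -mulrA; congr (_ * _).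
  rewrite -prod_forallb -big_split /=; apply: eq_bigr => i _.
  by rewrite /odd_step nth_word.
under [RHS]eq_bigr => rho _ do under eq_bigr => V _ do rewrite mulr_sumr.
under [RHS]eq_bigr => rho _ do rewrite exchange_big /=.
rewrite [RHS]exchange_big /ZHT_odd big_mkcond /=.
rewrite -(pair_bigA _ (fun h v => if ht_odd_state h v && (h (inord m, inord m) == b) then
  \prod_(i < (2 * m).+1) \prod_(j < m.+1 | overtex m i j) vweight a (z i j) (h (i, inord j))
    (h (i, inord j.+1)) (v (inord i, j)) (v (inord i.+1, j)) else 0)) /=.
apply: eq_bigr => h _; rewrite big_ffun_curry exchange_big /=; apply: eq_bigr => V _.
set w := \prod_(i < _) _; set v := [ffun p => _] in w *.
rewrite (bigD1 (ends h)) //= [X in _ + X]big1 ?addr0 => [|rho /negPf nr]; last first.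
  by rewrite [_ == rho]eq_sym nr !andbF mul0r mulr0.
rewrite eqxx andbT -natrM mulnb mulrA -natrM mulnb.
have -> : \prod_(i < (2 * m).+1) \prod_(j < m.+1 | overtex m i j) vweight a (z i j)
   (h (i, inord j)) (h (i, inord j.+1)) (V (inord i) j) (V (inord i.+1) j) = w.
  by apply: eq_bigr => i _; apply: eq_bigr => j _; rewrite !ffunE.
rewrite -(@if_ice _ _ _ _ (fun (i : 'I_(2 * m).+1) (j : 'I_m.+1) =>
  ice (h (i, inord j)) (h (i, inord j.+1)) (v (inord i, j)) (v (inord i.+1, j)))); last first.
  by move=> i j _; apply: vweight_notice.
congr (if _ then _ else _); rewrite /ht_odd_state -/w.
have E5 : Phi (word (ends h)) = [forall r : 'I_(2 * m).+1, (r < m)%N ==>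
    (h (inord (2 * m - r), ord_max) == ~~ h (r, inord m))] && (h (inord m, inord m) == b).
  have m_lt : (m < (2 * m).+1)%N by lia.
  rewrite /Phi; congr (_ && _).
    apply: eq_forallb => r; case: ltnP => //= Hr.
    have r_lt : (2 * m - r < (2 * m).+1)%N by lia.
    rewrite (nth_word _ r) (nth_word _ (Ordinal r_lt)) !ffunE /= (ltnW Hr).
    have -> : (2 * m - r <= m)%N = false by lia.
    by congr (h (_, _) == _); apply: val_inj; rewrite /= inordK.
  rewrite (nth_word _ (Ordinal m_lt)) ffunE /= leqnn.
  by congr (h (_, _) == _); apply: val_inj; rewrite /= inordK.
have Ev i j : v (i, j) = V i j by rewrite ffunE.
have -> : [forall j : 'I_m.+1, (j < m)%N ==> v (ord0, j)]
    = [forall j : 'I_m.+1, (j < m)%N ==> V ord0 j] by apply: eq_forallb => j; rewrite Ev.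
have -> : [forall j, ~~ v (ord_max, j)] = [forall j, ~~ V ord_max j].
  by apply: eq_forallb => j; rewrite Ev.
have -> : [forall r : 'I_(2 * m).+2, (r <= m)%N ==> ~~ v (r, ord_max)]
    = [forall r : 'I_(2 * m).+2, (r <= m)%N ==> ~~ V r ord_max].
  by apply: eq_forallb => r; rewrite Ev.
rewrite E5 Ev /Vc; case: (h (inord m, inord m) =P b) => [->|_]; last by rewrite !andbF.
rewrite !andbT -!andbA.
move: [forall r, h (r, ord0)] [forall j : 'I_m.+1, (j < m)%N ==> V ord0 j] => A1 A2.
move: [forall j, ~~ V ord_max j] (V (inord m.+1) ord_max == ~~ b) => A3 A4.
move: [forall r : 'I_(2 * m).+1, (r < m)%N ==> _] => A5.
move: [forall r : 'I_(2 * m).+1, (r <= m)%N ==> _] => A6.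
move: [forall r : 'I_(2 * m).+2, (r <= m)%N ==> _] => A7.
by case: A1 A2 A3 A4 A5 A6 A7 => [] [] [] [] [] [] [].
Qed.

End Rows.
End OddTranslation.

Import Num.Theory.

(** * Specialization to arbitrary parameters *)

Section GenericRelations.
Variables (F : fieldType) (a : F).
Hypothesis two_neq0 : 2%:R != 0 :> F.
Variables (X ys : seq F) (u y : F).
Hypothesis size_ys : size ys = size X.
Hypothesis gen : generic a (rcons X u ++ rcons ys y).

Let genX : generic a (u :: X ++ y :: ys).
Proof.
apply: generic_perm gen; apply/permP => f.
by rewrite -!cats1 /= !count_cat /=; ring.
Qed.

Let genXy : generic a (u :: X ++ ys).
Proof.
apply: (@generic_cons F a y); apply: generic_perm genX; apply/permP => f.
by rewrite /= !count_cat /=; ring.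
Qed.

Let y0 : y != 0.
Proof. by apply: generic_neq0 gen _; rewrite mem_cat !mem_rcons !in_cons eqxx !orbT. Qed.

Let ZdE : Zd a (rcons X u) (rcons ys y) = Zd a (u :: X) (y :: ys).
Proof.
have a0 : a != 0 by case: gen.
have G1 := generic_catl gen; have G2 := generic_catr gen.
rewrite (Zd_perm_x a0 (generic_commuting G1) (xs' := u :: X)); last 2 first.
- by case: G2.
- by rewrite perm_rcons.
apply: (Zd_perm_y a0 (generic_commuting G2)); last by rewrite perm_rcons.
have G3 : generic a (u :: X) by apply: generic_catl (_ : generic a ((u :: X) ++ ys)).
by case: G3.
Qed.

(** The extra factor [Zd a X ys] turns [Z2] into [HT]. Both sides are now free of the poles of [Z2],
    so the identity can be specialized; likewise in [generic_relB]. *)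
Lemma generic_relA :
  Zd a X ys * (sigma (a ^+ 2) * oddHT a true X u ys y + htw a (u / y) * oddHT a false X u ys y)
  = Zd a (rcons X u) (rcons ys y) * HT a X ys.
Proof.
rewrite oddHT_relA // HT_factor //; last exact: generic_cons genXy.
by rewrite ZdE; ring.
Qed.

Lemma generic_relB :
  Zd a (rcons X u) (rcons ys y)
    * (htw a (u / y) * oddHT a true X u ys y + sigma (a ^+ 2) * oddHT a false X u ys y)
  = Zd a X ys * HT a (rcons X u) (rcons ys y).
Proof.
have G2 : generic a (y :: ys) by apply: generic_perm (generic_catr gen); rewrite perm_rcons.
rewrite oddHT_relB //; last first.
  move=> k kys; apply/eqP => /(generic_sqr_inj G2); rewrite mem_head in_cons kys orbT.
  by move=> /(_ isT isT) E; have [_ _ _ +] := G2; rewrite E /= kys.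
rewrite [HT a (rcons _ _) _]HT_factor ?size_rcons ?size_ys //.
rewrite (Z2_perm_x a _ (_ : perm_eq (u :: X) (rcons X u))) ?(perm_sym (u :: X)) ?perm_rcons //;
  last by case: G2.
rewrite (Z2_perm_y a _ (_ : perm_eq (y :: ys) (rcons ys y))) ?(perm_sym (y :: ys)) ?perm_rcons //.
by ring.
Qed.

End GenericRelations.

Section Specialization.
Variable F : numFieldType.

(* [f] is a rational function without pole at [0].  As [x^-1] is total, [f] itself is only
   constrained where the denominator does not vanish. *)
Definition regular0 (f : F -> F) := exists p q : {poly F},
  q.[0] != 0 /\ forall t, q.[t] != 0 -> f t = p.[t] / q.[t].

Definition cofinite (P : F -> Prop) :=
  exists2 g : {poly F}, g != 0 & forall t, g.[t] != 0 -> P t.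

Lemma regular0_poly (p : {poly F}) : regular0 (fun t => p.[t]).
Proof. by exists p, 1; rewrite hornerC oner_neq0; split=> // t _; rewrite hornerC divr1. Qed.

Lemma regular0_const c : regular0 (fun=> c).
Proof.
have [p [q [q0 H]]] := regular0_poly c%:P; exists p, q; split=> // t Ht.
by rewrite -H // hornerC.
Qed.

Lemma regular0D f g : regular0 f -> regular0 g -> regular0 (fun t => f t + g t).
Proof.
move=> [p [q [q0 H]]] [p' [q' [q'0 H']]]; exists (p * q' + p' * q), (q * q').
rewrite hornerM mulf_neq0 //; split=> // t; rewrite hornerM mulf_eq0 negb_or => /andP[qt q't].
by rewrite H // H' // hornerD !hornerM; field; rewrite ?qt ?q't.
Qed.

Lemma regular0M f g : regular0 f -> regular0 g -> regular0 (fun t => f t * g t).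
Proof.
move=> [p [q [q0 H]]] [p' [q' [q'0 H']]]; exists (p * p'), (q * q').
rewrite hornerM mulf_neq0 //; split=> // t; rewrite hornerM mulf_eq0 negb_or => /andP[qt q't].
by rewrite H // H' // !hornerM; field; rewrite ?qt ?q't.
Qed.

Lemma regular0V f : f 0 != 0 -> regular0 f -> regular0 (fun t => (f t)^-1).
Proof.
(* The inverse is [q / p]; extending by [q] makes a nonzero denominator imply that [q] is nonzero,
   where [f] is known. *)
move=> f0 [p [q [q0 H]]]; exists (q * q), (p * q).
have p0 : p.[0] != 0 by apply: contraNneq f0 => p0; rewrite H // p0 mul0r.
rewrite hornerM mulf_neq0 //; split=> // t; rewrite hornerM mulf_eq0 negb_or => /andP[pt qt].
by rewrite H // !hornerM; field; rewrite ?pt ?qt.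
Qed.

Lemma regular0_sum (I : Type) (s : seq I) (f : I -> F -> F) :
  (forall i, regular0 (f i)) -> regular0 (fun t => \sum_(i <- s) f i t).
Proof.
move=> H; elim: s => [|i s IH].
  have [p [q [q0 E]]] := regular0_const 0; exists p, q; split=> // t qt.
  by rewrite -E // big_nil.
have [p [q [q0 E]]] := regular0D (H i) IH; exists p, q; split=> // t qt.
by rewrite -E // big_cons.
Qed.

Lemma poly_nat_roots (p : {poly F}) : (forall t, p.[t] = 0) -> p = 0.
Proof.
move=> H; apply: (roots_geq_poly_eq0 (rs := mkseq (fun n => n%:R) (size p))).
- by apply/allP => t _; apply/rootP.
- by rewrite mkseq_uniq // => m n /eqP; rewrite eqr_nat => /eqP.
by rewrite size_mkseq.
Qed.

(** The numerator times [q * g] vanishes everywhere, hence is the zero polynomial, the field being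
    infinite. *)
Lemma regular0_eq0 f : regular0 f -> cofinite (fun t => f t = 0) -> f 0 = 0.
Proof.
move=> [p [q [q0 H]]] [g g0 Hg].
have qn0 : q != 0 by apply: contraNneq q0 => ->; rewrite horner0.
suff p0 : p = 0 by rewrite H // p0 horner0 mul0r.
have : p * (q * g) = 0.
  apply: poly_nat_roots => t; rewrite !hornerM.
  have [->|qt] := eqVneq q.[t] 0; first by rewrite mul0r mulr0.
  have [->|gt] := eqVneq g.[t] 0; first by rewrite !mulr0.
  have := Hg t gt; rewrite H // => /eqP; rewrite mulf_eq0 invr_eq0 (negPf qt) orbF => /eqP ->.
  by rewrite mul0r.
by move/eqP; rewrite mulf_eq0 mulf_eq0 (negPf qn0) (negPf g0) !orbF => /eqP.
Qed.

Lemma cofinite_and P Q : cofinite P -> cofinite Q -> cofinite (fun t => P t /\ Q t).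
Proof.
move=> [g g0 Hg] [h h0 Hh]; exists (g * h) => [|t]; first by rewrite mulf_neq0.
by rewrite hornerM mulf_eq0 negb_or => /andP[/Hg ? /Hh].
Qed.

Lemma cofinite_imp (P Q : F -> Prop) : (forall t, P t -> Q t) -> cofinite P -> cofinite Q.
Proof. by move=> H [g g0 Hg]; exists g => // t /Hg /H. Qed.

Lemma cofinite_all (T : eqType) (s : seq T) (P : T -> F -> Prop) :
  (forall i, i \in s -> cofinite (P i)) -> cofinite (fun t => forall i, i \in s -> P i t).
Proof.
elim: s => [|i s IH] H; first by exists 1 => //; apply: oner_neq0.
have Hs : cofinite (fun t => forall i, i \in s -> P i t).
  by apply: IH => j js; apply: H; rewrite in_cons js orbT.
apply: cofinite_imp (cofinite_and (H i (mem_head _ _)) Hs) => t [Hi Ht] j.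
by rewrite in_cons => /orP[/eqP->|/Ht].
Qed.

Lemma cofinite_neq (p q : {poly F}) : p != q -> cofinite (fun t => p.[t] != q.[t]).
Proof.
move=> pq; exists (p - q); first by rewrite subr_eq0.
by move=> t; rewrite hornerD hornerN subr_eq0.
Qed.

Lemma cofinite_generic (A : {poly F}) (Ps : seq {poly F}) : size A = 2 -> uniq Ps ->
  (forall p, p \in Ps -> exists d, size p = (3 * d.+1).+1) ->
  {in Ps &, injective (fun p : {poly F} => size p)} ->
  cofinite (fun t => generic A.[t] (map (fun p => p.[t]) Ps)).
Proof.
move=> sA UPs sP IP.
have A0 : A != 0 by rewrite -size_poly_gt0 sA.
have P0 p : p \in Ps -> p != 0 by move=> /sP[d E]; rewrite -size_poly_gt0 E.
have deg_mul k p : p \in Ps -> (size (A ^+ k * p ^+ 2)%R).-1 = (k + 2 * (size p).-1)%N.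
  move=> /P0 p0; rewrite size_mul ?expf_neq0 //.
  have Ek := size_exp A k; have E2 := size_exp p 2; rewrite sA in Ek.
  have gk : (0 < size (A ^+ k))%N by rewrite size_poly_gt0 expf_neq0.
  have g2 : (0 < size (p ^+ 2))%N by rewrite size_poly_gt0 expf_neq0.
  move: Ek E2 gk g2; move: (size (A ^+ k)) (size (p ^+ 2)) (size p) => i j n; lia.
(* The degree of [A ^+ k * p ^+ 2] is [k + 6 * (d + 1)] with [k <= 4], so it determines [d], and
   thus [p]. *)
have neq k l p q : (k <= 4)%N -> (l <= 4)%N -> p \in Ps -> q \in Ps -> p != q ->
    A ^+ k * p ^+ 2 != A ^+ l * q ^+ 2.
  move=> Hk Hl pP qP pq; apply: contraNneq pq => E.
  have := deg_mul k p pP; rewrite E deg_mul // => Ed.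
  apply/eqP/IP => //; have [d Ep] := sP p pP; have [e Eq] := sP q qP.
  by move: Ed; rewrite Ep Eq /=; lia.
have CA : cofinite (fun t => A.[t] != 0 /\ A.[t] ^+ 4 != 1).
  apply: cofinite_and; first by have := cofinite_neq A0; apply: cofinite_imp => t; rewrite horner0.
  have A4 : A ^+ 4 != 1.
    by apply/eqP => E; have := size_exp A 4; rewrite E sA size_poly1.
  by have := cofinite_neq A4; apply: cofinite_imp => t; rewrite horner_exp hornerC.
have CP : cofinite (fun t => forall p, p \in Ps -> p.[t] != 0).
  apply: cofinite_all => p pP; have := cofinite_neq (P0 p pP).
  by apply: cofinite_imp => t; rewrite horner0.
have Cneq k l p q : (k <= 4)%N -> (l <= 4)%N -> p \in Ps -> q \in Ps -> p != q ->
    cofinite (fun t => A.[t] ^+ k * p.[t] ^+ 2 != A.[t] ^+ l * q.[t] ^+ 2).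
  move=> Hk Hl pP qP pq; have := cofinite_neq (neq k l p q Hk Hl pP qP pq).
  by apply: cofinite_imp => t; rewrite !hornerM !horner_exp.
have Csep : cofinite (fun t => forall p, p \in Ps -> forall q, q \in Ps ->
    p != q -> sep A.[t] p.[t] q.[t]).
  apply: cofinite_all => p pP; apply: cofinite_all => q qP.
  have [->|pq] := eqVneq p q; first by exists 1; rewrite ?oner_neq0 // => t _; rewrite eqxx.
  have qp : q != p by rewrite eq_sym.
  apply: cofinite_imp (cofinite_and (Cneq 0 0 p q isT isT pP qP pq)
    (cofinite_and (cofinite_and (Cneq 2 0 p q isT isT pP qP pq) (Cneq 2 0 q p isT isT qP pP qp))
      (cofinite_and (Cneq 4 0 p q isT isT pP qP pq) (Cneq 4 0 q p isT isT qP pP qp)))) => t.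
  by rewrite !expr0 !mul1r /sep => -[-> [[-> ->] [-> ->]]].
apply: cofinite_imp (cofinite_and CA (cofinite_and CP Csep)) => t [[At A4t] [Pt St]].
have It : {in Ps &, injective (fun p : {poly F} => p.[t])}.
  move=> p q pP qP E; apply/eqP/negPn/negP => pq.
  by have /and5P[] := St p pP q qP pq; rewrite E eqxx.
split=> //.
- by apply/mapP => -[p /Pt + E]; rewrite -E eqxx.
- by rewrite map_inj_in_uniq.
by move=> _ _ /mapP[p pP ->] /mapP[q qP ->] pq; apply: St => //; apply: contraNneq pq => ->.
Qed.

(** Lists of functions have no Boolean membership, hence [List.In]. *)
Lemma In_cat (w : F -> F) (ws vs : seq (F -> F)) : List.In w (ws ++ vs) -> List.In w ws \/ List.In w vs.
Proof. by elim: ws => [|v ws IH] /=; [right|case=> [->|/IH[]]; auto]. Qed.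

Lemma In_rev (w : F -> F) (ws : seq (F -> F)) : List.In w (rev ws) -> List.In w ws.
Proof.
by elim: ws => //= v ws IH; rewrite rev_cons -cats1 => /In_cat[/IH|[<-|[]]]; auto.
Qed.

Section Models.
Variable A : F -> F.
Hypotheses (A0 : A 0 != 0) (rA : regular0 A).
(** A nonzero value at 0 makes all quotients of parameters, and hence all vertex weights, regular
    there. *)
Definition good (w : F -> F) := w 0 != 0 /\ regular0 w.
Local Notation at_ t ws := (map (fun w : F -> F => w t) ws).
Implicit Types (ws vs : seq (F -> F)).

Lemma regular0_sigma f : f 0 != 0 -> regular0 f -> regular0 (fun t => sigma (f t)).
Proof.
move=> f0 rf; have [p [q [q0 H]]] := regular0D rf (regular0M (regular0_const (-1)) (regular0V f0 rf)).
by exists p, q; split=> // t qt; rewrite -H // mulN1r.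
Qed.

Lemma good_div w v : good w -> good v -> good (fun t => w t / v t).
Proof.
move=> [w0 rw] [v0 rv]; split; first by rewrite mulf_neq0 ?invr_eq0.
exact: regular0M rw (regular0V v0 rv).
Qed.

Lemma regular0_vweight w l r u d : good w -> regular0 (fun t => vweight (A t) (w t) l r u d).
Proof.
move=> [w0 rw]; rewrite /vweight; case: (vtype1 l r u d || vtype2 l r u d).
  by apply: (regular0_sigma (f := fun t => A t * A t)); [rewrite mulf_neq0|apply: regular0M].
case: (vtype3 l r u d || vtype4 l r u d); first by apply: regular0_sigma; [rewrite mulf_neq0|apply: regular0M].
case: (vtype5 l r u d || vtype6 l r u d); last exact: regular0_const.
apply: regular0_sigma; first by rewrite mulf_neq0 ?invr_eq0.
by apply: regular0M => //; apply: regular0V.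
Qed.

Lemma regular0_row ws l us ds r : (forall w, List.In w ws -> good w) ->
  regular0 (fun t => rowZ (A t) (at_ t ws) l us ds r).
Proof.
elim: ws l us ds => [|w ws IH] l us ds H.
  by case: us => [|? ?]; case: ds => [|? ?]; apply: regular0_const.
case: us => [|? ?]; first exact: regular0_const.
case: ds => [|? ?]; first exact: regular0_const.
apply: regular0_sum => b; apply: regular0M; first by apply: regular0_vweight; apply: H; left.
by apply: IH => v Hv; apply: H; right.
Qed.

Lemma regular0_rowx w vs l us ds r : good w -> (forall v, List.In v vs -> good v) ->
  regular0 (fun t => rowZ (A t) (map (fun k => w t / k) (at_ t vs)) l us ds r).
Proof.
move=> gw gv; have [|p [q [q0 H]]] := @regular0_row (map (fun v t => w t / v t) vs) l us ds r.
  by move=> v' /List.in_map_iff[v [<- /gv gv']]; apply: good_div.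
exists p, q; split=> // t qt; rewrite -H // -!map_comp //.
Qed.

Lemma regular0_grid ws vs ls rs us ds :
  (forall w, List.In w ws -> good w) -> (forall v, List.In v vs -> good v) ->
  regular0 (fun t => gridZ (A t) (fun x y => x / y) (at_ t ws) (at_ t vs) ls rs us ds).
Proof.
move=> + gv; elim: ws ls rs us => [|w ws IH] ls rs us gw.
  case: ls => [|? ?]; case: rs => [|? ?]; try exact: regular0_const.
  have [p [q [q0 H]]] := regular0_const ((us == ds) && (size us == size vs))%:R.
  by exists p, q; split=> // t qt; rewrite -H //= size_map.
case: ls => [|l ls]; first exact: regular0_const.
case: rs => [|r rs]; first exact: regular0_const.
have [|p [q [q0 H]]] := @regular0_sum _ (words (size vs)) (fun ms t =>
  rowZ (A t) (map (fun k => w t / k) (at_ t vs)) l us ms r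
  * gridZ (A t) (fun x y => x / y) (at_ t ws) (at_ t vs) ls rs ms ds).
  move=> ms; apply: regular0M; first by apply: regular0_rowx => //; apply: gw; left.
  by apply: IH => v Hv; apply: gw; right.
by exists p, q; split=> // t qt; rewrite -H //= size_map.
Qed.

Lemma regular0_Zd ws vs :
  (forall w, List.In w ws -> good w) -> (forall v, List.In v vs -> good v) ->
  regular0 (fun t => Zd (A t) (at_ t ws) (at_ t vs)).
Proof.
move=> gw gv; rewrite /Zd; have [p [q [q0 H]]] := regular0_grid (nseq (size ws) true)
  (nseq (size ws) false) (nseq (size vs) true) (nseq (size vs) false) gw gv.
by exists p, q; split=> // t qt; rewrite -H // !size_map.
Qed.

Lemma regular0_HT ws vs :
  (forall w, List.In w ws -> good w) -> (forall v, List.In v vs -> good v) ->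
  regular0 (fun t => HT (A t) (at_ t ws) (at_ t vs)).
Proof.
move=> gw gv; have [|p [q [q0 H]]] := @regular0_sum _ (words (size ws)) (fun p t =>
  gridZ (A t) (fun x y => x / y) (at_ t (ws ++ rev ws)) (at_ t vs)
    (nseq (size (ws ++ rev ws)) true) (p ++ rev (map negb p))
    (nseq (size vs) true) (nseq (size vs) false)).
  move=> r; apply: regular0_grid => // w /In_cat[/gw //|/In_rev/gw //].
exists p, q; split=> // t qt; rewrite -H // /HT size_map.
apply: eq_bigr => r _; rewrite map_cat map_rev !size_map !size_cat !size_rev !size_map //.
Qed.

Lemma regular0_oddHT b ws vs w v :
  (forall w, List.In w ws -> good w) -> (forall v, List.In v vs -> good v) -> good w -> good v ->
  regular0 (fun t => oddHT (A t) b (at_ t ws) (w t) (at_ t vs) (v t)).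
Proof.
move=> gw gv gw' gv'; have [|p [q [q0 H]]] := @regular0_sum _ (words (size vs)) (fun es t =>
  \sum_(gs <- words (size vs))
   gridZ (A t) (fun x y => x / y) (at_ t ws) (at_ t (vs ++ v :: rev vs))
    (nseq (size ws) true) (nseq (size ws) false) (nseq (size (vs ++ v :: rev vs)) true)
    (es ++ b :: rev (map negb gs))
   * rowZ (A t) (map (fun k => w t / k) (at_ t vs)) true es gs b).
  move=> es; apply: regular0_sum => gs; apply: regular0M; last exact: regular0_rowx.
  by apply: regular0_grid => // v' /In_cat[/gv //|[<-//|/In_rev/gv //]].
exists p, q; split=> // t qt; rewrite -H // /oddHT !size_map; apply: eq_bigr => es _.
apply: eq_bigr => gs _.
by rewrite map_cat /= map_rev !size_cat /= !size_rev !size_map.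
Qed.

Lemma regular0_htw w : good w -> regular0 (fun t => htw (A t) (w t)).
Proof.
move=> [w0 rw]; apply: regular0M; first exact: regular0_sigma.
by apply: regular0D => //; apply: regular0V.
Qed.

End Models.

Section Relations.
Variables (a : F) (m : nat) (x y : nat -> F).
Hypothesis a0 : a != 0.
Hypothesis x0 : forall k, (k <= m)%N -> x k != 0.
Hypothesis y0 : forall k, (k <= m)%N -> y k != 0.
Let X := mkseq x m.
Let Y := mkseq y m.
Let z := x m / y m.

(* The exponents are distinct multiples of 3, and [Ap] enters the genericity conditions at
   most to the power 4: the two sides of each condition, of the form
   [Ap ^+ k * p ^+ 2 != q ^+ 2], therefore have distinct degrees. *)
Let Ap : {poly F} := a%:P + 'X.
Let xp k : {poly F} := (x k)%:P + 'X^(3 * (2 * k).+1).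
Let yp k : {poly F} := (y k)%:P + 'X^(3 * (2 * k).+2).
Let hp (p : {poly F}) : F -> F := fun t => p.[t].

Let size_shift c d : (0 < d)%N -> size (c%:P + 'X^d : {poly F}) = d.+1.
Proof.
by move=> d0; rewrite addrC size_polyDl size_polyXn // ltnS (leq_trans (size_polyC_leq1 _)).
Qed.

Let generic_path : cofinite (fun t => generic Ap.[t]
  (rcons (mkseq (fun k => (xp k).[t]) m) (xp m).[t]
   ++ rcons (mkseq (fun k => (yp k).[t]) m) (yp m).[t])).
Proof.
have sx k : size (xp k) = (3 * (2 * k).+1).+1 by rewrite size_shift.
have sy k : size (yp k) = (3 * (2 * k).+2).+1 by rewrite size_shift.
have Ix : injective xp by move=> j k E; have := sx j; rewrite E sx; lia.
have Iy : injective yp by move=> j k E; have := sy j; rewrite E sy; lia.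
apply: cofinite_imp (@cofinite_generic Ap (mkseq xp m.+1 ++ mkseq yp m.+1) _ _ _ _) => [t|||p|p q].
- by rewrite !mkseqS map_cat !map_rcons /mkseq -!map_comp.
- by rewrite (size_shift a (d := 1)).
- rewrite cat_uniq; apply/and3P; split; [exact: mkseq_uniq| |exact: mkseq_uniq].
  apply/hasPn => _ /mapP[k _ ->].
  by apply/mapP => -[j _ E]; have := sy k; rewrite E sx; lia.
- by rewrite mem_cat => /orP[]/mapP[k _ ->]; [exists (2 * k)%N|exists (2 * k).+1].
rewrite !mem_cat => /orP[]/mapP[k _ ->] /orP[]/mapP[j _ ->]; rewrite ?sx ?sy => E.
- by congr xp; lia.
- by exfalso; lia.
- by exfalso; lia.
by congr yp; lia.
Qed.

Let xp0 k : (xp k).[0] = x k.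
Proof. by rewrite hornerD hornerC hornerXn expr0n addr0. Qed.

Let yp0 k : (yp k).[0] = y k.
Proof. by rewrite hornerD hornerC hornerXn expr0n addr0. Qed.

Let Ap0 : Ap.[0] = a. Proof. by rewrite hornerD hornerC hornerX addr0. Qed.

Let good_mkseq (h : nat -> {poly F}) n : (forall k, (k < n)%N -> (h k).[0] != 0) ->
  forall w, List.In w (mkseq (fun k => hp (h k)) n) -> good w.
Proof.
elim: n => // n IH H w; rewrite mkseqS -cats1 => /In_cat[/IH|[<-|[]]].
  by apply=> k Hk; apply: H; apply: ltnW.
by split; [apply: H|apply: regular0_poly].
Qed.

Let xs := mkseq (fun k => hp (xp k)) m.
Let ys := mkseq (fun k => hp (yp k)) m.

Let good_xs w : List.In w (rcons xs (hp (xp m))) -> good w.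
Proof.
by rewrite -(mkseqS (fun k => hp (xp k))); apply: good_mkseq => k Hk; rewrite xp0 x0.
Qed.

Let good_ys w : List.In w (rcons ys (hp (yp m))) -> good w.
Proof.
by rewrite -(mkseqS (fun k => hp (yp k))); apply: good_mkseq => k Hk; rewrite yp0 y0.
Qed.

Let two_neq0 : 2%:R != 0 :> F. Proof. by rewrite pnatr_eq0. Qed.

Let at_path n (h : nat -> {poly F}) t :
  map (fun w : F -> F => w t) (mkseq (fun k => hp (h k)) n) = mkseq (fun k => (h k).[t]) n.
Proof. by rewrite /mkseq -map_comp. Qed.

Let good_cat : [/\ forall w, List.In w xs -> good w, forall w, List.In w ys -> good w,
  good (hp (xp m)) & good (hp (yp m))].
Proof.
have In_rcons (w v : F -> F) s : List.In w s \/ w = v -> List.In w (rcons s v).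
  elim: s => [|v' s IH] /=; first by case=> [[]|->]; left.
  by case=> [[->|Hw]|Hw]; [left|right; apply: IH; left|right; apply: IH; right].
by split=> [w H|w H||]; [apply: good_xs|apply: good_ys|apply: good_xs|apply: good_ys];
  apply: In_rcons; auto.
Qed.

Let A0 : hp Ap 0 != 0. Proof. by rewrite /hp Ap0. Qed.
Let rA : regular0 (hp Ap). Proof. exact: regular0_poly. Qed.

Let good_z : good (fun t => hp (xp m) t / hp (yp m) t).
Proof. by case: good_cat => _ _ gx gy; apply: good_div. Qed.

Let regular_sigma2 : regular0 (fun t => sigma (hp Ap t ^+ 2)).
Proof.
by apply: (regular0_sigma (f := fun t => hp Ap t * hp Ap t)); [rewrite mulf_neq0|apply: regular0M].
Qed.

(** Along the curve the difference of both sides is a rational function regular at 0 that vanishes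
    at all but finitely many points, hence also at 0. The parameter [a] moves too, because
    genericity excludes values such as [a ^+ 4 = 1]. *)
Lemma relation_A :
  Zd a X Y * (sigma (a ^+ 2) * oddHT a true X (x m) Y (y m)
    + htw a z * oddHT a false X (x m) Y (y m))
  = Zd a (rcons X (x m)) (rcons Y (y m)) * HT a X Y.
Proof.
have [gx gy gxm gym] := good_cat.
(* The difference is written with [-1 *] to fit the closure of [regular0] under sums and
   products. *)
pose f t := Zd (hp Ap t) (map (fun w : F -> F => w t) xs) (map (fun w : F -> F => w t) ys)
  * (sigma (hp Ap t ^+ 2) * oddHT (hp Ap t) true (map (fun w : F -> F => w t) xs) (hp (xp m) t)
       (map (fun w : F -> F => w t) ys) (hp (yp m) t)
     + htw (hp Ap t) (hp (xp m) t / hp (yp m) t)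
       * oddHT (hp Ap t) false (map (fun w : F -> F => w t) xs) (hp (xp m) t)
       (map (fun w : F -> F => w t) ys) (hp (yp m) t))
  + -1 * (Zd (hp Ap t) (map (fun w : F -> F => w t) (rcons xs (hp (xp m))))
        (map (fun w : F -> F => w t) (rcons ys (hp (yp m))))
      * HT (hp Ap t) (map (fun w : F -> F => w t) xs) (map (fun w : F -> F => w t) ys)).
have rf : regular0 f.
  apply: regular0D; first apply: regular0M.
  - exact: regular0_Zd.
  - apply: regular0D; apply: regular0M; rewrite //; try exact: regular0_oddHT.
    exact: regular0_htw.
  apply: regular0M; first exact: regular0_const.
  by apply: regular0M; [apply: regular0_Zd|apply: regular0_HT].
have f0 : f 0 = 0.
  apply: regular0_eq0 rf _; apply: cofinite_imp generic_path => t G.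
  rewrite /f !map_rcons !at_path /hp generic_relA // ?size_mkseq //.
  by rewrite mulN1r subrr.
move: f0; rewrite /f !map_rcons !at_path /hp !xp0 !yp0 Ap0 mulN1r => /eqP.
rewrite subr_eq0 => /eqP.
by rewrite (eq_mkseq xp0) (eq_mkseq yp0).
Qed.

Lemma relation_B :
  Zd a (rcons X (x m)) (rcons Y (y m)) * (htw a z * oddHT a true X (x m) Y (y m)
    + sigma (a ^+ 2) * oddHT a false X (x m) Y (y m))
  = Zd a X Y * HT a (rcons X (x m)) (rcons Y (y m)).
Proof.
have [gx gy gxm gym] := good_cat.
pose f t := Zd (hp Ap t) (map (fun w : F -> F => w t) (rcons xs (hp (xp m))))
        (map (fun w : F -> F => w t) (rcons ys (hp (yp m))))
  * (htw (hp Ap t) (hp (xp m) t / hp (yp m) t)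
       * oddHT (hp Ap t) true (map (fun w : F -> F => w t) xs) (hp (xp m) t)
       (map (fun w : F -> F => w t) ys) (hp (yp m) t)
     + sigma (hp Ap t ^+ 2) * oddHT (hp Ap t) false (map (fun w : F -> F => w t) xs) (hp (xp m) t)
       (map (fun w : F -> F => w t) ys) (hp (yp m) t))
  + -1 * (Zd (hp Ap t) (map (fun w : F -> F => w t) xs) (map (fun w : F -> F => w t) ys)
      * HT (hp Ap t) (map (fun w : F -> F => w t) (rcons xs (hp (xp m))))
        (map (fun w : F -> F => w t) (rcons ys (hp (yp m))))).
have rf : regular0 f.
  apply: regular0D; first apply: regular0M.
  - exact: regular0_Zd.
  - apply: regular0D; apply: regular0M; rewrite //; try exact: regular0_oddHT.
    exact: regular0_htw.
  apply: regular0M; first exact: regular0_const.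
  by apply: regular0M; [apply: regular0_Zd|apply: regular0_HT].
have f0 : f 0 = 0.
  apply: regular0_eq0 rf _; apply: cofinite_imp generic_path => t G.
  rewrite /f !map_rcons !at_path /hp generic_relB // ?size_mkseq //.
  by rewrite mulN1r subrr.
move: f0; rewrite /f !map_rcons !at_path /hp !xp0 !yp0 Ap0 mulN1r => /eqP.
rewrite subr_eq0 => /eqP.
by rewrite (eq_mkseq xp0) (eq_mkseq yp0).
Qed.

Hypothesis sigma_a : sigma a != 0.
Hypothesis sigma_az : sigma (a * (x m / y m)) != 0.
Hypothesis sigma_azV : sigma (a * (y m / x m)) != 0.
Hypothesis Zm : Zdw a m x y != 0.
Hypothesis ZmS : Zdw a m.+1 x y != 0.

Lemma ZHT_odd_factor :
  ZHTplus a m x y =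
    ((a + a^-1) * Zdw a m.+1 x y * ZHT2 a m x y
     - (x m / y m + y m / x m) * Zdw a m x y * ZHT2 a m.+1 x y)
    / (sigma a * sigma (a * (x m / y m)) * sigma (a * (y m / x m)))
  /\
  ZHTminus a m x y =
    (- (x m / y m + y m / x m) * Zdw a m.+1 x y * ZHT2 a m x y
     + (a + a^-1) * Zdw a m x y * ZHT2 a m.+1 x y)
    / (sigma a * sigma (a * (x m / y m)) * sigma (a * (y m / x m))).
Proof.
have xm := x0 (leqnn m); have ym := y0 (leqnn m).
have HA := relation_A; have HB := relation_B.
rewrite /ZHTplus /ZHTminus /ZHT2 !ZHT_oddE !ZHT_evenE.
move: Zm ZmS; rewrite !ZdwE !mkseqS -/X -/Y => D0 E0.
move: HA HB; set P := oddHT a true _ _ _ _; set M := oddHT a false _ _ _ _.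
set D := Zd a X Y; set E := Zd a _ _ => HA HB.
(* Dividing the relations by the nonzero domain-wall functions gives the linear system for [P] and
   [M]; substituting it into the stated formulas leaves rational identities. *)
have EA : E * (HT a X Y / D) = sigma (a ^+ 2) * P + htw a z * M.
  by rewrite mulrA -HA mulrAC mulfV // mul1r.
have EB : D * (HT a (rcons X (x m)) (rcons Y (y m)) / E) = htw a z * P + sigma (a ^+ 2) * M.
  by rewrite mulrA -HB mulrAC mulfV // mul1r.
have nz : sigma a * sigma (a * (x m / y m)) * sigma (a * (y m / x m)) != 0.
  by rewrite !mulf_neq0.
rewrite -![_ * E * _]mulrA -![_ * D * _]mulrA EA EB.
split; apply: (mulIf nz); rewrite mulfVK // /htw /z /sigma.
  by field; rewrite ?a0 ?xm ?ym ?oner_neq0.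
by field; rewrite ?a0 ?xm ?ym ?oner_neq0.
Qed.
End Relations.
End Specialization.

Theorem theorem2 (R : realType) (a : R[i]) (m : nat) (x y : nat -> R[i]) :
  a != 0 ->
  (forall k, (k <= m)%N -> x k != 0) ->
  (forall k, (k <= m)%N -> y k != 0) ->
  sigma a != 0 ->
  sigma (a * (x m / y m)) != 0 ->
  sigma (a * (y m / x m)) != 0 ->
  Zdw a m x y != 0 ->
  Zdw a m.+1 x y != 0 ->
  ZHTplus a m x y =
    ((a + a^-1) * Zdw a m.+1 x y * ZHT2 a m x y
     - (x m / y m + y m / x m) * Zdw a m x y * ZHT2 a m.+1 x y)
    / (sigma a * sigma (a * (x m / y m)) * sigma (a * (y m / x m)))
  /\
  ZHTminus a m x y =
    (- (x m / y m + y m / x m) * Zdw a m.+1 x y * ZHT2 a m x y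
     + (a + a^-1) * Zdw a m x y * ZHT2 a m.+1 x y)
    / (sigma a * sigma (a * (x m / y m)) * sigma (a * (y m / x m))).
Proof. exact: ZHT_odd_factor. Qed.
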